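(* Let $n\ge3$. The Haglund–Loehr zeta map of type $D_n$, $\zeta_D:\operatorname{Vert}(D_n)\to\operatorname{Diag}(D_n)$, $(\pi,v)\mapsto(\zeta_D(\pi),d_D(\pi,v))$, is a (well-defined) bijection from vertically labelled signed lattice paths to diagonally labelled signed ballot paths.
   Context: Signed permutations: $\mathfrak S_n^B$ is the group of bijections $w$ of $\{\pm1,\dots,\pm n\}$ with $w(-i)=-w(i)$, written $[w(1),\dots,w(n)]$; $\mathfrak S_n^D$ is the subgroup of those with an even number of $i\in[n]$ with $w(i)<0$. Rise $i$ of a path: its $i$-th North step is immediately followed by a North step; valley $(i,j)$: its $i$-th East step is immediately followed by its $j$-th North step, and additionally, if a ballot path with $i$ East and $j$ North steps ends with an East step, $(i,j+1)$ counts as a valley (signed East steps $E^\pm$ count as East steps). A signed lattice path is a word with $n-1$ East steps and $n$ North steps, except that if its first step is East, this step is replaced by $E^+$ or $E^-$; the set is $\mathcal L^\bullet_{n-1,n}$ and $\epsilon(\pi)=-1$ if $\pi$ contains $E^-$, else $1$. For such $\pi$ let $\pi_i$ be the number of East steps before the $i$-th North step and set $\lambda_1=\epsilon(\pi)\pi_1$, $\lambda_i=\pi_i$ for $1<i<n$, $\lambda_n=2\pi_n-\pi_{n-1}$ if $\pi_1+\dots+\pi_{n-2}$ is even and $\lambda_n=2n-1-2\pi_n+\pi_{n-1}$ otherwise. If $n-1\equiv0,3\pmod 4$ let $\nu=(0,1,\dots,n-2,n-1)$; if $n-1\equiv1,2\pmod4$ let $\nu=(0,1,\dots,n-2,n)$.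 The area vector $\mu$ is $\mu=(\lambda_1,\lambda_2-1,\dots,\lambda_{n-1}-(n-2),\lambda_n-(n-1))$ if $n-1\equiv0,3\pmod4$ and $\mu=(-\lambda_1,\lambda_2-1,\dots,\lambda_{n-1}-(n-2),n-\lambda_n)$ if $n-1\equiv1,2\pmod4$. For $a\in\mathbb Z^n$, $j\ge0$: $\overrightarrow{S}^+_j(a)$ reads $a$ left to right writing $N$ for entries $j$ and $E$ for entries $j+1$; $\overleftarrow{S}^+_j(a)$ reads right to left; $\overrightarrow{S}^-_j,\overleftarrow{S}^-_j$ likewise with $N$ for $-j$ and $E$ for $-j-1$. $\zeta_D(\pi)$: take $\overleftarrow{S}^-_{2n-1}(\mu)\overrightarrow{S}^+_{2n-1}(\mu)\overleftarrow{S}^-_{2n-2}(\mu)\overrightarrow{S}^+_{2n-2}(\mu)\cdots\overleftarrow{S}^-_0(\mu)\overrightarrow{S}^+_0(\mu)$, delete its last letter, and if the $n$-th North step is immediately followed by an East step, replace that East step by $E^+$ if $\#\{r:\mu_r>0\}$ is even and by $E^-$ if it is odd. A signed ballot path is a word of length $2n-1$ in $\{N,E\}$ all of whose prefixes have at least as many $N$'s as $E$'s, except that if its $n$-th North step is immediately followed by an East step, this East step is replaced by $E^+$ or $E^-$; set $\mathcal B^\bullet_{2n-1}$, sign $\epsilon(\beta)$ as before. $\operatorname{Vert}(D_n)$: pairs $(\pi,v)$ with $\pi\in\mathcal L^\bullet_{n-1,n}$, $v\in\mathfrak S_n^B$, such that $v(i)<v(i+1)$ for each rise $i$ of $\pi$,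 $|v(1)|<v(2)$ if $\pi$ begins with two North steps, and $\prod_{i=1}^n\operatorname{sgn}(v(i))=\epsilon(\pi)(-1)^{\lambda_{n-1}+\lambda_n}$. Diagonal reading word $d_D(\pi,v)$: for $i=0,1,2,\dots$ first write $v(j)$ for all rows $j$ with $\mu_j=-i$ in increasing order of $j$, then $-v(j)$ for all rows $j$ with $\mu_j=i+1$ in decreasing order of $j$; then multiply the entry coming from row $n$ by $(-1)^{1+\mu_{n-1}+\mu_n}$ and the entry coming from row $1$ by $\epsilon(\pi)(-1)^{1+\nu_{n-1}+\nu_n}$; finally change the sign of the first entry if $\mu$ has an odd number of positive entries. The result is the window of $d_D(\pi,v)$. $\operatorname{Diag}(D_n)$: pairs $(\beta,w)$ with $\beta\in\mathcal B^\bullet_{2n-1}$, $w\in\mathfrak S_n^D$, such that for each valley $(i,j)$ of $\beta$: $w(n+1-i)>w(n+1-j)$ if $j\le n-1$, $>\epsilon(\beta)w(1)$ if $j=n$, $>-\epsilon(\beta)w(1)$ if $j=n+1$, $>w(n-j)$ if $j\ge n+2$ (with $w(-k)=-w(k)$); and moreover $w(n+1-i)>|w(1)|$ if $\beta$ has a valley $(i,n)$ and its $n$-th North step is not followed by an East step. *)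

(* Defs.v *)
From HB Require Import structures.
From mathcomp Require Import all_boot all_order all_algebra all_fingroup.

Set Implicit Arguments.
Unset Strict Implicit.
Unset Printing Implicit Defensive.

Import Order.TTheory GRing.Theory Num.Theory.
Local Open Scope ring_scope.

(* (b, i) stands for the integer (-1)^b * (i + 1), as i : 'I_n starts at 0. *)
Definition pm (n : nat) : finType := (bool * 'I_n)%type.

Definition pm_val n (x : pm n) : int := (-1) ^+ x.1 * (x.2.+1)%:Z.

Definition pm_opp n (x : pm n) : pm n := (~~ x.1, x.2).

Definition SB n : {set {perm pm n}} :=
  [set w : {perm pm n} | [forall x, w (pm_opp x) == pm_opp (w x)]].

(* The integer w(k), for 1 <= |k| <= n; never used for other values of k. *)
Definition sapp n (w : {perm pm n}) (k : int) : int :=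
  if insub `|k|.-1 is Some i then pm_val (w (k < 0, i)) else 0.

Definition window n (w : {perm pm n}) : seq int :=
  [seq sapp w k%:Z | k <- iota 1 n].

Definition SD n : {set {perm pm n}} :=
  [set w in SB n | ~~ odd (count (fun x : int => x < 0) (window w))].

(* Ep and Em are the signed East steps E^+ and E^-. *)
Inductive letter := N | E | Ep | Em.

Definition letter_code (x : letter) : bool * bool :=
  match x with
  | N => (false, false) | E => (false, true)
  | Ep => (true, false) | Em => (true, true)
  end.

Definition letter_decode (c : bool * bool) : letter :=
  match c with
  | (false, false) => N | (false, true) => E
  | (true, false) => Ep | (true, true) => Em
  end.

Lemma letter_codeK : cancel letter_code letter_decode.
Proof. by case. Qed.

HB.instance Definition _ := Finite.copy letter (can_type letter_codeK).

Definition is_east (x : letter) : bool := x != N.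
Definition is_signed (x : letter) : bool := (x == Ep) || (x == Em).

Definition num_north (p : seq letter) : nat := count_mem N p.
Definition num_east (p : seq letter) : nat := count is_east p.

(* Steps are counted from 1, positions in the word from 0.  A step that does
   not exist gets position [size p], where [onth] returns [None]. *)
Definition north_pos (p : seq letter) (i : nat) : nat :=
  nth (size p) [seq k <- iota 0 (size p) | nth E p k == N] i.-1.
Definition east_pos (p : seq letter) (i : nat) : nat :=
  nth (size p) [seq k <- iota 0 (size p) | is_east (nth N p k)] i.-1.

Definition rises (p : seq letter) : seq nat :=
  [seq i <- iota 1 (num_north p) | onth p (north_pos p i).+1 == Some N].

Definition is_valley (p : seq letter) (ij : nat * nat) : bool :=
  let: (i, j) := ij in
  [&& (1 <= i <= num_east p)%N, (1 <= j <= num_north p)%N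
    & north_pos p j == (east_pos p i).+1]
  || [&& is_east (last N p), i == num_east p & j == (num_north p).+1].

Definition valleys (p : seq letter) : seq (nat * nat) :=
  [seq ij <- [seq (i, j) | i <- iota 1 (num_east p),
                           j <- iota 1 (num_north p).+1]
  | is_valley p ij].

(* The step at position k carries a sign if it exists and is an East step;
   no other step carries a sign. *)
Definition signed_only_at (k : nat) (p : seq letter) : bool :=
  all (fun i => is_signed (nth N p i) == (i == k) && is_east (nth N p i))
      (iota 0 (size p)).

Definition eps (p : seq letter) : int := if Em \in p then -1 else 1.

Definition signed_lattice_path (n : nat) (p : seq letter) : bool :=
  [&& num_east p == n.-1, num_north p == n & signed_only_at 0 p].

Definition signed_ballot_path (n : nat) (b : seq letter) : bool :=
  [&& size b == (2 * n).-1,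
      all (fun k => num_east (take k b) <= num_north (take k b))%N
          (iota 0 (size b).+1)
    & signed_only_at (north_pos b n).+1 b].

(* Vectors indexed by 1, ..., n are written as functions on nat. *)
Definition easts_before (p : seq letter) (i : nat) : nat :=
  num_east (take (north_pos p i) p).

Definition lam (n : nat) (p : seq letter) (i : nat) : int :=
  let a := easts_before p in
  if i == 1%N then eps p * (a 1%N)%:Z
  else if (i < n)%N then (a i)%:Z
  else if ~~ odd (\sum_(1 <= k < n.-1) a k)
       then 2 * (a n)%:Z - (a n.-1)%:Z
       else 2 * n%:Z - 1 - 2 * (a n)%:Z + (a n.-1)%:Z.

Definition cond03 (n : nat) : bool := (n.-1 %% 4 \in [:: 0; 3])%N.

Definition nu (n i : nat) : int :=
  if (i < n)%N then i%:Z - 1 else if cond03 n then n%:Z - 1 else n%:Z.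

Definition mu (n : nat) (p : seq letter) (i : nat) : int :=
  if cond03 n then lam n p i - (i%:Z - 1)
  else if i == 1%N then - lam n p 1
  else if (i < n)%N then lam n p i - (i%:Z - 1)
  else n%:Z - lam n p n.

Definition area (n : nat) (p : seq letter) : seq int :=
  [seq mu n p i | i <- iota 1 n].

Definition odd_pos_area (n : nat) (p : seq letter) : bool :=
  odd (count (fun x : int => 0 < x) (area n p)).

Definition S_plus (j : nat) (a : seq int) : seq letter :=
  pmap (fun x : int => if x == j%:Z then Some N
                       else if x == j%:Z + 1 then Some E else None) a.

Definition S_minus_rev (j : nat) (a : seq int) : seq letter :=
  pmap (fun x : int => if x == - j%:Z then Some N
                       else if x == - j%:Z - 1 then Some E else None) (rev a).

Definition zetaD_word (n : nat) (p : seq letter) : seq letter :=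
  let w := flatten [seq S_minus_rev j (area n p) ++ S_plus j (area n p)
                   | j <- rev (iota 0 (2 * n))] in
  take (size w).-1 w.

Definition zetaD (n : nat) (p : seq letter) : seq letter :=
  let w := zetaD_word n p in
  let k := (north_pos w n).+1 in
  if onth w k == Some E
  then set_nth N w k (if odd_pos_area n p then Em else Ep)
  else w.

Definition is_vert (n : nat) (x : seq letter * {perm pm n}) : bool :=
  let: (p, v) := x in
  [&& signed_lattice_path n p, v \in SB n,
      all (fun i : nat => sapp v i < sapp v i.+1) (rises p),
      (take 2 p == [:: N; N]) ==> (`|sapp v 1| < sapp v 2)
    & \prod_(1 <= i < n.+1) Num.sg (sapp v i)
        == eps p * (-1) ^ (lam n p n.-1 + lam n p n)].

Definition Vert (n : nat) := {x : seq letter * {perm pm n} | is_vert x}.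

(* The entries of the reading word before any sign changes, each paired with
   the row it comes from.  All |mu_j| are at most n, so i < 2n suffices. *)
Definition rows_word (n : nat) (p : seq letter) (v : {perm pm n}) :
    seq (nat * int) :=
  flatten
    [seq [seq (j, sapp v j%:Z) | j <- iota 1 n & mu n p j == - i%:Z]
         ++ [seq (j, - sapp v j%:Z) | j <- rev (iota 1 n) & mu n p j == i%:Z + 1]
    | i <- iota 0 (2 * n)].

Definition row_sign (n : nat) (p : seq letter) (j : nat) : int :=
  (if j == n then (-1) ^ (1 + mu n p n.-1 + mu n p n) else 1)
  * (if j == 1%N then eps p * (-1) ^ (1 + nu n n.-1 + nu n n) else 1).

Definition opp_head (s : seq int) : seq int :=
  if s is x :: s' then - x :: s' else [::].

Definition dD (n : nat) (p : seq letter) (v : {perm pm n}) : seq int :=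
  let s := [seq row_sign n p jx.1 * jx.2 | jx <- rows_word p v] in
  if odd_pos_area n p then opp_head s else s.

Definition valley_rhs (n : nat) (b : seq letter) (w : {perm pm n}) (j : nat) :
    int :=
  if (j <= n.-1)%N then sapp w (n%:Z + 1 - j%:Z)
  else if j == n then eps b * sapp w 1
  else if j == n.+1 then - eps b * sapp w 1
  else sapp w (n%:Z - j%:Z).

Definition north_then_east (b : seq letter) (i : nat) : bool :=
  if onth b (north_pos b i).+1 is Some x then is_east x else false.

Definition is_diag (n : nat) (x : seq letter * {perm pm n}) : bool :=
  let: (b, w) := x in
  [&& signed_ballot_path n b, w \in SD n,
      all (fun ij : nat * nat =>
             sapp w (n%:Z + 1 - ij.1%:Z) > valley_rhs b w ij.2) (valleys b)
    & all (fun ij : nat * nat =>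
             (ij.2 == n) && ~~ north_then_east b n
             ==> (sapp w (n%:Z + 1 - ij.1%:Z) > `|sapp w 1|)) (valleys b)].

Definition Diag (n : nat) := {x : seq letter * {perm pm n} | is_diag x}.

(* Main.v *)
(* Let h = 2n - 2 be the Coxeter number of D_n and rho = (0, 1, ..., n - 1).
   The area vector mu of a path is a vector such that mu + rho lies in the
   closed fundamental alcove dilated by h + 1; put z = rho - h mu.  Sorting
   the letters of zeta_D(pi) by an integer key shows that an East step precedes
   a North step exactly when a certain root of type D takes a value larger than
   h on z, and that the valleys of zeta_D(pi) are the minimal such roots.  A
   positive affine root of height at least 2 on which the linear form
   associated with mu is negative splits into two positive affine roots on
   which it is at most 0.  Hence
   - a minimal root has value exactly h + 1 on z, that is, it comes from an
     affine simple root vanishing on mu + rho, that is, from a rise of pi; so,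
     for a fixed path, the reading word only permutes the labels, up to signs,
     and it turns the conditions at the rises into those at the valleys;
   - a root with value larger than k h on z is a sum of k roots with value
     larger than h, so zeta_D(pi) determines all levels of z, and therefore z
     and pi.
   Finally there are C(2n-1, n) + C(2n-2, n) signed lattice paths, and at most
   as many signed ballot paths, so zeta_D is onto. *)

Require Import Defs.
From mathcomp Require Import all_boot all_order all_algebra all_fingroup.
From mathcomp Require Import zify ring.

Set Implicit Arguments.
Unset Strict Implicit.
Unset Printing Implicit Defensive.

Import Order.TTheory GRing.Theory Num.Theory.
Local Open Scope ring_scope.

(** * Type D roots and affine heights *)

(** The obstacle is the pair [x], [pm_opp x]: the word of zeta compares it like any other two
    entries, but its difference is not a root of type D, and in row 0 [rho] does not even separate
    the two. Hence two functions: [ckey], which has no ties, sorts the letters, and [zz] carries the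
    geometry; they agree on distinct rows ([ckey_zz]). The discrepancy survives only at the two
    middle ranks [n-1] and [n], always held by a pair of opposite entries. There it meets the
    special clauses of the definitions: the signed East step, the sign change of the first window
    entry, and the condition with the absolute value of [w(1)]. The deletion of the last letter has
    the same source. Prolonged to 4n letters, the word is symmetric under exchanging the North step
    of [x] with the East step of [pm_opp x]; the rank sums below [2n-1] meet each root once, and the
    sum [2n-1], removed with the last letter, is that of a pair [x], [pm_opp x]. *)

Definition rho n (x : pm n) : int := if x.1 then - (x.2 : nat)%:Z else (x.2 : nat)%:Z.
Definition ext n (m : nat -> int) (x : pm n) : int :=
  if x.1 then - m x.2 else m x.2.
Definition cox (n : nat) : int := 2 * n%:Z - 2.
Definition zz n (m : nat -> int) (x : pm n) : int := rho x - cox n * ext m x.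

(* The affine root (x, y, k) is [e_y - e_x + k delta], in the basis where
   [e_(pm_opp x) = - e_x]; it is a root of type D only when [x.2 != y.2]. *)
Definition aht n (x y : pm n) (k : int) : int := rho y - rho x + cox n * k.
Definition aphi n (m : nat -> int) (x y : pm n) (k : int) : int :=
  ext m y - ext m x + k.

Lemma pm_oppK n : involutive (@pm_opp n).
Proof. by case=> b i; rewrite /pm_opp /= negbK. Qed.

Lemma rho_opp n (x : pm n) : rho (pm_opp x) = - rho x.
Proof. by case: x => [[] i]; rewrite /rho /= ?opprK. Qed.

Lemma ext_opp n m (x : pm n) : ext m (pm_opp x) = - ext m x.
Proof. by case: x => [[] i]; rewrite /ext /= ?opprK. Qed.

Lemma zz_opp n m (x : pm n) : zz m (pm_opp x) = - zz m x.
Proof. by rewrite /zz rho_opp ext_opp; ring. Qed.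

Lemma zz_diff n m (x y : pm n) k :
  zz m y - zz m x = aht x y k - cox n * aphi m x y k.
Proof. by rewrite /zz /aht /aphi; ring. Qed.

Ltac root_lia :=
  repeat match goal with H : forall _, _ |- _ => clear H end;
  repeat match goal with
  | |- context [aht ?a ?b ?c] => generalize dependent (aht a b c); intros
  | H : context [aht ?a ?b ?c] |- _ => generalize dependent (aht a b c); intros
  | |- context [aphi ?m ?a ?b ?c] => generalize dependent (aphi m a b c); intros
  | H : context [aphi ?m ?a ?b ?c] |- _ =>
      generalize dependent (aphi m a b c); intros
  end; lia.

Section Roots.
Variables (n : nat) (m : nat -> int).
Hypothesis n3 : (2 < n)%N.

Local Notation h := (cox n).
Implicit Types (x y w : pm n) (k l : int).

Lemma aht_opp x y k : aht (pm_opp y) (pm_opp x) k = aht x y k.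
Proof. by rewrite /aht !rho_opp; ring. Qed.

Lemma aphi_opp x y k : aphi m (pm_opp y) (pm_opp x) k = aphi m x y k.
Proof. by rewrite /aphi !ext_opp; ring. Qed.

Lemma aht_add x y w k l : aht x w l + aht w y (k - l) = aht x y k.
Proof. by rewrite /aht; ring. Qed.

Lemma aphi_add x y w k l : aphi m x w l + aphi m w y (k - l) = aphi m x y k.
Proof. by rewrite /aphi; ring. Qed.

(** The largest difference is (n-1) + (n-2) = h - 1, the height of the highest root. Zero is
    excluded because [rho] has the row number as absolute value. *)
Lemma rho_diff x y : x.2 != y.2 ->
  [/\ rho y - rho x != 0, - h < rho y - rho x & rho y - rho x < h].
Proof.
case: x => b i; case: y => c j /= ij; have := ltn_ord i; have := ltn_ord j.
have {ij} : (i : nat) <> j by move=> e; move/eqP: ij; apply; apply: val_inj.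
by rewrite /rho /cox /=; case: b; case: c; split; lia.
Qed.

(** The affine roots of height strictly between 0 and h are the positive roots and [delta] minus a
    positive root. *)
Lemma aht_level x y k : x.2 != y.2 -> 0 < aht x y k < h ->
  (k = 0 /\ 0 < rho y - rho x) \/ (k = 1 /\ rho y - rho x < 0).
Proof.
move=> /rho_diff []; rewrite /aht; have : 0 < h by rewrite /cox; lia.
move: h (rho y - rho x) => H r; case: (ltrgtP k 0) => k0; nia.
Qed.

Lemma aht_exists x y : x.2 != y.2 -> exists k, 0 < aht x y k < h.
Proof.
move=> /rho_diff [r0 r1 r2]; have h0 : 0 < h by rewrite /cox; lia.
case: (ltrP 0 (rho y - rho x)) => r3; [exists 0 | exists 1]; rewrite /aht; lia.
Qed.

Lemma aht_neq0 x y k : x.2 != y.2 -> aht x y k != 0.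
Proof.
move=> /rho_diff []; rewrite /aht; have : 0 < h by rewrite /cox; lia.
move: h (rho y - rho x) => H r; case: (ltrgtP k 0) => k0; nia.
Qed.

Lemma zz_diff_neq x y k : x.2 != y.2 -> zz m y - zz m x != h * k.
Proof.
move=> xy; rewrite (zz_diff _ _ _ 0) /aphi addr0.
have := @aht_neq0 x y (- (ext m y - ext m x + k)) xy.
apply: contra_neq; rewrite /aht => e.
have {e} : rho y - rho x = h * (ext m y - ext m x + k) by rewrite mulrDr -e; ring.
by move=> ->; ring.
Qed.

Lemma root_wlog (P : pm n -> pm n -> Prop) :
  (forall x y, P (pm_opp y) (pm_opp x) -> P x y) ->
  (forall x y, (x.2 < y.2)%N -> P x y) ->
  forall x y, x.2 != y.2 -> P x y.
Proof.
move=> Po Pl x y; case: (ltngtP x.2 y.2) => [/Pl//|l _|/val_inj->].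
  by apply: Po; apply: Pl.
by rewrite eqxx.
Qed.

Definition between x y k w l :=
  [/\ w.2 != x.2, w.2 != y.2, 0 < aht x w l & 0 < aht w y (k - l)].

Lemma between_opp x y k w l :
  between (pm_opp y) (pm_opp x) k w l -> between x y k (pm_opp w) (k - l).
Proof.
case=> w1 w2 h1 h2; split=> //; first by rewrite -aht_opp pm_oppK.
by rewrite -aht_opp pm_oppK (_ : k - (k - l) = l) //; ring.
Qed.

(** It is enough that one part has height 1: heights add up, so the other part is then positive. The
    witnesses move an endpoint of the root by one row, except for [delta + e_0 - e_(n-1)], from
    which the end node [e_0 + e_1] is split off. *)
Lemma peel_simple x y k : x.2 != y.2 -> 2 <= aht x y k < h ->
  exists w l, between x y k w l /\ (aht x w l = 1 \/ aht w y (k - l) = 1).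
Proof.
move: x y; apply: root_wlog => [x y IH|x y].
  rewrite -aht_opp => /IH[w [l [bt o]]].
  exists (pm_opp w), (k - l); split; first exact: between_opp.
  case: o => o; [right|left]; rewrite -aht_opp pm_oppK //.
  by rewrite (_ : k - (k - l) = l) //; ring.
move=> ij a2; suff [w [l [wx wy o]]] : exists w l, [/\ w.2 != x.2, w.2 != y.2 &
    aht x w l = 1 \/ aht w y (k - l) = 1].
  exists w, l; split=> //; have s := aht_add x y w k l.
  by move: s o a2; rewrite /between; move: (aht x w l) (aht w y (k - l)) (aht x y k) => A B C; split=> //; lia.
case: x y ij a2 => [b i] [c j] /= ij a2; have jn := ltn_ord j.
have ne : i != j by apply: contraTN ij => /eqP ->; rewrite ltnn.
have := @aht_level (b, i) (c, j) k ne.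
have mk (d : bool) (e : nat) (en : (e < n)%N) l : e <> i -> e <> j ->
    aht (b, i) (d, Ordinal en) l = 1 \/ aht (d, Ordinal en) (c, j) (k - l) = 1 ->
    exists w l, [/\ w.2 != i, w.2 != j &
      aht (b, i) w l = 1 \/ aht w (c, j) (k - l) = 1].
  move=> ei ej o; exists (d, Ordinal en), l; split=> //.
  - by apply/eqP => /(congr1 val).
  - by apply/eqP => /(congr1 val).
have := mk; move: a2; rewrite /aht /rho /cox /= => a2 {}mk.
case: b c a2 mk => [] [] /= a2 mk [|[k1 _]|[k1 _]]; try lia; subst k.
- have [jl|jl] := ltnP j.+1 n.
    by apply: (mk true j.+1 jl 1); lia.
  have [i0|i0] := posnP i.
    have e1 : (1 < n)%N by lia.
    by apply: (mk false 1%N e1 0); lia.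
  have e1 : (i.-1 < n)%N by lia.
  by apply: (mk true i.-1 e1 0); lia.
- have [i0|i0] := posnP i.
    have e1 : (j.-1 < n)%N by lia.
    by apply: (mk false j.-1 e1 0); lia.
  have e1 : (i.-1 < n)%N by lia.
  by apply: (mk true i.-1 e1 0); lia.
- have [jl|jl] := ltnP j.+1 n.
    by apply: (mk true j.+1 jl 1); lia.
  have e1 : (i.+1 < n)%N by lia.
  by apply: (mk false i.+1 e1 0); lia.
- have e1 : (i.+1 < n)%N by lia.
  by apply: (mk false i.+1 e1 0); lia.
Qed.

Hypothesis m_step : forall i, (i.+1 < n)%N -> m i - 1 <= m i.+1.
Hypothesis m_first : -1 <= m 0 + m 1%N.
Hypothesis m_last : m n.-2 + m n.-1 <= 2.

(** A root of height 1 is an affine simple root: [e_(i+1) - e_i], [e_0 + e_1], or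
    [delta - e_(n-2) - e_(n-1)]. The three hypotheses on [m] are exactly the bound for these. *)
Lemma aphi_simple x y k : x.2 != y.2 -> aht x y k = 1 -> -1 <= aphi m x y k.
Proof.
move: x y; apply: root_wlog => [x y IH|]; first by rewrite -aht_opp -aphi_opp.
move=> [b i] [c j] /= ij; have jn := ltn_ord j => e.
have ne : i != j by apply: contraTN ij => /eqP ->; rewrite ltnn.
have := @aht_level (b, i) (c, j) k ne; rewrite e.
have h1 : 1 < h by rewrite /cox; lia.
have s := m_step; have := s i; move: e; rewrite /aht /aphi /rho /ext /cox /=.
case: b; case: c => /= e si /(_ _)[]; rewrite ?h1 // => -[k01 _]; subst k.
- lia.
- lia.
- have [i0 j1] : (i : nat) = 0%N /\ (j : nat) = 1%N by lia.
  by rewrite i0 j1; lia.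
- lia.
- lia.
- have [i0 j1] : (i : nat) = n.-2 /\ (j : nat) = n.-1 by lia.
  by rewrite i0 j1; lia.
- have ji : (j : nat) = i.+1 by lia.
  by have := si; rewrite -ji jn => /(_ isT); lia.
- lia.
Qed.

Definition splits x y k := exists w l,
  [/\ between x y k w l, aphi m x w l <= 0 & aphi m w y (k - l) <= 0].

Lemma splits_opp x y k : splits (pm_opp y) (pm_opp x) k -> splits x y k.
Proof.
case=> w [l [bt p1 p2]]; exists (pm_opp w), (k - l); split.
- exact: between_opp.
- by rewrite -aphi_opp pm_oppK.
- by rewrite -aphi_opp pm_oppK (_ : k - (k - l) = l) //; ring.
Qed.

Lemma pm_same_row x y : x.2 = y.2 -> y = x \/ y = pm_opp x.
Proof.
by case: x y => [b i] [c j] /= ->; case: b c => [] []; [left|right|right|left].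
Qed.

(* A split whose first part has positive [aphi] is repaired by splitting the
   second part in two and moving one of the pieces to the first part; the
   height of the second part decreases. *)
Lemma split_repair B x y k w l :
  (forall x' y' k', x'.2 != y'.2 -> 2 <= aht x' y' k' < h ->
     aht x' y' k' <= aht w y (k - l) -> aphi m x' y' k' <= -1 ->
     splits x' y' k') ->
  aht w y (k - l) <= B%:Z -> between x y k w l -> aht x y k < h ->
  aphi m x y k <= -1 -> 1 <= aphi m x w l -> splits x y k.
Proof.
elim: B x y k w l => [|B IHB] x y k w l IH cB [wx wy d0 c0] bh bp dp.
  by move: cB c0; root_lia.
have := aphi_add x y w k l; have := aht_add x y w k l => ha pa.
have c2 : 2 <= aht w y (k - l).
  case: (ltrP 1 (aht w y (k - l))) => [|c1]; first by root_lia.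
  have c1' : aht w y (k - l) = 1 by root_lia.
  by have := aphi_simple wy c1'; root_lia.
have [|||u [l2 [[uw uy c10 c20] p1 p2]]] := IH w y (k - l) wy; [root_lia..|].
have hc := aht_add w y u (k - l) l2; have pc := aphi_add w y u (k - l) l2.
(* If [u] lies in the row of [x], then [(x, u)] is no root. The case [u = x] would give a multiple
   of h strictly between 0 and h. For [u = pm_opp x] the other piece moves: [(pm_opp x, y)] is the
   same root as [(pm_opp y, x)], and followed by [(x, w)] it becomes [(pm_opp y, w)]. *)
have [ux|ux] := eqVneq x.2 u.2.
  case: (pm_same_row ux) => eu; subst u.
    have := aht_add x x w (l + l2) l; rewrite (_ : l + l2 - l = l2); last by ring.
    have : aht x x (l + l2) = h * (l + l2) by rewrite /aht; ring.
    have {}bh : aht x w l + aht w x l2 < h by root_lia.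
    move=> -> e; exfalso; move: e d0 c10 bh.
    by move: (aht x w l) (aht w x l2) (l + l2) h => D C t H; case: (ltrP 0 t); nia.
  have hd : aht (pm_opp y) w (k - l2) = aht x w l + aht (pm_opp x) y (k - l - l2).
    by rewrite /aht !rho_opp; ring.
  have pd : aphi m (pm_opp y) w (k - l2) =
      aphi m x w l + aphi m (pm_opp x) y (k - l - l2).
    by rewrite /aphi !ext_opp; ring.
  have kk : k - (k - l2) = l2 by ring.
  have bt : between (pm_opp y) (pm_opp x) k w (k - l2).
    by split=> //; rewrite ?hd ?kk //; root_lia.
  apply: splits_opp; case: (lerP (aphi m (pm_opp y) w (k - l2)) 0) => dp'.
    by exists w, (k - l2); split; rewrite ?kk.
  apply: (IHB _ _ _ w (k - l2)) => //; rewrite ?kk ?aht_opp ?aphi_opp //; try root_lia.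
  by move=> x' y' k' r a1 a2; apply: IH => //; root_lia.
have hd : aht x u (l + l2) = aht x w l + aht w u l2 by rewrite /aht; ring.
have pd : aphi m x u (l + l2) = aphi m x w l + aphi m w u l2 by rewrite /aphi; ring.
have kk : k - (l + l2) = k - l - l2 by ring.
have bt : between x y k u (l + l2).
  by split=> //; rewrite 1?eq_sym ?hd ?kk //; root_lia.
case: (lerP (aphi m x u (l + l2)) 0) => dp'.
  by exists u, (l + l2); split; rewrite ?kk.
apply: (IHB _ _ _ u (l + l2)) => //; rewrite ?kk //; try root_lia.
by move=> x' y' k' r a1 a2; apply: IH => //; root_lia.
Qed.

(** Peel off a simple root; its value is at least -1. If this value is at most 0, so is that of the
    rest, the total being at most -1. If it is positive, the rest has value at most -2, hence is not
    simple, and [split_repair] applies. *)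
Lemma split_root x y k : x.2 != y.2 -> 2 <= aht x y k < h ->
  aphi m x y k <= -1 -> splits x y k.
Proof.
have [A] : {A : nat | aht x y k <= A%:Z}.
  by exists `|aht x y k|%N; rewrite -ler_norml_abs || root_lia.
elim: A x y k => [|A IH] x y k kA xy kh kp; first by root_lia.
have [w [l [[wx wy d0 c0] o]]] := peel_simple xy kh.
have pa := aphi_add x y w k l; have ha := aht_add x y w k l.
have rec x' y' k' : x'.2 != y'.2 -> 2 <= aht x' y' k' < h ->
    aht x' y' k' < aht x y k -> aphi m x' y' k' <= -1 -> splits x' y' k'.
  by move=> r a1 a2; apply: IH => //; root_lia.
have xw : x.2 != w.2 by rewrite eq_sym.
have kk : k - (k - l) = l by ring.
case: o => o.
  have p1 := aphi_simple xw o; case: (lerP (aphi m x w l) 0) => dp.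
    by exists w, l; split=> //; root_lia.
  apply: (@split_repair `|aht w y (k - l)|%N x y k w l) => //; try root_lia.
  by move=> x' y' k' r a1 a2; apply: rec => //; root_lia.
have p1 := aphi_simple wy o; case: (lerP (aphi m w y (k - l)) 0) => dp.
  by exists w, l; split=> //; root_lia.
apply: splits_opp.
apply: (@split_repair `|aht x w l|%N _ _ k (pm_opp w) (k - l));
  rewrite ?kk ?aht_opp ?aphi_opp //; try root_lia.
- by move=> x' y' k' r a1 a2; apply: rec => //; root_lia.
- by split; rewrite ?kk ?aht_opp.
Qed.

(** The value on z is [aht - h * aphi], so for the lift of height between 0 and h a value above h
    means that [aphi] is at most -1. If the height were at least 2, one part of a split would again
    have [aphi] at most -1, hence a value above h, and the other part a positive value, against
    minimality. *)
Lemma minimal_root x y : x.2 != y.2 -> h < zz m y - zz m x ->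
  (forall w, w.2 != x.2 -> w.2 != y.2 ->
     (h < zz m w - zz m x -> zz m w < zz m y -> False) /\
     (h < zz m y - zz m w -> zz m x < zz m w -> False)) ->
  zz m y - zz m x = h + 1.
Proof.
move=> xy hz hmin; have [k kh] := aht_exists xy.
have h0 : 0 < h by rewrite /cox; lia.
have e w v l := zz_diff m w v l.
have kp : aphi m x y k <= -1.
  have := e x y k; move: hz kh; move: (aht x y k) (aphi m x y k) => A P; nia.
case: (ltrP 1 (aht x y k)) => [k2|k1]; last first.
  have k1' : aht x y k = 1 by root_lia.
  have := aphi_simple xy k1' => p1; rewrite (e _ _ k) k1'.
  by rewrite (_ : aphi m x y k = -1); [ring | root_lia].
have [||w [l [[wx wy d0 c0] p1 p2]]] := @split_root x y k xy; [root_lia..|].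
have pa := aphi_add x y w k l.
have [//|m1 m2] := hmin w wx.
have := e x w l; have := e w y (k - l) => e2 e1.
case: (lerP (aphi m x w l) (-1)) => q1.
  case: m1.
    by rewrite e1; move: (aht x w l) (aphi m x w l) d0 q1 => A P; nia.
  by rewrite -subr_gt0 e2; move: (aht w y _) (aphi m w y _) c0 p2 => A P; nia.
have q2 : aphi m w y (k - l) <= -1 by root_lia.
case: m2.
  by rewrite e2; move: (aht w y _) (aphi m w y _) c0 q2 => A P; nia.
by rewrite -subr_gt0 e1; move: (aht x w _) (aphi m x w _) d0 p1 => A P; nia.
Qed.

(** The bound [- (h * aphi)] is additive, so it passes from the two parts of a split to their sum.
    The induction on the height ends at [aphi = 0] and at simple roots with [aphi = -1], which are
    the two hypotheses. The function [t] is arbitrary so that it can be the z of another path,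
    relabelled. *)
Lemma levels_determined (t : pm n -> int) :
  (forall x y, x.2 != y.2 -> 0 < zz m y - zz m x -> 0 < t y - t x) ->
  (forall x y, x.2 != y.2 -> h < zz m y - zz m x -> h < t y - t x) ->
  forall (j : nat) x y, x.2 != y.2 -> h * j%:Z < zz m y - zz m x ->
    h * j%:Z < t y - t x.
Proof.
move=> t0 t1; have h0 : 0 < h by rewrite /cox; lia.
suff key A x y k : aht x y k <= A%:Z -> x.2 != y.2 -> 0 < aht x y k < h ->
    aphi m x y k <= 0 -> - (h * aphi m x y k) < t y - t x.
  move=> j x y xy jz; have [k kh] := aht_exists xy.
  have e := zz_diff m x y k.
  have pj : aphi m x y k <= - j%:Z.
    move: jz kh; rewrite e; move: (aht x y k) (aphi m x y k) => B P; nia.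
  have := @key `|aht x y k|%N x y k _ xy kh.
  move: pj; move: (aphi m x y k) (t y - t x) => P T; nia.
elim: A x y k => [|A IH] x y k kA xy kh kp; first by root_lia.
have [p0|p0] := eqVneq (aphi m x y k) 0.
  by rewrite p0 mulr0 oppr0; apply: t0 => //; rewrite (zz_diff _ _ _ k) p0; root_lia.
have {p0} kp2 : aphi m x y k <= -1 by root_lia.
case: (ltrP 1 (aht x y k)) => [k2|k1]; last first.
  have k1' : aht x y k = 1 by root_lia.
  have p1 := aphi_simple xy k1'.
  have e : aphi m x y k = -1 by root_lia.
  have := t1 x y xy; rewrite (zz_diff _ _ _ k) k1' e; root_lia.
have [||w [l [[wx wy d0 c0] p1 p2]]] := @split_root x y k xy; [root_lia..|].
have pa := aphi_add x y w k l; have ha := aht_add x y w k l.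
have i1 : - (h * aphi m x w l) < t w - t x.
  by apply: IH; rewrite 1?eq_sym //; root_lia.
have i2 : - (h * aphi m w y (k - l)) < t y - t w by apply: IH => //; root_lia.
by rewrite -pa mulrDr; move: i1 i2; root_lia.
Qed.

End Roots.

(** * Levels 0 and 1 determine z *)

Section Uniqueness.
Variables (n : nat) (m m' : nat -> int) (g : pm n -> pm n).
Hypothesis n3 : (2 < n)%N.
Hypothesis m_step : forall i, (i.+1 < n)%N -> m i - 1 <= m i.+1.
Hypothesis m_first : -1 <= m 0 + m 1%N.
Hypothesis m_last : m n.-2 + m n.-1 <= 2.
Hypothesis m'_step : forall i, (i.+1 < n)%N -> m' i - 1 <= m' i.+1.
Hypothesis m'_first : -1 <= m' 0 + m' 1%N.
Hypothesis m'_last : m' n.-2 + m' n.-1 <= 2.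
Hypothesis g_inj : injective g.
Hypothesis g_opp : forall x, g (pm_opp x) = pm_opp (g x).
Local Notation h := (cox n).
Hypothesis lev0 : forall x y : pm n, x.2 != y.2 ->
  (0 < zz m y - zz m x) = (0 < zz m' (g y) - zz m' (g x)).
Hypothesis lev1 : forall x y : pm n, x.2 != y.2 ->
  (h < zz m y - zz m x) = (h < zz m' (g y) - zz m' (g x)).

Lemma row_neq (x y : pm n) : x.2 != y.2 -> (g x).2 != (g y).2.
Proof.
apply: contraNneq => /pm_same_row[|] e; first by rewrite (g_inj e).
by rewrite (_ : y = pm_opp x) //; apply: g_inj; rewrite g_opp.
Qed.

(** The left side is [1 - h * aphi], the first integer above a multiple of h, and the right side is
    never a multiple of h; so only the level of the right side matters. For [aphi] equal to -1 or 0
    this is [lev1] or [lev0]; for positive [aphi], [levels_determined] is applied backwards, from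
    [m'] to [m]. *)
Lemma zz_simple_le (x y : pm n) k : x.2 != y.2 -> aht x y k = 1 ->
  zz m y - zz m x <= zz m' (g y) - zz m' (g x).
Proof.
move=> xy k1; have h0 : 0 < h by rewrite /cox; lia.
have p1 := aphi_simple n3 m_step m_first m_last xy k1.
have e := zz_diff m x y k; rewrite k1 in e.
case: (ltrgtP (aphi m x y k) 0) => p0.
- have e1 : aphi m x y k = -1 by lia.
  by have := lev1 xy; rewrite e e1; lia.
- have [f fK gK] := injF_bij g_inj.
  have f_opp u : f (pm_opp u) = pm_opp (f u) by rewrite -{1}(gK u) -g_opp fK.
  have f_row u v : u.2 != v.2 -> (f u).2 != (f v).2.
    apply: contraNneq => /pm_same_row[] /(congr1 g); rewrite ?g_opp !gK => ->//.
  have [j pj] : exists j : nat, aphi m x y k = j%:Z.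
    by exists `|aphi m x y k|%N; lia.
  have xy' : (g y).2 != (g x).2 by rewrite eq_sym row_neq.
  have := @levels_determined n m' n3 m'_step m'_first m'_last (zz m \o f) _ _ j _ _ xy'.
  rewrite /= !fK => L.
  have {}L : h * j%:Z < zz m' (g x) - zz m' (g y) -> h * j%:Z < zz m x - zz m y.
    by apply: L => u v uv; rewrite 1?lev0 1?lev1 ?f_row ?gK.
  have ne := zz_diff_neq m' n3 j xy'.
  move: L ne; rewrite -pj; move: (h * _) e => H e L ne.
  case: (ltrP H (zz m' (g x) - zz m' (g y))) => [/L|]; lia.
- have := lev0 xy; rewrite e p0; lia.
Qed.

(** By [zz_simple_le] the difference [D] is at least 0 on the finite part of each affine simple
    root. Some combination of these parts with positive coefficients is zero, so [D] vanishes. *)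
Lemma zz_determined x : zz m' (g x) = zz m x.
Proof.
pose D (i : nat) : int := if insub i is Some j then zz m' (g (false, j)) - zz m (false, j) else 0.
have DE (j : 'I_n) : D j = zz m' (g (false, j)) - zz m (false, j).
  by rewrite /D valK.
have oppE (j : 'I_n) : zz m' (g (true, j)) - zz m (true, j) = - D j.
  by rewrite DE -[(true, j)]/(pm_opp (false, j)) g_opp !zz_opp; lia.
have ord_neq (i j : 'I_n) : (i : nat) != (j : nat) -> i != j.
  by apply: contraNneq => ->.
have Dstep i : (i.+1 < n)%N -> D i <= D i.+1.
  move=> i1; have i0 : (i < n)%N by lia.
  have := @zz_simple_le (false, Ordinal i0) (false, Ordinal i1) 0.
  rewrite -[i]/(nat_of_ord (Ordinal i0)) -[i.+1]/(nat_of_ord (Ordinal i1)) !DE.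
  rewrite ord_neq //=; last by lia.
  by rewrite /aht /rho /=; lia.
have Dfirst : 0 <= D 0%N + D 1%N.
  have i0 : (0 < n)%N by lia.
  have i1 : (1 < n)%N by lia.
  have L := @zz_simple_le (true, Ordinal i0) (false, Ordinal i1) 0.
  have {}L := L (ord_neq (Ordinal i0) (Ordinal i1) isT); move: L (oppE (Ordinal i0)) (DE (Ordinal i1)).
  by rewrite /aht /rho /=; lia.
have Dlast : D n.-2 + D n.-1 <= 0.
  have i0 : (n.-2 < n)%N by lia.
  have i1 : (n.-1 < n)%N by lia.
  have L := @zz_simple_le (false, Ordinal i0) (true, Ordinal i1) 1.
  have ne : (n.-2 != n.-1)%N by lia.
  have {}L := L (ord_neq (Ordinal i0) (Ordinal i1) ne).
  move: L (oppE (Ordinal i1)) (DE (Ordinal i0)).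
  by rewrite /aht /rho /cox /=; lia.
have D1 i : (0 < i < n)%N -> 0 <= D i.
  elim: i => // i IH i1; have [i0|i0] := posnP i; last first.
    by have := IH _; have := Dstep i; lia.
  by rewrite i0; have := Dstep 0%N; lia.
have Dle i j : (i + j < n)%N -> D i <= D (i + j)%N.
  elim: j => [|j IH] ij; first by rewrite addn0.
  by rewrite addnS; have := IH _; have := Dstep (i + j)%N; lia.
have D0 i : (i < n)%N -> D i = 0.
  move=> i0; have d1 := D1 n.-1; have d2 := D1 n.-2.
  have Di j : (0 < j < n)%N -> D j = 0.
    move=> j0; have := D1 j j0; have := Dle j (n.-1 - j)%N.
    by rewrite (_ : j + (n.-1 - j) = n.-1)%N; lia.
  have [e|e] := posnP i; last by apply: Di; lia.
  have d3 : D 1%N = 0 by apply: Di; lia.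
  have d4 : D 0%N <= D 1%N by apply: Dstep; lia.
  by rewrite e; lia.
case: x => [[] j]; first by have := oppE j; rewrite D0 ?ltn_ord // oppr0 => /subr0_eq.
by have := DE j; rewrite D0 ?ltn_ord // => /esym/subr0_eq.
Qed.

End Uniqueness.

(** * Valleys as positions in a word *)

Lemma nth_filter_iota (P : pred nat) d l k :
  (k < l)%N -> P k -> nth d (filter P (iota 0 l)) (count P (iota 0 k)) = k.
Proof.
move=> kl Pk; have -> : iota 0 l = iota 0 k ++ k :: iota k.+1 (l - k.+1).
  rewrite -[k :: _]/(iota k (l - k.+1).+1) -{2}(add0n k) -iotaD.
  by congr iota; lia.
by rewrite filter_cat /= Pk nth_cat size_filter ltnn subnn.
Qed.

Lemma count_nth_iota T (a : pred T) x0 s k : (k <= size s)%N ->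
  count (fun l => a (nth x0 s l)) (iota 0 k) = count a (take k s).
Proof. by move=> ks; rewrite -(map_nth_iota0 x0) // count_map. Qed.

Lemma nth_positions T (a : pred T) x0 s i k : (k < size s)%N ->
  (nth (size s) [seq l <- iota 0 (size s) | a (nth x0 s l)] i == k) =
  a (nth x0 s k) && (count a (take k s) == i).
Proof.
move=> ks; set l := [seq _ <- _ | _]; set P := fun l => a (nth x0 s l).
have key r : (r < size s)%N -> P r -> nth (size s) l (count a (take r s)) = r.
  by move=> rs Pr; rewrite -(count_nth_iota _ x0) ?(ltnW rs) // nth_filter_iota.
apply/eqP/andP => [e|[ak /eqP <-]]; last exact: key.
have il : (i < size l)%N.
  by rewrite ltnNge; apply/negP => /(nth_default (size s)) e'; lia.
have kl : k \in l by rewrite -e mem_nth.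
have Pk : P k by move: kl; rewrite mem_filter => /andP[].
split=> //; have kP := key k ks Pk.
have u : uniq l by rewrite filter_uniq ?iota_uniq.
have il' : (count a (take k s) < size l)%N.
  by rewrite ltnNge; apply/negP => /(nth_default (size s)) e'; lia.
by rewrite -(nth_uniq (size s) il' il u) kP e.
Qed.

(** Positions and valleys do not see the signs of East steps, so they are computed on this image of
    the word. *)
Definition eshape (p : seq letter) : seq bool := map is_east p.

Lemma north_pos_eq p i k : (0 < i)%N -> (k < size p)%N ->
  (north_pos p i == k) =
  ~~ nth true (eshape p) k && (num_north (take k p) == i.-1).
Proof.
move=> i0 kp; rewrite /north_pos (nth_positions (pred1 N) E) //.
by rewrite (nth_map E) //= /is_east negbK.
Qed.

Lemma east_pos_eq p i k : (0 < i)%N -> (k < size p)%N ->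
  (east_pos p i == k) =
  nth false (eshape p) k && (num_east (take k p) == i.-1).
Proof.
move=> i0 kp; rewrite /east_pos (nth_positions is_east N) //.
by rewrite (nth_map N).
Qed.

Lemma num_eastE p : num_east p = count id (eshape p).
Proof. by rewrite /num_east count_map. Qed.

Lemma num_northE p : num_north p = count negb (eshape p).
Proof.
by rewrite /num_north count_map; apply: eq_count => x; rewrite /= /is_east negbK.
Qed.

Lemma num_letters p : (num_north p + num_east p)%N = size p.
Proof. by rewrite /num_east -(count_predC (pred1 N) p). Qed.

Lemma north_pos_shape p q : eshape p = eshape q -> north_pos p =1 north_pos q.
Proof.
move=> e i; have s : size p = size q by have := congr1 size e; rewrite !size_map.
rewrite /north_pos s; congr nth; apply: eq_in_filter => k.
rewrite mem_iota add0n => /= ks.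
have := congr1 (fun s => nth true s k) e; rewrite /eshape !(nth_map E) ?s //.
by rewrite /is_east => /negb_inj.
Qed.

(** Both clauses of the definition of a valley become one: an East step at [k] that is not followed
    by an East step. If it ends the word, [j] refers to a North step just beyond the end. *)
Lemma valley_pos p i j : is_valley p (i, j) ->
  exists k, [/\ (k < size p)%N, nth false (eshape p) k,
    i = (num_east (take k p)).+1, j = (num_north (take k p)).+1
    & (k.+1 < size p)%N -> nth true (eshape p) k.+1 = false].
Proof.
case/orP => [/and3P[/andP[i1 ie] /andP[j1 jn] /eqP e]|/and3P[l /eqP-> /eqP->]].
  have [np|np] := ltnP (north_pos p j) (size p); last first.
    have : num_north (take (size p) p) = num_north p by rewrite take_size.
    suff : (num_north p <= j.-1)%N by lia.
    rewrite leqNgt; apply/negP => jl; move: np.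
    rewrite /north_pos leqNgt => /negP; apply.
    set l := [seq _ <- _ | _]; have := @mem_nth _ (size p) l j.-1.
    rewrite mem_filter mem_iota add0n /= => mm; apply: (andP (mm _)).2.
    rewrite size_filter; move: jl; rewrite /num_north -{1}(take_size p).
    by rewrite -(count_nth_iota _ E).
  exists (east_pos p i); have ep : (east_pos p i < size p)%N by lia.
  have := east_pos_eq i1 ep; rewrite eqxx => /esym/andP[ee /eqP ->].
  have := north_pos_eq j1 np; rewrite eqxx => /esym/andP[en].
  rewrite e (take_nth N) // -cats1 num_northE /eshape map_cat count_cat /= addn0.
  have -> : is_east (nth N p (east_pos p i)) by move: ee; rewrite (nth_map N).
  rewrite /= addn0 -num_northE => /eqP->; split=> //; try lia.
  by move=> _; apply: negbTE; rewrite -e.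
case/lastP: p l => //= p x; rewrite last_rcons => xe.
have tp : take (size p) (rcons p x) = p by rewrite -cats1 take_size_cat.
exists (size p); rewrite size_rcons tp; split; rewrite ?ltnn //.
- by rewrite /eshape map_rcons nth_rcons size_map ltnn eqxx.
- by rewrite /num_east -cats1 count_cat /= xe; lia.
- by rewrite !num_northE /eshape map_rcons -cats1 count_cat /= xe; lia.
Qed.

Lemma pos_valley p k : (k < size p)%N -> nth false (eshape p) k ->
  ((k.+1 < size p)%N -> nth true (eshape p) k.+1 = false) ->
  is_valley p ((num_east (take k p)).+1, (num_north (take k p)).+1).
Proof.
move=> kp ek nk.
have tk : eshape (take k.+1 p) = rcons (eshape (take k p)) true.
  rewrite (take_nth N) // /eshape map_rcons; congr rcons.
  by move: ek; rewrite (nth_map N).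
have le b : (count b (eshape (take k.+1 p)) <= count b (eshape p))%N.
  by rewrite -[in X in (_ <= X)%N](cat_take_drop k.+1 p) /eshape map_cat count_cat leq_addr.
have := le id; have := le negb; rewrite tk -!cats1 !count_cat /= -!num_eastE -!num_northE.
move=> le2 le1; rewrite /is_valley; have [kl|kl] := ltnP k.+1 (size p); last first.
  have kl' : k.+1 = size p by lia.
  have tp : eshape p = rcons (eshape (take k p)) true by rewrite -tk kl' take_size.
  apply/orP; right; apply/and3P; split.
  - have : (0 < size p)%N by lia.
    move=> p0; rewrite -nth_last -kl' /=.
    by move: ek; rewrite (nth_map N).
  - by rewrite [in X in _ == X]num_eastE tp -cats1 count_cat -num_eastE /= addn1.
  - by rewrite eqSS [in X in _ == X]num_northE tp -cats1 count_cat -num_northE /=; lia.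
apply/orP; left; have {}nk := nk kl.
have e1 : east_pos p (num_east (take k p)).+1 = k.
  by apply/eqP; rewrite east_pos_eq // ek /= eqxx.
have t2 : num_north (take k.+1 p) = num_north (take k p).
  by rewrite num_northE tk -cats1 count_cat -num_northE /=; lia.
have le3 : (num_north (take k.+2 p) <= num_north p)%N.
  by rewrite -[in X in (_ <= X)%N](cat_take_drop k.+2 p) /num_north count_cat leq_addr.
have t3 : num_north (take k.+2 p) = (num_north (take k p)).+1.
  rewrite (take_nth N) // -cats1 /num_north count_cat -!/(num_north _) t2 /=.
  move: nk; rewrite (nth_map N) // /is_east => /negbFE/eqP ->; rewrite eqxx; lia.
apply/and3P; split; try lia.
rewrite e1; rewrite (_ : north_pos _ _ = k.+1) //.
by apply/eqP; rewrite north_pos_eq // nk t2 /= eqxx.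
Qed.

(** * The word of an area vector *)

Definition key_lt T (key : T -> int) : rel T := fun a b => key a < key b.

Lemma key_lt_irr T (key : T -> int) : irreflexive (key_lt key).
Proof. by move=> a; rewrite /key_lt ltxx. Qed.

Lemma key_lt_trans T (key : T -> int) : transitive (key_lt key).
Proof. by move=> b a c; apply: lt_trans. Qed.

Lemma pairwise_flatten I T (r : rel T) (s : I -> I -> bool) (F : I -> seq T) l :
  pairwise s l -> (forall i, pairwise r (F i)) ->
  (forall i j, s i j -> allrel r (F i) (F j)) ->
  pairwise r (flatten [seq F i | i <- l]).
Proof.
move=> + rF sF; elim: l => //= i l IH /andP[il /IH rl].
rewrite pairwise_cat rF rl !andbT; elim: l il {IH rl} => [|j l IH] /=.
  by rewrite allrel0r.
by case/andP=> ij il; rewrite allrel_catr sF // IH.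
Qed.

Section Sorted.
Variables (T : eqType) (key : T -> int) (s : seq T).
Hypothesis ss : pairwise (key_lt key) s.

Lemma key_uniq : uniq s.
Proof. exact: (pairwise_uniq (@key_lt_irr _ key)). Qed.

Lemma key_index a b : a \in s -> b \in s ->
  (index a s < index b s)%N = (key a < key b).
Proof.
move=> sa sb; have h := sorted_ltn_index (@key_lt_trans _ key) _.
have {}h : {in s &, forall x y, (index x s < index y s)%N -> key x < key y}.
  by apply: h; apply: pairwise_sorted.
case: (ltngtP (index a s) (index b s)) => ab.
- by rewrite h.
- by apply/esym/negbTE; rewrite -leNgt ltW // h.
- by rewrite -(nth_index a sb) -ab nth_index // ltxx.
Qed.

Lemma count_take_key (P : pred T) x0 k : (k < size s)%N ->
  count P (take k s) = count (fun b => P b && (key b < key (nth x0 s k))) s.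
Proof.
move=> ks; rewrite -[X in _ = count _ X](cat_take_drop k s) count_cat.
have st : pairwise (key_lt key) (take k s ++ drop k s) by rewrite cat_take_drop.
move: st; rewrite pairwise_cat (drop_nth x0) // allrel_consr /=.
case/and4P=> [/andP[tk _] _ dk _].
rewrite [X in (_ = _ + X)%N](_ : _ = 0)%N ?addn0.
  apply: eq_in_count => b bt.
  by have -> : key b < key (nth x0 s k) by [exact: (allP tk)]; rewrite andbT.
rewrite ltxx andbF add0n; apply/eqP; rewrite -leqn0 leqNgt -has_count.
apply/hasPn => b bd; rewrite negb_and -leNgt orbC ltW //; exact: (allP dk).
Qed.

End Sorted.

Lemma pm_valE n (x : pm n) :
  pm_val x = if x.1 then - (x.2.+1)%:Z else (x.2.+1)%:Z.
Proof. by rewrite /pm_val; case: x => [[] i] /=; rewrite ?mulN1r ?mul1r. Qed.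

Lemma pm_val_opp n (x : pm n) : pm_val (pm_opp x) = - pm_val x.
Proof. by rewrite !pm_valE; case: x => [[] i] /=; rewrite ?opprK. Qed.

Lemma pm_val_inj n : injective (@pm_val n).
Proof.
move=> [b i] [c j]; rewrite !pm_valE /=.
by case: b; case: c => /=; case: i => i hi; case: j => j hj /= e;
  congr pair; try apply: val_inj => /=; lia.
Qed.

Lemma pm_val_bound n (x : pm n) : [/\ pm_val x != 0, - n%:Z <= pm_val x & pm_val x <= n%:Z].
Proof.
by rewrite !pm_valE; case: x => b i /=; have := ltn_ord i; case: b; split; lia.
Qed.

Lemma pm_opp_neq n (x : pm n) : pm_opp x != x.
Proof. by case: x => [[] i]; apply/eqP. Qed.

Lemma pm_opp_inj n : injective (@pm_opp n).
Proof. exact: can_inj (@pm_oppK n). Qed.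

(* [ckey m x] orders the entries of (-m_(n-1), ..., -m_0, m_0, ..., m_(n-1)) by
   decreasing value, then from left to right.  The period is odd and larger than
   2n, so that adding it to a key never creates a tie. *)
Definition period (n : nat) : int := 2 * n%:Z + 1.
Definition ckey n (m : nat -> int) (x : pm n) : int :=
  pm_val x - period n * ext m x.
(* [(false, x)] is the North step and [(true, x)] the East step produced by
   the entry [x]. *)
Definition item n : finType := (bool * pm n)%type.
Definition ikey n (m : nat -> int) (a : item n) : int :=
  ckey m a.2 + (if a.1 then period n else 0).
(** The symmetry of the prolonged word: it reverses the order of the keys, since it sends a key to
    [period n] minus that key. *)
Definition iflip n (a : item n) : item n := (~~ a.1, pm_opp a.2).

Lemma ckey_opp n m (x : pm n) : ckey m (pm_opp x) = - ckey m x.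
Proof. by rewrite /ckey pm_val_opp ext_opp; ring. Qed.

Lemma ikey_flip n m (a : item n) : ikey m (iflip a) = period n - ikey m a.
Proof. by case: a => [[] x]; rewrite /ikey /= ckey_opp; ring. Qed.

Lemma iflipK n : involutive (@iflip n).
Proof. by case=> b x; rewrite /iflip /= negbK pm_oppK. Qed.

Lemma period_dvd n (a c : int) :
  - (2 * n%:Z) <= a <= 2 * n%:Z -> a = period n * c -> a = 0 /\ c = 0.
Proof.
rewrite /period => h e; have : c = 0; last by move=> c0; rewrite e c0 mulr0.
by case: (ltrgtP c 0) => // c0; nia.
Qed.

Lemma ckey_inj n m : injective (@ckey n m).
Proof.
move=> x y e; apply: pm_val_inj; apply/eqP; rewrite -subr_eq0; apply/eqP.
have [_ x1 x2] := pm_val_bound x; have [_ y1 y2] := pm_val_bound y.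
apply: (proj1 (@period_dvd n _ (ext m x - ext m y) _ _)); first by lia.
by move: e; rewrite /ckey mulrBr => e; lia.
Qed.

(** For distinct rows the differences of [pm_val] and of [rho] have the same sign, and are smaller
    in absolute value than the period and h respectively. Both inequalities are therefore decided by
    the difference of [ext] plus [k], and by that common sign when this is 0. Inside row 0 this
    fails, as [rho] is 0 there. *)
Lemma ckey_zz n m (x y : pm n) (k : int) : (2 < n)%N -> x.2 != y.2 ->
  (period n * k < ckey m y - ckey m x) = (cox n * k < zz m y - zz m x).
Proof.
move=> n3 xy; have [r0 r1 r2] := rho_diff n3 xy.
have [_ x1 x2] := pm_val_bound x; have [_ y1 y2] := pm_val_bound y.
have vr : (0 < pm_val y - pm_val x) = (0 < rho y - rho x).
  move: r0; rewrite !pm_valE /rho; case: x y xy {x1 x2 y1 y2 r1 r2} => b i [c j] /= ij.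
  have {ij} : (i : nat) <> j by move=> e; move/eqP: ij; apply; apply: val_inj.
  by case: b; case: c; lia.
rewrite /ckey /zz.
have -> : pm_val y - period n * ext m y - (pm_val x - period n * ext m x) =
  pm_val y - pm_val x - period n * (ext m y - ext m x) by ring.
have -> : rho y - cox n * ext m y - (rho x - cox n * ext m x) =
  rho y - rho x - cox n * (ext m y - ext m x) by ring.
move: vr r0 r1 r2 x1 x2 y1 y2; move: (rho y - rho x) (ext m y - ext m x) => R M.
move: (pm_val y) (pm_val x) => a b; rewrite /period /cox => vr *.
have e1 : ((2 * n%:Z + 1) * k < a - b - (2 * n%:Z + 1) * M) =
          (0 < a - b - (2 * n%:Z + 1) * (M + k)) by apply/idP/idP; lia.
have e2 : ((2 * n%:Z - 2) * k < R - (2 * n%:Z - 2) * M) =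
          (0 < R - (2 * n%:Z - 2) * (M + k)) by apply/idP/idP; lia.
rewrite e1 e2; move: (M + k) => {e1 e2 k}M; apply/idP/idP => h.
  case: (ltrgtP M 0) => M0; first by nia.
  - by nia.
  - by move: vr h; rewrite M0 !mulr0 !subr0 => ->.
case: (ltrgtP M 0) => M0; first by nia.
- by nia.
- by move: vr h; rewrite M0 !mulr0 !subr0 => ->.
Qed.

Definition rowseq n : seq (pm n) :=
  rev [seq (true, i) | i <- enum 'I_n] ++ [seq (false, i) | i <- enum 'I_n].

Lemma mem_rowseq n (x : pm n) : x \in rowseq n.
Proof.
rewrite mem_cat mem_rev; case: x => [[] i]; apply/orP; [left|right];
  by apply/mapP; exists i; rewrite ?mem_enum.
Qed.

Lemma pairwise_enum_ord n : pairwise (key_lt (fun i : 'I_n => (i : nat)%:Z)) (enum 'I_n).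
Proof.
have : pairwise ltn (map val (enum 'I_n)).
  by rewrite val_enum_ord -sorted_pairwise; [exact: iota_ltn_sorted | exact: ltn_trans].
by rewrite pairwise_map; apply: sub_pairwise => i j; rewrite /key_lt /= ltz_nat.
Qed.

Lemma pairwise_rev T (r : rel T) s : pairwise r (rev s) = pairwise (fun a b => r b a) s.
Proof.
elim: s => //= a s IH; rewrite rev_cons pairwise_rcons IH all_rev.
by congr andb.
Qed.

Lemma pairwise_rowseq n : pairwise (key_lt (@pm_val n)) (rowseq n).
Proof.
rewrite pairwise_cat pairwise_rev (pairwise_map (pair true)) (pairwise_map (pair false)); apply/and3P; split.
- apply/allrelP => x y; rewrite mem_rev => /mapP[i _ ->] /mapP[j _ ->].
  by rewrite /key_lt !pm_valE /=; lia.
- apply: sub_pairwise (pairwise_enum_ord n) => i j.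
  by rewrite /key_lt /= !pm_valE /=; lia.
- apply: sub_pairwise (pairwise_enum_ord n) => i j.
  by rewrite /key_lt /= !pm_valE /=; lia.
Qed.

Section Items.
Variables (n : nat) (m : nat -> int).
Hypothesis m_bound : forall i, (i < n)%N -> - (2 * n%:Z) < m i < 2 * n%:Z.

Lemma ext_bound (x : pm n) : - (2 * n%:Z) < ext m x < 2 * n%:Z.
Proof. by case: x => b i; have := m_bound (ltn_ord i); rewrite /ext; case: b => /=; lia. Qed.

(** [S_plus] reads the rows [(false, i)] and [S_minus_rev] the rows [(true, i)]; in terms of [ext]
    both follow the same rule. *)
Definition item_at (j : nat) (x : pm n) : option (item n) :=
  if ext m x == j%:Z then Some (false, x)
  else if ext m x == j%:Z + 1 then Some (true, x) else None.

Lemma item_atE j x a :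
  (item_at j x == Some a) = (x == a.2) && (ext m x == j%:Z + (a.1 : nat)%:Z).
Proof.
case: a => b y; rewrite /item_at /=; move: (ext m x) => e.
have E c : (Some (c, x) == Some (b, y) :> option (item n)) = (c == b) && (x == y).
  exact: xpair_eqE.
case: ifP => [/eqP->|ne]; first by rewrite E andbC; case: b {E}; lia.
case: ifP => [/eqP->|ne2]; first by rewrite E andbC; case: b {E}; lia.
clear E; rewrite (_ : (None == _) = false) // andbC.
by case: b; rewrite [X in X && _](_ : _ = false) //; lia.
Qed.

Definition items_at (j : nat) (s : seq (pm n)) : seq (item n) := pmap (item_at j) s.

Lemma mem_items_at j s a :
  (a \in items_at j s) = (a.2 \in s) && (ext m a.2 == j%:Z + (a.1 : nat)%:Z).
Proof.
rewrite /items_at mem_pmap; apply/mapP/andP => [[x xs /esym/eqP]|[xs e]].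
  by rewrite item_atE => /andP[/eqP <- ->].
by exists a.2 => //; apply/esym/eqP; rewrite item_atE eqxx.
Qed.

Lemma ikey_item j s a : a \in items_at j s -> ikey m a = pm_val a.2 - period n * j%:Z.
Proof.
rewrite mem_items_at => /andP[_ /eqP e]; rewrite /ikey /ckey e.
by case: a {e} => [[] x] /=; ring.
Qed.

Lemma pairwise_items_at j s :
  pairwise (key_lt (@pm_val n)) s -> pairwise (key_lt (ikey m)) (items_at j s).
Proof.
elim: s => //= x s IH /andP[xs /IH ps]; rewrite /items_at /=.
case e: (item_at j x) => [a|] //=; rewrite ps andbT; apply/allP => b bs.
move/eqP: e; rewrite item_atE => /andP[/eqP xa /eqP e].
have aj : a \in items_at j [:: x] by rewrite mem_items_at -xa mem_head e eqxx.
rewrite /key_lt (ikey_item aj) (ikey_item bs) -xa ltrD2r.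
by apply: (allP xs); move: bs; rewrite mem_items_at => /andP[].
Qed.

Definition zitems : seq (item n) :=
  flatten [seq items_at j (rowseq n) | j <- rev (iota 0 (2 * n))].

Lemma pairwise_zitems : pairwise (key_lt (ikey m)) zitems.
Proof.
apply: (@pairwise_flatten _ _ _ gtn).
- rewrite pairwise_rev; have : pairwise ltn (iota 0 (2 * n)).
    by rewrite -sorted_pairwise; [exact: iota_ltn_sorted | exact: ltn_trans].
  by apply: sub_pairwise.
- by move=> j; apply/pairwise_items_at/pairwise_rowseq.
- move=> i j ij; apply/allrelP => a b ia jb.
  rewrite /key_lt (ikey_item ia) (ikey_item jb).
  have [_ x1 x2] := pm_val_bound a.2; have [_ y1 y2] := pm_val_bound b.2.
  by move: (pm_val a.2) (pm_val b.2) x1 x2 y1 y2 ij; rewrite /period /=; nia.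
Qed.

(** An item of level j has key [pm_val - period * j]. This is at most n if [j >= 0] and at least n+1
    if [j < 0], so the word before the deletion of its last letter is exactly the half of the
    symmetric order below [period / 2]. *)
Lemma mem_zitems a : (a \in zitems) = (2 * ikey m a < period n).
Proof.
have [v0 v1 v2] := pm_val_bound a.2; have eb := ext_bound a.2.
apply/flatten_mapP/idP => [[j _ ja]|l].
  by rewrite (ikey_item ja); move: (pm_val a.2) v1 v2; rewrite /period; nia.
have [j ej] : exists j : nat, ext m a.2 = j%:Z + (a.1 : nat)%:Z.
  exists `|ext m a.2 - (a.1 : nat)%:Z|%N.
  suff : 0 <= ext m a.2 - (a.1 : nat)%:Z by lia.
  move: l v1 v2; rewrite /ikey /ckey /period; move: (ext m _) (pm_val _) => M V.
  by case: a.1; nia.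
exists j; last by rewrite mem_items_at mem_rowseq ej eqxx.
by rewrite mem_rev mem_iota; lia.
Qed.

(** With the flipped half added, every signed row contributes one North and one East step, so that
    ranks and positions can be counted without the truncation. *)
Definition allitems : seq (item n) := zitems ++ rev (map (@iflip n) zitems).

Lemma pairwise_allitems : pairwise (key_lt (ikey m)) allitems.
Proof.
rewrite pairwise_cat pairwise_zitems pairwise_rev pairwise_map /=; apply/andP; split.
  apply/allrelP => a b; rewrite mem_rev mem_zitems => az /mapP[c]; rewrite mem_zitems.
  by move=> cz ->; rewrite /key_lt ikey_flip; lia.
by apply: sub_pairwise pairwise_zitems => a b; rewrite /key_lt /= !ikey_flip; lia.
Qed.

Lemma mem_allitems a : a \in allitems.
Proof.
rewrite mem_cat mem_rev -{2}(iflipK a) (mem_map (can_inj (@iflipK n))) !mem_zitems.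
rewrite ikey_flip; have p1 : period n = 2 * n%:Z + 1 by [].
by apply/orP; case: (ltrP (2 * ikey m a) (period n)) => h; [left | right; lia].
Qed.

Lemma perm_allitems : perm_eq allitems (enum (item n)).
Proof.
apply: uniq_perm; rewrite ?enum_uniq ?(key_uniq pairwise_allitems) // => a.
by rewrite mem_allitems mem_enum.
Qed.

Lemma size_allitems : size allitems = (4 * n)%N.
Proof.
rewrite (perm_size perm_allitems) -cardE /item /pm !card_prod card_bool card_ord.
by rewrite mulnA.
Qed.

Lemma size_zitems : size zitems = (2 * n)%N.
Proof.
have := size_allitems; rewrite size_cat size_rev size_map; lia.
Qed.

End Items.

(** * Ranks of the entries and positions of their steps *)

Section Positions.
Variables (n : nat) (m : nat -> int).
Hypothesis m_bound : forall i, (i < n)%N -> - (2 * n%:Z) < m i < 2 * n%:Z.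

Local Notation s := (allitems n m).
Local Notation key := (ckey m).
Implicit Types (x y u w : pm n) (a b : item n).

(* The rank of an entry is its position among the sources of the North steps,
   and also among the sources of the East steps. *)
Definition rk x : nat := #|[pred y : pm n | key y < key x]|.
Definition pos a : nat := index a s.
Definition easts k : nat := count (fun a : item n => a.1) (take k s).
Definition norths k : nat := count (fun a : item n => ~~ a.1) (take k s).

Lemma rk_lt x y : (rk x < rk y)%N = (key x < key y).
Proof.
have sub u w : key u <= key w -> (rk u <= rk w)%N.
  move=> uw; apply: subset_leq_card; apply/subsetP => v; rewrite !inE => vu.
  exact: lt_le_trans vu uw.
case: (ltrP (key x) (key y)) => [xy|/sub]; last by rewrite leqNgt => /negbTE.
apply: proper_card; apply/properP; split; last by exists x; rewrite !inE ?ltxx.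
by apply/subsetP => v; rewrite !inE => /lt_trans; apply.
Qed.

Lemma rk_inj : injective rk.
Proof.
move=> x y e; apply: (@ckey_inj n m); apply/eqP; rewrite eq_le !leNgt -!rk_lt e.
by rewrite ltnn.
Qed.

Lemma card_pm : #|pm n| = (2 * n)%N.
Proof. by rewrite card_prod card_bool card_ord. Qed.

Lemma rk_opp x : (rk x + rk (pm_opp x)).+1 = (2 * n)%N.
Proof.
rewrite -card_pm -(cardC [pred y : pm n | key y < key x]) -addnS; congr addn.
have -> : rk (pm_opp x) = #|[pred y : pm n | key x < key y]|.
  rewrite /rk -(card_image (@pm_opp_inj n)); apply: eq_card => y.
  rewrite inE; apply/imageP/idP => [[v]|l].
    by rewrite inE => l ->; move: l; rewrite !ckey_opp; lia.
  by exists (pm_opp y); rewrite ?pm_oppK // inE; move: l; rewrite !ckey_opp; lia.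
rewrite (cardD1 x [predC _]) !inE ltxx add1n; congr S; apply: eq_card => y.
by rewrite !inE -leNgt lt_neqAle eq_sym (inj_eq (@ckey_inj n m)).
Qed.

Lemma rk_max x : (rk x < 2 * n)%N.
Proof. by have := rk_opp x; lia. Qed.

Lemma rk_onto r : (r < 2 * n)%N -> exists x, rk x = r.
Proof.
move=> rn; pose f x : 'I_(2 * n) := Ordinal (rk_max x).
have fi : injective f by move=> x y /(congr1 val) /rk_inj.
have := inj_card_onto fi; rewrite card_pm card_ord => /(_ (leqnn _) (Ordinal rn)).
by case/codomP => x /(congr1 val) /= ->; exists x.
Qed.

Lemma pos_max a : (pos a < 4 * n)%N.
Proof. by rewrite -(size_allitems m_bound) index_mem mem_allitems. Qed.

Lemma pos_onto k : (k < 4 * n)%N -> exists a, pos a = k.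
Proof.
rewrite -(size_allitems m_bound) => ks.
case e: s ks => [//|a0 l] ks.
exists (nth a0 s k); rewrite /pos index_uniq ?e //.
by rewrite -e (key_uniq (pairwise_allitems m_bound)).
Qed.

Lemma pos_lt a b : (pos a < pos b)%N = (ikey m a < ikey m b).
Proof. by rewrite (key_index (pairwise_allitems m_bound)) ?mem_allitems. Qed.

Lemma pos_inj : injective pos.
Proof. by move=> a b e; rewrite -(nth_index a (mem_allitems m_bound a)) -/(pos a) e nth_index ?mem_allitems. Qed.

Lemma count_pos (P : pred (item n)) a :
  count P (take (pos a) s) = #|[pred b : item n | P b && (ikey m b < ikey m a)]|.
Proof.
have as_ := mem_allitems m_bound a.
rewrite (count_take_key (pairwise_allitems m_bound) _ a) ?index_mem //.
rewrite nth_index // (seq.permP (perm_allitems m_bound)) cardE /enum_mem -size_filter.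
by congr size; rewrite -filter_predI; apply: eq_filter => b; rewrite /= !inE andbT.
Qed.

Lemma card_items c (v : int) :
  #|[pred b : item n | (b.1 == c) && (ckey m b.2 < v)]| = #|[pred y : pm n | key y < v]|.
Proof.
rewrite -[RHS](@card_image _ (item n) (pair c)); last by move=> y y' [].
apply: eq_card => -[d y]; rewrite !inE /=; apply/andP/imageP => [[/eqP-> l]|].
  by exists y.
by case=> y' l [-> ->]; rewrite eqxx.
Qed.

Lemma easts_pos x : easts (pos (true, x)) = rk x.
Proof.
rewrite /easts count_pos /rk -(card_items true); apply: eq_card => -[d y].
by rewrite !inE /ikey /=; case: d => //=; rewrite ltrD2r.
Qed.

Lemma norths_pos x : norths (pos (false, x)) = rk x.
Proof.
rewrite /norths count_pos /rk -(card_items false); apply: eq_card => -[d y].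
by rewrite !inE /ikey /=; case: d => //=; rewrite !addr0.
Qed.

Lemma easts_step a : easts (pos a).+1 = (easts (pos a) + a.1)%N.
Proof.
have as_ := mem_allitems m_bound a.
by rewrite /easts (take_nth a) ?index_mem // -cats1 count_cat /= nth_index // addn0.
Qed.

Lemma norths_step a : norths (pos a).+1 = (norths (pos a) + ~~ a.1)%N.
Proof.
have as_ := mem_allitems m_bound a.
by rewrite /norths (take_nth a) ?index_mem // -cats1 count_cat /= nth_index // addn0.
Qed.

Lemma count_take_mono T (P : pred T) (l : seq T) i j : (i <= j)%N ->
  (count P (take i l) <= count P (take j l))%N.
Proof.
move=> ij; rewrite -(cat_take_drop i (take j l)) count_cat.
by rewrite take_takel // leq_addr.
Qed.

Lemma easts_norths k : (k <= 4 * n)%N -> (easts k + norths k)%N = k.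
Proof.
move=> kn; rewrite /easts /norths (count_predC (fun a : item n => a.1)).
by rewrite size_take size_allitems //; case: ltnP => //; lia.
Qed.

Lemma pos_east x k : (k <= pos (true, x))%N = (easts k <= rk x)%N.
Proof.
apply/idP/idP => [l|]; first by rewrite -easts_pos; exact: count_take_mono.
apply: contraTT; rewrite -!ltnNge => l.
have := easts_step (true, x); rewrite easts_pos addn1 => <-; exact: count_take_mono.
Qed.

Lemma pos_north x k : (k <= pos (false, x))%N = (norths k <= rk x)%N.
Proof.
apply/idP/idP => [l|]; first by rewrite -norths_pos; exact: count_take_mono.
apply: contraTT; rewrite -!ltnNge => l.
have := norths_step (false, x); rewrite norths_pos addn1 => <-; exact: count_take_mono.
Qed.

Lemma pos_north_east x y : (pos (true, x) < pos (false, y))%N = (key x + period n < key y).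
Proof. by rewrite pos_lt /ikey addr0. Qed.

Lemma north_after x y : (norths (pos (true, x)) <= rk y)%N -> key x + period n < key y.
Proof.
rewrite -pos_north -pos_north_east => l; rewrite ltn_neqAle l andbT.
by apply/eqP => /pos_inj.
Qed.

(** The North step of an entry precedes its East step, by one period in the keys. With more East
    than North steps among the first [k], the entry of rank [norths k] would have its East step
    before [k] and its North step after. *)
Lemma easts_le_norths k : (k <= 4 * n)%N -> (easts k <= norths k)%N.
Proof.
move=> kn; rewrite leqNgt; apply/negP => l.
have := easts_norths kn => e.
have [x xr] : exists x, rk x = norths k by apply: rk_onto; lia.
have := pos_east x k; have := pos_north x k; rewrite xr leqnn => h1 h2.
have : (pos (false, x) < pos (true, x))%N.
  by rewrite pos_lt /ikey /= /period; lia.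
lia.
Qed.

End Positions.

(** * Valleys and floors *)

Section Valleys.
Variables (n : nat) (m : nat -> int).
Hypothesis n3 : (2 < n)%N.

Local Notation h := (cox n).
Local Notation rk := (@rk n m).
Local Notation pos := (@pos n m).
Local Notation key := (@ckey n m).
Implicit Types (x y u w : pm n).

(* The root [e_y - e_x] is the normal of a wall, at height one, between the
   origin and the alcove attached to [m]. *)
Definition floor x y : bool := (x.2 != y.2) && (zz m y - zz m x == h + 1).

Lemma floor_opp x y : floor (pm_opp y) (pm_opp x) = floor x y.
Proof.
rewrite /floor !zz_opp eq_sym; congr andb.
by rewrite opprK addrC.
Qed.

Lemma key_zz0 x y : x.2 != y.2 -> (key x < key y) = (zz m x < zz m y).
Proof.
move=> xy; have := ckey_zz m 0 n3 xy; rewrite !mulr0 !subr_gt0; apply.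
Qed.

Lemma key_zz1 x y : x.2 != y.2 ->
  (key x + period n < key y) = (h < zz m y - zz m x).
Proof.
by move=> xy; rewrite -[h]mulr1 -(ckey_zz m 1 n3 xy) mulr1; apply/idP/idP; lia.
Qed.

Lemma rows_cases x y : [\/ y = x, y = pm_opp x | x.2 != y.2].
Proof.
have [/pm_same_row[]|] := eqVneq x.2 y.2; first exact: Or31.
  exact: Or32.
by constructor 3.
Qed.

Lemma row_opp_neq x y : x.2 != y.2 -> x.2 != (pm_opp y).2.
Proof. by []. Qed.

Hypothesis m_bound : forall i, (i < n)%N -> - (2 * n%:Z) < m i < 2 * n%:Z.

(* [x] and [y] are the sources of the East and North steps of a valley at
   position [k] of the word truncated after 2n - 1 letters; the last clause does
   not apply to an East step that ends the truncated word. *)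
Definition valley_at k x y : Prop :=
  [/\ (k < (2 * n).-1)%N, pos (true, x) = k, norths n m k = rk y
    & (k < (2 * n).-2)%N -> pos (false, y) = k.+1].

Lemma valley_at_facts k x y : valley_at k x y ->
  [/\ easts n m k = rk x, (rk x + rk y = k)%N, easts n m k.+1 = (rk x).+1,
      norths n m k.+1 = rk y & key x + period n < key y].
Proof.
case=> kn pk nk _.
have ek : easts n m k = rk x by rewrite -pk easts_pos.
have kk := easts_norths m_bound (_ : (k <= 4 * n)%N).
have {}kk : (rk x + rk y = k)%N by rewrite -ek -nk kk //; lia.
have ek' : easts n m k.+1 = (rk x).+1 by rewrite -{1}pk easts_step // pk ek addn1.
have nk' : norths n m k.+1 = rk y by rewrite -{1}pk norths_step // pk nk addn0.
split=> //; rewrite -pos_north_east // pk.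
by rewrite (pos_north m_bound) nk'.
Qed.

(** The ranks of a valley add up to its position, and those of [x] and [pm_opp x] to [2n-1], the
    position of the deleted letter. So the deletion excludes the one pair in a common row that could
    form a valley. *)
Lemma valley_at_rows k x y : valley_at k x y -> x.2 != y.2.
Proof.
move=> v; have [_ rr _ _ kl] := valley_at_facts v; have [kn _ _ _] := v.
case: (rows_cases x y) => // e; subst y.
  by move: kl; rewrite /period; lia.
by have := rk_opp m x; lia.
Qed.

(** No integer lies strictly between h and h+1, so only steps of [pm_opp y], whose difference with
    [y] is not a root, can intervene between the East step of [x] and the North step of [y]. If its
    North step does, the ranks of [pm_opp y] and [y] are consecutive and add up to [2n-1], hence are
    [n-1] and [n]. *)
Lemma floor_valley x y : floor x y -> (rk x + rk y < (2 * n).-1)%N ->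
  valley_at (pos (true, x)) x y \/
  [/\ rk y = n, valley_at (pos (true, x)) x (pm_opp y),
      pos (false, pm_opp y) = (pos (true, x)).+1
    & ((pos (true, x)).+2 < (2 * n).-1)%N -> pos (false, y) = (pos (true, x)).+2].
Proof.
case/andP=> xy /eqP f rxy; set k := pos (true, x).
have yx : key y < key (pm_opp x).
  by rewrite -rk_lt; have := rk_opp m x; lia.
have ek : easts n m k = rk x by rewrite easts_pos.
have ky : key x + period n < key y by rewrite key_zz1 // f; lia.
have kpy : (k < pos (false, y))%N by rewrite pos_north_east.
have kn4 : (k < 4 * n)%N by exact: pos_max.
have kk : (rk x + norths n m k = k)%N.
  by have := easts_norths m_bound (ltnW kn4); rewrite ek.
have ek' : easts n m k.+1 = (rk x).+1 by rewrite easts_step // ek addn1.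
have nk' : norths n m k.+1 = norths n m k by rewrite norths_step // addn0.
have nky : (norths n m k <= rk y)%N by rewrite -(pos_north m_bound) ltnW.
have ryo := rk_opp m y.
(* A North step of an entry in a third row would give a value on z strictly between h and h+1; [noE]
   is the same for East steps. *)
have noN u : key x + period n < key u -> key u < key y -> u = pm_opp y.
  move=> h1 h2; case: (rows_cases x u) => [e|e|xu].
  - by move: h1; rewrite e /period; lia.
  - by move: h2; rewrite e; lia.
  case: (rows_cases y u) => // [e|yu]; first by move: h2; rewrite e; lia.
  have := key_zz1 xu; rewrite h1 => /esym z1.
  have uy : u.2 != y.2 by rewrite eq_sym.
  have := key_zz0 uy; rewrite h2 => /esym z2; lia.
have noE u : key x < key u -> key u + period n < key y -> u = pm_opp y.
  move=> h1 h2; case: (rows_cases x u) => [e|e|xu].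
  - by move: h1; rewrite e; lia.
  - by move: h2; rewrite e /period; lia.
  case: (rows_cases y u) => // [e|yu]; first by move: h2; rewrite e /period; lia.
  have := key_zz0 xu; rewrite h1 => /esym z1.
  have uy : u.2 != y.2 by rewrite eq_sym.
  have := key_zz1 uy; rewrite h2 => /esym z2; lia.
case: (ltnP (norths n m k) (rk y)) => nkl; last first.
  left; split=> //; [lia|lia|] => kn2.
  have [[[] u] pu] : exists a, pos a = k.+1 by apply: (pos_onto m_bound); lia.
    have ru : rk u = (rk x).+1 by rewrite -(easts_pos m_bound) pu ek'.
    have : u = pm_opp y.
      apply: noE; first by rewrite -rk_lt ru.
      by apply: (north_after m_bound); rewrite pu nk'.
    by move=> uy; move: ru; rewrite uy; lia.
  have ru : rk u = rk y by rewrite -(norths_pos m_bound) pu nk'; lia.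
  by rewrite -(rk_inj ru).
have toN u : (norths n m k <= rk u)%N -> (rk u < rk y)%N -> u = pm_opp y.
  move=> h1 h2; apply: noN; last by rewrite -rk_lt.
  exact: (north_after m_bound).
have ry : rk y = n.
  have [|u ru] := @rk_onto n m (rk y).-1; first by lia.
  have : u = pm_opp y by apply: toN; lia.
  by move=> uy; move: ru; rewrite uy; lia.
have nkn : norths n m k = n.-1.
  case: (ltnP (norths n m k) n.-1) => [l|]; last by lia.
  have [|u ru] := @rk_onto n m n.-2; first by lia.
  have : u = pm_opp y by apply: toN; lia.
  by move=> uy; move: ru; rewrite uy; lia.
right; have py1 : pos (false, pm_opp y) = k.+1.
  have [[[] u] pu] : exists a, pos a = k.+1 by apply: (pos_onto m_bound); lia.
    have ru : rk u = (rk x).+1 by rewrite -(easts_pos m_bound) pu ek'.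
    have pl : (pos (true, u) < pos (false, pm_opp y))%N.
      rewrite pu ltn_neqAle -{1}pu (pos_north m_bound) nk'; apply/andP; split; last by lia.
      by apply/eqP => /(pos_inj m_bound).
    have {}pl : key u + period n < key (pm_opp y) by rewrite -pos_north_east.
    have yy : key (pm_opp y) < key y by rewrite -rk_lt; lia.
    have : u = pm_opp y by apply: noE; [rewrite -rk_lt ru | lia].
    by move=> uy; move: pl; rewrite uy /period; lia.
  have ru : rk u = rk (pm_opp y) by rewrite -(norths_pos m_bound) pu nk'; lia.
  by rewrite -(rk_inj ru).
split=> //; first by split=> //; lia.
have ek2 : easts n m k.+2 = (rk x).+1 by rewrite -{1}py1 easts_step // py1 ek' addn0.
have nk2 : norths n m k.+2 = n.
  by rewrite -{1}py1 norths_step // py1 nk' nkn addn1; lia.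
move=> k2; have [[[] u] pu] : exists a, pos a = k.+2 by apply: (pos_onto m_bound); lia.
  have ru : rk u = (rk x).+1 by rewrite -(easts_pos m_bound) pu ek2.
  have : u = pm_opp y.
    apply: noE; first by rewrite -rk_lt ru.
    by apply: (north_after m_bound); rewrite pu nk2 ry.
  by move=> uy; move: ru; rewrite uy; lia.
have ru : rk u = rk y by rewrite -(norths_pos m_bound) pu nk2.
by rewrite -(rk_inj ru).
Qed.

Hypothesis m_step : forall i, (i.+1 < n)%N -> m i - 1 <= m i.+1.
Hypothesis m_first : -1 <= m 0 + m 1%N.
Hypothesis m_last : m n.-2 + m n.-1 <= 2.

Lemma valley_floor k x y : valley_at k x y -> floor x y.
Proof.
move=> v; have xy := valley_at_rows v; have [kn pk nk ny] := v.
have [ek rr ek' nk' kl] := valley_at_facts v.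
rewrite /floor xy; apply/eqP; apply: minimal_root => //; first by rewrite -key_zz1.
move=> w wx wy; split=> [h1 h2|h1 h2].
  have : (pos (true, x) < pos (false, w))%N.
    by rewrite pos_north_east // key_zz1 1?eq_sym.
  rewrite pk (pos_north m_bound) nk' leqNgt => /negP; apply.
  by rewrite rk_lt key_zz0.
have rxw : (rk x < rk w)%N by rewrite rk_lt key_zz0 1?eq_sym.
have pwy : (pos (true, w) < pos (false, y))%N by rewrite pos_north_east // key_zz1.
have pw : (k < pos (true, w))%N by rewrite (pos_east m_bound) ek'.
have npy : pos (false, y) != k.+1 by lia.
(* The East step of [w] lies between that of [x] and the North step of [y], so the latter is not the
   next letter: the valley can only be the East step that ends the truncated word. *)
have kE : k = (2 * n).-2 by case: (ltnP k (2 * n).-2) => [/ny e|]; lia.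
(* This letter is the deleted one. If it is an East step, its rank shows that it comes from
   [pm_opp y]; flipping the relation between [w] and [y] then bounds the rank of [w] from above as
   well, which puts [w] in the row of [y]. *)
have [[[] u] pu] : exists a, pos a = k.+1 by apply: (pos_onto m_bound); lia.
  have ru : rk u = (rk x).+1 by rewrite -(easts_pos m_bound) pu ek'.
  have ry := rk_opp m y.
  have uy : u = pm_opp y by apply: (@rk_inj n m); lia.
  have lw : (pos (true, u) < pos (false, pm_opp w))%N.
    by rewrite pos_north_east //; move: pwy; rewrite pos_north_east // uy !ckey_opp; lia.
  have nu : norths n m k.+2 = rk y by rewrite -{1}pu norths_step // pu nk' addn0.
  move: lw; rewrite pu (pos_north m_bound) nu => lw.
  have := rk_opp m w => rw; have wu : rk w = rk u by lia.
  by move: wy; rewrite (rk_inj wu) uy eqxx.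
have ru : rk u = rk y by rewrite -(norths_pos m_bound) pu nk'.
by move: npy; rewrite -(rk_inj ru) pu eqxx.
Qed.

(** No East step separates the two middle North steps, so a valley at the first one yields a floor
    for each of [y] and [pm_opp y]. The two inequalities between labels together are the condition
    with the absolute value of [w(1)]. *)
Lemma middle_floor k x y : valley_at k x y -> rk y = n.-1 -> pos (false, y) = k.+1 ->
  ((k.+2 < (2 * n).-1)%N -> pos (false, pm_opp y) = k.+2) ->
  floor x (pm_opp y).
Proof.
move=> v ryn py py'; have xy := valley_at_rows v; have [kn pk nk _] := v.
have [ek rr ek' nk' kl] := valley_at_facts v.
have ryo : rk (pm_opp y) = n by have := rk_opp m y; lia.
have yy : key y < key (pm_opp y) by rewrite -rk_lt; lia.
rewrite /floor row_opp_neq //; apply/eqP; apply: minimal_root => //.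
  by rewrite -key_zz1 //; lia.
move=> w wx wy; split=> [h1 h2|h1 h2].
  have : (pos (true, x) < pos (false, w))%N.
    by rewrite pos_north_east // key_zz1 1?eq_sym.
  rewrite pk (pos_north m_bound) nk' => lw.
  have : (rk w < rk (pm_opp y))%N by rewrite rk_lt key_zz0.
  have : rk w != rk y by apply: contraNneq wy => /rk_inj ->.
  lia.
have rxw : (rk x < rk w)%N by rewrite rk_lt key_zz0 1?eq_sym.
have pwy : (pos (true, w) < pos (false, pm_opp y))%N.
  by rewrite pos_north_east // key_zz1.
have pw : (k < pos (true, w))%N by rewrite (pos_east m_bound) ek'.
have npw : pos (true, w) != k.+1 by rewrite -py; apply/eqP => /(pos_inj m_bound).
have npy : pos (false, pm_opp y) != k.+2 by lia.
have bal := easts_le_norths m_bound (_ : (k.+1 <= 4 * n)%N).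
have {}bal : ((rk x).+1 <= rk y)%N by rewrite -ek' -nk' bal //; lia.
have kE : k.+2 = (2 * n).-1 by case: (ltnP k.+2 (2 * n).-1) => [/py' e|]; lia.
have ek2 : easts n m k.+2 = (rk x).+1 by rewrite -{1}py easts_step // py ek' addn0.
have nk2 : norths n m k.+2 = (rk y).+1 by rewrite -{1}py norths_step // py nk' addn1.
have [[[] u] pu] : exists a, pos a = k.+2 by apply: (pos_onto m_bound); lia.
  have ru : rk u = (rk x).+1 by rewrite -(easts_pos m_bound) pu ek2.
  have wy1 : rk w != rk y by apply: contraNneq wy => /rk_inj ->.
  have wy2 : rk w != rk (pm_opp y) by apply: contraNneq wy => /rk_inj ->.
  have : (rk (pm_opp y) < rk w)%N by lia.
  by rewrite rk_lt; move: pwy; rewrite pos_north_east // /period; lia.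
have ru : rk u = rk (pm_opp y) by rewrite -(norths_pos m_bound) pu nk2; lia.
by move: npy; rewrite -(rk_inj ru) pu eqxx.
Qed.

End Valleys.

(** * Lattice paths and their area vectors *)

Lemma north_pos_spec p i : (0 < i <= num_north p)%N ->
  [/\ (north_pos p i < size p)%N, nth true (eshape p) (north_pos p i) = false
    & num_north (take (north_pos p i) p) = i.-1].
Proof.
move=> /andP[i0 ip]; have np : (north_pos p i < size p)%N.
  rewrite /north_pos; set l := [seq _ <- _ | _].
  have := @mem_nth _ (size p) l i.-1; rewrite {1}mem_filter mem_iota add0n.
  move=> mm; apply: (andP (andP (mm _)).2).2; rewrite size_filter.
  have := @count_nth_iota _ (pred1 N) E p (size p) (leqnn _); rewrite take_size => ->.
  by rewrite -/(num_north p); lia.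
have := north_pos_eq i0 np; rewrite eqxx => /esym/andP[/negbTE e /eqP e2].
by split.
Qed.

Lemma north_pos_uniq p k : (k < size p)%N -> nth true (eshape p) k = false ->
  north_pos p (num_north (take k p)).+1 = k /\ (num_north (take k p) < num_north p)%N.
Proof.
move=> kp e; split; first by apply/eqP; rewrite north_pos_eq // e eqxx.
rewrite -[X in (_ < num_north X)%N](cat_take_drop k p) /num_north count_cat.
rewrite (drop_nth E) //=; move: e; rewrite (nth_map E) // /is_east => /negbFE ->; lia.
Qed.

Lemma easts_beforeE p i : (0 < i <= num_north p)%N ->
  (easts_before p i + i.-1)%N = north_pos p i.
Proof.
move=> ip; have [np _ e] := north_pos_spec ip; rewrite /easts_before -e addnC.
by rewrite num_letters size_take np.
Qed.

Lemma north_pos_lt p i j : (0 < i)%N -> (i < j <= num_north p)%N ->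
  (north_pos p i < north_pos p j)%N.
Proof.
move=> i0 /andP[ij jp]; have [|ni _ ei] := @north_pos_spec p i; first by lia.
have [|nj _ ej] := @north_pos_spec p j; first by lia.
rewrite ltnNge; apply/negP => /(@count_take_mono _ (pred1 N) p).
by rewrite -!/(num_north _) ei ej; lia.
Qed.

Lemma onth_lt T x0 (s : seq T) k : (k < size s)%N -> onth s k = Some (nth x0 s k).
Proof. by move=> ks; rewrite onthE (nth_map x0). Qed.

Lemma mem_rises p i :
  (i \in rises p) = (0 < i < num_north p)%N && (easts_before p i == easts_before p i.+1).
Proof.
rewrite /rises mem_filter mem_iota andbC.
case: (posnP i) => [->|i0]; first by [].
case: (leqP i (num_north p)) => ip; last first.
  have -> : (i < 1 + num_north p)%N = false by lia.
  by have -> : (i < num_north p)%N = false by lia.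
have [//|np ne e] := @north_pos_spec p i; first by rewrite i0.
have onthE : (onth p (north_pos p i).+1 == Some N) =
    ((north_pos p i).+1 < size p)%N && ~~ nth true (eshape p) (north_pos p i).+1.
  case: ltnP => l; last by rewrite onth_default.
  by rewrite (onth_lt N) // (nth_map N) // /is_east negbK.
have tk : num_north (take (north_pos p i).+1 p) = i.
  rewrite (take_nth E) // -cats1 /num_north count_cat -/(num_north _) e /=.
  by move: ne; rewrite (nth_map E) // /is_east => /negbFE ->; lia.
rewrite add1n ltnS ip /= onthE; case: (ltnP i (num_north p)) => ip2 /=.
  have ip2' : (0 < i.+1 <= num_north p)%N by [].
  have h1 := @easts_beforeE p i; have h2 := easts_beforeE ip2'.
  have lt := @north_pos_lt p i i.+1 i0; rewrite ltnS leqnn ip2 in lt.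
  have [np2 ne2 e2] := north_pos_spec ip2'.
  apply/andP/eqP => [[l /negbTE n1]|ee].
    have [] := north_pos_uniq l n1; rewrite tk => h3 _; move: h1 h2; rewrite i0 ip h3; lia.
  have h3 : north_pos p i.+1 = (north_pos p i).+1 by move: h1 h2; rewrite i0 ip; lia.
  by rewrite -h3 np2 ne2.
apply/negP => /andP[l /negbTE n1].
by have [_] := north_pos_uniq l n1; rewrite tk; lia.
Qed.

Section Path.
Variables (n : nat) (p : seq letter).
Hypothesis n3 : (2 < n)%N.
Hypothesis pL : signed_lattice_path n p.

Local Notation a := (easts_before p).

Lemma path_easts : num_east p = n.-1. Proof. by case/and3P: pL => /eqP. Qed.
Lemma path_norths : num_north p = n. Proof. by case/and3P: pL => _ /eqP. Qed.
Lemma path_size : size p = (2 * n).-1.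
Proof. by rewrite -num_letters path_easts path_norths; lia. Qed.

Lemma path_signed k : (k < size p)%N ->
  is_signed (nth N p k) = (k == 0%N) && is_east (nth N p k).
Proof.
move=> kp; case/and3P: pL => _ _ /allP/(_ k); rewrite mem_iota add0n => /(_ kp).
have := is_east (nth N p k); have : is_signed (nth N p k) -> is_east (nth N p k).
  by case: (nth N p k).
by case: (k == 0%N); case: (is_signed _); case: (is_east _) => // /(_ isT).
Qed.

Lemma path_mono i : (0 < i < n)%N -> (a i <= a i.+1)%N.
Proof.
move=> /andP[i0 i1]; have := @north_pos_lt p i i.+1 i0.
have := @easts_beforeE p i; have := @easts_beforeE p i.+1.
by rewrite path_norths; lia.
Qed.

Lemma path_bound i : (a i <= n.-1)%N.
Proof.
rewrite -path_easts -[X in (_ <= num_east X)%N](cat_take_drop (north_pos p i) p).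
by rewrite /num_east count_cat leq_addr.
Qed.

Lemma path_eps : eps p = 1 \/ eps p = -1.
Proof. by rewrite /eps; case: ifP; [right | left]. Qed.

(** The area vector distinguishes cases by n modulo 4, and its last entry also by the parity of the
    path. Together these reduce to the sign of the first entry, given here, and to the choice
    between two formulas for the last entry, made by [last_flag]. *)
Definition lead_sign : int := if cond03 n then eps p else - eps p.
Definition last_flag : bool :=
  ~~ odd (\sum_(1 <= k < n.-1) a k) == cond03 n.
Definition mrow (i : nat) : int := mu n p i.+1.

Lemma mrow0 : mrow 0 = lead_sign * (a 1%N)%:Z.
Proof. by rewrite /mrow /mu /lam /lead_sign /=; case: ifP => _; rewrite ?mulNr ?subrr ?subr0. Qed.

Lemma mrow_mid i : (0 < i < n.-1)%N -> mrow i = (a i.+1)%:Z - i%:Z.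
Proof.
move=> ii; rewrite /mrow /mu /lam /=.
have -> : (i.+1 == 1)%N = false by lia.
have -> : (i.+1 < n)%N by lia.
by case: ifP => _; rewrite -[i.+1]addn1 PoszD addrK.
Qed.

Lemma mrow_last :
  mrow n.-1 = if last_flag then 2 * (a n)%:Z - (a n.-1)%:Z - n%:Z + 1
              else n%:Z - 2 * (a n)%:Z + (a n.-1)%:Z.
Proof.
rewrite /mrow /mu /lam /last_flag prednK; last by lia.
have -> : (n == 1)%N = false by lia.
rewrite ltnn; case: (cond03 n); case: (odd _) => /=; lia.
Qed.

Lemma lead_sign_cases : lead_sign = 1 \/ lead_sign = -1.
Proof. by rewrite /lead_sign; case: path_eps => ->; case: ifP; auto; rewrite ?opprK; auto. Qed.

Lemma mrow_step i : (i.+1 < n)%N -> mrow i - 1 <= mrow i.+1.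
Proof.
move=> ii; have [i0|i0] := posnP i.
  rewrite i0 mrow0 mrow_mid; last by lia.
  have := @path_mono 1; case: lead_sign_cases => ->; lia.
rewrite mrow_mid; last by lia.
case: (ltnP i.+1 n.-1) => i1.
  rewrite mrow_mid; last by lia.
  have := @path_mono i.+1; lia.
have ni : n.-1 = i.+1 by lia.
rewrite -ni mrow_last ni; have := path_bound n; have := @path_mono i.+1.
have -> : i.+2 = n by lia.
by case: last_flag; lia.
Qed.

Lemma mrow_first : -1 <= mrow 0 + mrow 1.
Proof.
rewrite mrow0 mrow_mid; last by lia.
have := @path_mono 1; case: lead_sign_cases => ->; lia.
Qed.

(** Under the flag the sum is odd and never equals 2; otherwise it equals 2 exactly when
    [a n = a n.-1]. So the flag tells on which of the two end walls the last rise lies. *)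
Lemma mrow_pair : mrow n.-2 + mrow n.-1 =
  if last_flag then 2 * (a n)%:Z - 2 * n%:Z + 3
  else 2 - 2 * ((a n)%:Z - (a n.-1)%:Z).
Proof.
rewrite mrow_last mrow_mid; last by lia.
have -> : n.-2.+1 = n.-1 by lia.
by case: last_flag; lia.
Qed.

Lemma mrow_final : mrow n.-2 + mrow n.-1 <= 2.
Proof.
rewrite mrow_pair; have := path_bound n; have := @path_mono n.-1.
have -> : n.-1.+1 = n by lia.
by case: last_flag; lia.
Qed.

Lemma mrow_bound i : (i < n)%N -> - (2 * n%:Z) < mrow i < 2 * n%:Z.
Proof.
move=> ii; have b := path_bound; have [i0|i0] := posnP i.
  by rewrite i0 mrow0; have := b 1%N; case: lead_sign_cases => ->; lia.
case: (ltnP i n.-1) => i1.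
  by rewrite mrow_mid; [have := b i.+1; lia | lia].
have -> : i = n.-1 by lia.
by rewrite mrow_last; have := b n; have := b n.-1; case: last_flag; lia.
Qed.

Lemma take2_NN : (take 2 p == [:: N; N]) = (a 1%N == 0%N) && (a 2 == 0%N).
Proof.
have e1 := @easts_beforeE p 1; have e2 := @easts_beforeE p 2; have s := path_size.
rewrite path_norths in e1 e2; rewrite /= addn0 in e1.
have [|n1 s1 t1] := @north_pos_spec p 1; first by rewrite path_norths; lia.
have [|n2 s2 t2] := @north_pos_spec p 2; first by rewrite path_norths; lia.
have lt := @north_pos_lt p 1 2 isT; rewrite path_norths in lt.
apply/eqP/andP => [h|[/eqP a1 /eqP a2]].
  have [u pe] : exists u, p = [:: N, N & u] by exists (drop 2 p); rewrite -{1}(cat_take_drop 2 p) h.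
  have x1 : north_pos p 1 = 0%N by have [||] := @north_pos_uniq p 0; rewrite pe.
  have x2 : north_pos p 2 = 1%N by have [||] := @north_pos_uniq p 1; rewrite pe.
  by split; apply/eqP; lia.
move: s1 s2; have -> : north_pos p 1 = 0%N by lia.
have -> : north_pos p 2 = 1%N by lia.
case: p s => [|x [|y q]] /=; try lia.
by rewrite /is_east => _ /negbFE/eqP -> /negbFE/eqP ->; rewrite take0.
Qed.

End Path.

Lemma SB_opp n (v : {perm pm n}) x : v \in SB n -> v (pm_opp x) = pm_opp (v x).
Proof. by rewrite inE => /forallP/(_ x)/eqP. Qed.

Lemma sapp_pm n (v : {perm pm n}) x : sapp v (pm_val x) = pm_val (v x).
Proof.
rewrite /sapp pm_valE; case: x => b i /=.
have -> : `|(if b then - (i.+1)%:Z else (i.+1)%:Z)|%N = i.+1 by case: b; lia.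
by rewrite /= valK; congr (pm_val (v (_, _))); case: b; lia.
Qed.

(** * Floors are simple walls *)

Section Floors.
Variables (n : nat) (m : nat -> int).
Hypothesis n3 : (2 < n)%N.

(** In [aht - h * aphi = h + 1] with a height strictly between 0 and h, only height 1 and
    [aphi = -1] are possible. *)
Lemma floor_aht (x y : pm n) : floor m x y ->
  exists k, aht x y k = 1 /\ aphi m x y k = -1.
Proof.
case/andP=> xy /eqP e; have [k kh] := aht_exists n3 xy; exists k.
move: e kh; rewrite (zz_diff _ _ _ k); have : 3 < cox n by rewrite /cox; lia.
move: (aht x y k) (aphi m x y k) (cox n) => A P H h3 e kh.
have pm1 : P = -1 by case: (ltrgtP P (-1)); nia.
by subst P; split=> //; lia.
Qed.

Lemma floor_cases (x y : pm n) : (x.2 < y.2)%N -> floor m x y ->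
  [\/ [/\ x.1 = false, y.1 = false, (y.2 : nat) = x.2.+1 & m x.2.+1 = m x.2 - 1],
      [/\ x.1 = true, y.1 = false, (x.2 : nat) = 0%N, (y.2 : nat) = 1%N
        & m 0 + m 1%N = -1]
    | [/\ x.1 = false, y.1 = true, (x.2 : nat) = n.-2, (y.2 : nat) = n.-1
        & m n.-2 + m n.-1 = 2]].
Proof.
move=> ij f; have [k [e p]] := floor_aht f; have [xy _] := andP f.
have := @aht_level n n3 x y k xy; rewrite e.
have h1 : 1 < cox n by rewrite /cox; lia.
rewrite h1 => /(_ isT); case: x y ij e p {f xy} => [b i] [c j] /= ij e p.
have jn := ltn_ord j; move: e p; rewrite /aht /aphi /rho /ext /cox /=.
case: b; case: c => /= e p o.
- by exfalso; case: o => -[? _]; subst k; lia.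
- have k0 : k = 0 by case: o => -[? _]; subst k; lia.
  have [i0 j1] : (i : nat) = 0%N /\ (j : nat) = 1%N by subst k; lia.
  by constructor 2; split=> //; move: p; rewrite i0 j1; lia.
- have k0 : k = 1 by case: o => -[? _]; subst k; lia.
  have [i0 j1] : (i : nat) = n.-2 /\ (j : nat) = n.-1 by subst k; lia.
  by constructor 3; split=> //; move: p; rewrite i0 j1; lia.
- have k0 : k = 0 by case: o => -[? _]; subst k; lia.
  have ji : (j : nat) = i.+1 by subst k; lia.
  by constructor 1; split=> //; move: p; rewrite ji; lia.
Qed.

Lemma floor_mk (x y : pm n) k : x.2 != y.2 -> aht x y k = 1 -> aphi m x y k = -1 ->
  floor m x y.
Proof. by move=> xy e p; rewrite /floor xy (zz_diff _ _ _ k) e p; apply/eqP; ring. Qed.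

End Floors.

(** * Label conditions at the rises and at the floors *)

Section Labels.
Variables (n : nat) (p : seq letter).
Hypothesis n3 : (2 < n)%N.

Local Notation a := (easts_before p).
Local Notation m := (mrow n p).

(* Rows whose label changes sign in [row_sign]. *)
Definition row_neg (i : nat) : bool :=
  if i == n.-1 then ~~ last_flag n p else (i == 0%N) && (lead_sign n p == -1).
Definition tw (x : pm n) : pm n := (x.1 (+) row_neg x.2, x.2).

Lemma twK : involutive tw.
Proof. by case=> b i; rewrite /tw /= -addbA addbb addbF. Qed.

Lemma tw_opp x : tw (pm_opp x) = pm_opp (tw x).
Proof. by case: x => b i; rewrite /tw /pm_opp /= addNb. Qed.

Lemma row_neg_mid i : (0 < i < n.-1)%N -> row_neg i = false.
Proof. by move=> ii; rewrite /row_neg; case: eqP => [|_]; [lia | case: eqP => //; lia]. Qed.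

Lemma row_neg0 : row_neg 0 = (lead_sign n p == -1).
Proof. by rewrite /row_neg; case: eqP => //; lia. Qed.

Lemma row_neg_last : row_neg n.-1 = ~~ last_flag n p.
Proof. by rewrite /row_neg eqxx. Qed.

Hypothesis pL : signed_lattice_path n p.
Variable v : {perm pm n}.
Hypothesis vB : v \in SB n.

Definition lab (x : pm n) : int := pm_val (v (tw x)).

Lemma lab_opp x : lab (pm_opp x) = - lab x.
Proof. by rewrite /lab tw_opp SB_opp // pm_val_opp. Qed.

Definition val_row (i : nat) : int := sapp v (i.+1)%:Z.

Lemma lab_val x : lab x =
  if x.1 (+) row_neg x.2 then - val_row x.2 else val_row x.2.
Proof.
case: x => b i; rewrite /lab /tw /val_row /=.
have -> : (i.+1)%:Z = pm_val (false, i) by rewrite pm_valE.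
rewrite sapp_pm; case: (b (+) _) => //.
by rewrite -pm_val_opp -SB_opp.
Qed.

Definition rise_cond : Prop :=
  (forall i, (0 < i < n)%N -> a i = a i.+1 -> val_row i.-1 < val_row i) /\
  (a 1%N = 0%N -> a 2 = 0%N -> `|val_row 0| < val_row 1).

(** Inner walls are rises as they stand. At the left end, one of the walls [e_1 - e_0] and
    [e_1 + e_0] means a rise at row 1 and the other a path starting with two North steps;
    [lead_sign] says which. At the right end [last_flag] selects the only wall that can be a floor.
    In both places the twist by [row_neg] turns the inequality at the wall into the one at the
    rise. *)
Lemma rises_floors : rise_cond -> forall x y, floor m x y -> lab x < lab y.
Proof.
case=> rc nn x y f; have xy : x.2 != y.2 by case/andP: f.
move: x y xy f; apply: root_wlog => [x y IH|].
  by rewrite -floor_opp => /IH; rewrite !lab_opp ltrN2.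
move=> x y xy /(floor_cases n3 xy) h; rewrite !lab_val.
have m1 : m 1%N = (a 2)%:Z - 1 by rewrite (mrow_mid n3 pL); lia.
have p1 := @path_mono n p n3 pL 1; have pn := @path_mono n p n3 pL n.-1.
have pnn : n.-1.+1 = n by lia.
case: h => [[-> -> ji e]|[-> -> -> -> e]|[-> -> -> -> e]].
- rewrite ji; have jn := ltn_ord y.2; have [i0|i0] := posnP x.2.
    rewrite i0 row_neg0 row_neg_mid; last by lia.
    move: e; rewrite i0 (mrow0 n p) m1 /=; case: (lead_sign_cases n p) => -> e /=.
      by apply: (rc 1%N); lia.
    have [a1 a2] : a 1%N = 0%N /\ a 2 = 0%N by lia.
    by have := nn a1 a2; lia.
  have rx : row_neg x.2 = false by apply: row_neg_mid; lia.
  case: (ltnP x.2.+1 n.-1) => il.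
    rewrite rx row_neg_mid; last by lia.
    move: e; rewrite !(mrow_mid n3 pL); [|lia..] => e.
    by apply: (rc x.2.+1); lia.
  have xn : x.2.+1 = n.-1 by lia.
  rewrite rx xn row_neg_last; have xn2 : (x.2 : nat) = n.-2 by lia.
  move: e; rewrite xn (mrow_last n3 pL) (mrow_mid n3 pL) ?xn; last by lia.
  rewrite xn2; case: (last_flag n p) => /= e; last by have := path_bound pL n; lia.
  by have := rc n.-1; rewrite pnn; apply; lia.
- rewrite row_neg0 row_neg_mid; last by lia.
  move: e; rewrite (mrow0 n p) m1 /=; case: (lead_sign_cases n p) => -> e /=.
    have [a1 a2] : a 1%N = 0%N /\ a 2 = 0%N by lia.
    by have := nn a1 a2; lia.
  by apply: (rc 1%N); lia.
- rewrite row_neg_last row_neg_mid; last by lia.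
  move: e; rewrite (mrow_pair n3 pL); case: (last_flag n p) => /= e; first by lia.
  by have := rc n.-1; rewrite pnn; apply; lia.
Qed.

Lemma floors_rises : (forall x y, floor m x y -> lab x < lab y) -> rise_cond.
Proof.
move=> F; have m1 : m 1%N = (a 2)%:Z - 1 by rewrite (mrow_mid n3 pL); lia.
have i0n : (0 < n)%N by lia.
have i1n : (1 < n)%N by lia.
have key b c i j (ii : (i < n)%N) (jj : (j < n)%N) k : i != j ->
    aht (b, Ordinal ii) (c, Ordinal jj) k = 1 ->
    aphi m (b, Ordinal ii) (c, Ordinal jj) k = -1 ->
    (if b (+) row_neg i then - val_row i else val_row i) <
    (if c (+) row_neg j then - val_row j else val_row j).
  move=> ij e1 e2; have := F (b, Ordinal ii) (c, Ordinal jj) (@floor_mk n m (b, Ordinal ii) (c, Ordinal jj) k ij e1 e2).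
  by rewrite !lab_val.
have r0 := row_neg0.
have k0 := key false false 0%N 1%N i0n i1n 0 isT.
have k1 := key true false 0%N 1%N i0n i1n 0 isT.
rewrite (@row_neg_mid 1) /= in k0 k1; try lia.
rewrite r0 {}/aht {}/aphi /rho /ext /= (mrow0 n p) m1 in k0 k1.
split=> [i ii ai|a1 a2].
  case: (ltnP 1 i) => i1; last first.
    have i1' : i = 1%N by lia.
    subst i; move: k0 k1; case: (lead_sign_cases n p) => -> /= k0 k1.
      by apply: k0; lia.
    by move: k1; rewrite opprK; apply; lia.
  have ip : (i.-1 < n)%N by lia.
  have il : (i < n)%N by lia.
  case: (ltnP i n.-1) => ni.
    have := key false false i.-1 i ip il 0; rewrite !row_neg_mid; [|lia..].
    rewrite /aht /aphi /rho /ext /= !(mrow_mid n3 pL); [|lia..].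
    by rewrite prednK; [move=> k; apply: k; lia | lia].
  have ni' : i = n.-1 by lia.
  have := key false true i.-1 i ip il 1; have := key false false i.-1 i ip il 0.
  have pnn : n.-1.+1 = n by lia.
  rewrite row_neg_mid; last by lia.
  have -> : row_neg i = ~~ last_flag n p by rewrite ni' row_neg_last.
  have mp := mrow_pair n3 pL; have mi : m i = m n.-1 by rewrite ni'.
  have mi1 : m i.-1 = m n.-2 by rewrite ni'.
  rewrite /aht /aphi /rho /ext /cox /= mi mi1.
  have ml := mrow_last n3 pL; have mm : m n.-2 = (a n.-1)%:Z - n.-2%:Z.
    rewrite (mrow_mid n3 pL); [by congr (_%:Z - _); congr (a _); lia | lia].
  move: ai; rewrite ni' pnn => ai; rewrite mm ml.
  case: (last_flag n p) => /= k2 k3; first by apply: k2; lia.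
  by apply: k3; lia.
rewrite a1 a2 !mulr0 in k0 k1.
move: k0 k1; case: (lead_sign_cases n p) => -> /= k0 k1.
  have := k0 _ _; have := k1 _ _; lia.
have := k0 _ _; have := k1 _ _; lia.
Qed.

End Labels.

(** * Reading words *)

Definition item_letter n (a : item n) : letter := if a.1 then E else N.

Lemma iota_enum n : iota 1 n = map (fun i : 'I_n => (i : nat).+1) (enum 'I_n).
Proof. by rewrite (map_comp S (fun i : 'I_n => i : nat)) val_enum_ord -(addn0 1%N) iotaDl. Qed.

Section Words.
Variables (n : nat) (p : seq letter).
Local Notation m := (mrow n p).

Lemma areaE : area n p = [seq m i | i : 'I_n <- enum 'I_n].
Proof. by rewrite /area iota_enum -map_comp. Qed.

Lemma pmap_items_at T (F : int -> option letter) (g : T -> pm n) (z : T -> int) j (s : seq T) :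
  (forall t, F (z t) = omap (@item_letter n) (item_at m j (g t))) ->
  pmap F (map z s) = map (@item_letter n) (items_at m j (map g s)).
Proof.
move=> e; elim: s => //= t s IH; rewrite e /items_at /=.
by case: item_at => [x|] //=; rewrite IH.
Qed.

Lemma level_word j :
  S_minus_rev j (area n p) ++ S_plus j (area n p) =
  map (@item_letter n) (items_at m j (rowseq n)).
Proof.
rewrite /rowseq /S_minus_rev /S_plus areaE -map_rev -[rev (map (pair true) _)]map_rev.
rewrite /items_at pmap_cat map_cat -!/(items_at _ _ _); congr cat; apply: pmap_items_at => i.
  rewrite /item_at /ext /= (_ : (m i == - j%:Z) = (- m i == j%:Z)); last first.
    by apply/idP/idP; lia.
  case: ifP => // _; rewrite (_ : (m i == - j%:Z - 1) = (- m i == j%:Z + 1)).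
    by case: ifP.
  by apply/idP/idP; lia.
by rewrite /item_at /ext /=; case: ifP => // _; case: ifP.
Qed.

Lemma pmap_flatten_word :
  flatten [seq S_minus_rev j (area n p) ++ S_plus j (area n p) | j <- rev (iota 0 (2 * n))] =
  map (@item_letter n) (zitems n m).
Proof.
rewrite /zitems map_flatten -map_comp; congr flatten.
by apply: eq_map => j; rewrite level_word.
Qed.

Definition reading : seq (pm n) :=
  flatten [seq [seq (false, i) | i <- [seq i : 'I_n <- enum 'I_n | m i == - j%:Z]]
               ++ [seq (true, i) | i <- [seq i : 'I_n <- rev (enum 'I_n) | m i == j%:Z + 1]]
          | j <- iota 0 (2 * n)].

Lemma rows_wordE (v : {perm pm n}) : v \in SB n ->
  rows_word p v = [seq ((x.2 : nat).+1, pm_val (v x)) | x : pm n <- reading].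
Proof.
move=> vB; rewrite /rows_word /reading map_flatten -map_comp; congr flatten.
apply: eq_map => j /=; rewrite map_cat -!map_comp iota_enum -map_rev !filter_map -!map_comp.
congr cat; apply: eq_map => i /=; congr pair.
  by rewrite -sapp_pm pm_valE.
rewrite -[(true, i)]/(pm_opp (false, i)) SB_opp // pm_val_opp -sapp_pm pm_valE.
by [].
Qed.

Hypothesis n3 : (2 < n)%N.
Hypothesis pL : signed_lattice_path n p.

Let m_bound i : (i < n)%N -> - (2 * n%:Z) < m i < 2 * n%:Z.
Proof. exact: mrow_bound. Qed.

Lemma zetaD_wordE :
  zetaD_word n p = map (@item_letter n) (take (2 * n).-1 (allitems n m)).
Proof.
rewrite /zetaD_word pmap_flatten_word size_map -map_take size_zitems //.
by rewrite /allitems takel_cat // size_zitems //; lia.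
Qed.

(** The reading word is thus the upper half of the signed rows sorted by [ckey]: its entry number
    [i], counted from 0, has rank [n + i], and the lower half consists of the opposites. *)
Lemma mem_reading x : (x \in reading) = (0 < ckey m x).
Proof.
have [v0 v1 v2] := pm_val_bound x; have eb := @ext_bound n m m_bound x.
apply/flatten_mapP/idP => [[j _]|l].
  rewrite mem_cat => /orP[] /mapP[i]; rewrite mem_filter => /andP[/eqP e _] ->.
    by rewrite /ckey /ext /= e pm_valE /= /period; have := ltn_ord i; nia.
  by rewrite /ckey /ext /= e pm_valE /= /period; have := ltn_ord i; nia.
case: x v0 v1 v2 eb l => [[] i]; rewrite pm_valE /ckey /ext /= => v0 v1 v2 eb l.
  have [j ej] : exists j : nat, m i = j%:Z + 1.
    exists `|m i - 1|%N; suff : 1 <= m i by lia.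
    by move: l; rewrite pm_valE /= /period; move: (m i); nia.
  exists j; first by rewrite mem_iota; lia.
  rewrite mem_cat; apply/orP; right; apply/mapP; exists i => //.
  by rewrite mem_filter ej eqxx mem_rev mem_enum.
have [j ej] : exists j : nat, m i = - j%:Z.
  exists `|m i|%N; suff : m i <= 0 by lia.
  by move: l; rewrite pm_valE /= /period; have := ltn_ord i; move: (m i); nia.
exists j; first by rewrite mem_iota; lia.
rewrite mem_cat; apply/orP; left; apply/mapP; exists i => //.
by rewrite mem_filter ej eqxx mem_enum.
Qed.

Lemma pairwise_reading : pairwise (key_lt (ckey m)) reading.
Proof.
have blk j x : x \in [seq (false, i) | i <- [seq i : 'I_n <- enum 'I_n | m i == - j%:Z]] ->
    ckey m x = pm_val x + period n * j%:Z /\ 0 < pm_val x <= n%:Z.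
  move=> /mapP[i]; rewrite mem_filter => /andP[/eqP e _] ->.
  rewrite /ckey /ext /= e pm_valE /=; have := ltn_ord i; split; last by lia.
  by ring.
have blk2 j x : x \in [seq (true, i) | i <- [seq i : 'I_n <- rev (enum 'I_n) | m i == j%:Z + 1]] ->
    ckey m x = pm_val x + period n * (j%:Z + 1) /\ - n%:Z <= pm_val x < 0.
  move=> /mapP[i]; rewrite mem_filter => /andP[/eqP e _] ->.
  rewrite /ckey /ext /= e pm_valE /=; have := ltn_ord i; split; last by lia.
  by ring.
have shift (l : seq (pm n)) (c : int) : {in l, forall x, ckey m x = pm_val x + c} ->
    pairwise (key_lt (@pm_val n)) l -> pairwise (key_lt (ckey m)) l.
  move=> lc; apply: sub_in_pairwise (allss l) => x y xl yl.
  by rewrite /key_lt !lc // ltrD2r.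
apply: (@pairwise_flatten _ _ _ ltn).
- by rewrite -sorted_pairwise; [exact: iota_ltn_sorted | exact: ltn_trans].
- move=> j; rewrite pairwise_cat; apply/and3P; split.
  + apply/allrelP => x y /blk[xe xb] /blk2[ye yb].
    by rewrite /key_lt xe ye /period; lia.
  + apply: (shift _ (period n * j%:Z)) => [x /blk[] //|].
    rewrite (pairwise_map (pair false)); apply: pairwise_filter.
    apply: sub_pairwise (pairwise_enum_ord n) => i i'.
    by rewrite /key_lt /= !pm_valE /=; lia.
  + apply: (shift _ (period n * (j%:Z + 1))) => [x /blk2[] //|].
    rewrite (pairwise_map (pair true)); apply: pairwise_filter; rewrite pairwise_rev.
    apply: sub_pairwise (pairwise_enum_ord n) => i i'.
    by rewrite /key_lt /= !pm_valE /=; lia.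
- move=> i j ij; apply/allrelP => x y.
  rewrite !mem_cat => xi yj; rewrite /key_lt.
  have x1 : ckey m x <= period n * i%:Z + period n - 1.
    by case/orP: xi => [/blk|/blk2] [-> b]; move: b; rewrite /period; lia.
  have y1 : period n * j%:Z + 1 <= ckey m y.
    by case/orP: yj => [/blk|/blk2] [-> b]; move: b; rewrite /period; lia.
  by move: x1 y1 ij; rewrite /period; nia.
Qed.

Definition sorted_rows : seq (pm n) := rev (map (@pm_opp n) reading) ++ reading.

Lemma pairwise_sorted_rows : pairwise (key_lt (ckey m)) sorted_rows.
Proof.
rewrite pairwise_cat pairwise_rev pairwise_map pairwise_reading andbT; apply/andP; split.
  apply/allrelP => x y; rewrite mem_rev => /mapP[z]; rewrite !mem_reading => z0 -> y0.
  by rewrite /key_lt ckey_opp; lia.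
by apply: sub_pairwise pairwise_reading => x y; rewrite /key_lt /= !ckey_opp ltrN2.
Qed.

Lemma mem_sorted_rows x : x \in sorted_rows.
Proof.
rewrite mem_cat mem_rev -{1}(pm_oppK x) (mem_map (@pm_opp_inj n)) !mem_reading ckey_opp.
have : ckey m x != 0; last by lia.
apply: contraTneq (pm_opp_neq x) => e; rewrite negbK; apply/eqP.
by apply: (@ckey_inj n m); rewrite ckey_opp e oppr0.
Qed.

Lemma perm_sorted_rows : perm_eq sorted_rows (enum (pm n)).
Proof.
apply: uniq_perm; rewrite ?enum_uniq ?(key_uniq pairwise_sorted_rows) // => x.
by rewrite mem_sorted_rows mem_enum.
Qed.

Lemma size_reading : size reading = n.
Proof.
have := perm_size perm_sorted_rows; rewrite -cardE card_pm size_cat size_rev size_map.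
by rewrite addnn mul2n => /double_inj.
Qed.

Lemma index_sorted_rows x : index x sorted_rows = rk m x.
Proof.
have xs := mem_sorted_rows x.
have -> : index x sorted_rows = size (take (index x sorted_rows) sorted_rows).
  by rewrite size_takel // ltnW // index_mem.
rewrite -(count_predT (take _ _)) (count_take_key pairwise_sorted_rows _ x) ?index_mem //.
rewrite nth_index // (seq.permP perm_sorted_rows) /rk cardE /enum_mem -size_filter.
by congr size; rewrite -filter_predI; apply: eq_filter => y; rewrite /= !inE andbT.
Qed.

Lemma rk_reading x0 i : (i < n)%N -> rk m (nth x0 reading i) = (n + i)%N.
Proof.
move=> ii; rewrite -index_sorted_rows.
have -> : nth x0 reading i = nth x0 sorted_rows (n + i).
  by rewrite nth_cat size_rev size_map size_reading ltnNge leq_addr /= addKn.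
rewrite index_uniq ?(key_uniq pairwise_sorted_rows) //.
by rewrite size_cat size_rev size_map size_reading; lia.
Qed.

Lemma uniq_reading : uniq reading.
Proof. exact: key_uniq pairwise_reading. Qed.

(** The rows with a positive area entry are those read with a minus sign; the extra sign change of
    the first entry makes the number of these sign changes even. *)
Lemma odd_areaE : odd_pos_area n p = odd (count (fun x : pm n => x.1) reading).
Proof.
rewrite /odd_pos_area areaE count_map; congr odd.
transitivity (size (filter (fun x : pm n => x.1) reading)); last by rewrite size_filter.
rewrite -size_filter -(size_map (pair true)); apply: perm_size; apply: uniq_perm.
- by rewrite map_inj_uniq => [|i j []//]; apply: filter_uniq; apply: enum_uniq.
- by rewrite filter_uniq ?uniq_reading.
move=> [b i]; rewrite mem_filter mem_reading; apply/mapP/andP => [[j]|[/= b1]].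
  rewrite mem_filter => /andP[mj _] [-> ->]; split=> //.
  by rewrite /ckey /ext pm_valE /= /period; have := ltn_ord j; move: mj => /=; nia.
rewrite b1 => l; exists i => //; rewrite mem_filter mem_enum andbT.
move: l; rewrite /ckey /ext pm_valE /= /period; have := ltn_ord i.
by move: (m i) => M; case: (ltrP 0 M) => //; nia.
Qed.

End Words.

(** * The zeta map on paths *)

Lemma north_then_eastE b i :
  north_then_east b i = nth false (eshape b) (north_pos b i).+1.
Proof.
rewrite /north_then_east; case: (ltnP (north_pos b i).+1 (size b)) => l.
  by rewrite (onth_lt N) // (nth_map N).
by rewrite onth_default // nth_default // size_map.
Qed.

Section Zeta.
Variables (n : nat) (p : seq letter).
Hypothesis n3 : (2 < n)%N.
Hypothesis pL : signed_lattice_path n p.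
Local Notation m := (mrow n p).
Local Notation W := (zetaD_word n p).
Local Notation pos := (@pos n m).
Local Notation rk := (@rk n m).

Let m_bound i : (i < n)%N -> - (2 * n%:Z) < m i < 2 * n%:Z.
Proof. exact: mrow_bound. Qed.

Lemma size_zetaD_word : size W = (2 * n).-1.
Proof. by rewrite zetaD_wordE // size_map size_takel // size_allitems //; lia. Qed.

Lemma eshape_word : eshape W = [seq a.1 | a : item n <- take (2 * n).-1 (allitems n m)].
Proof. by rewrite zetaD_wordE // /eshape -map_comp; apply: eq_map => -[[] x]. Qed.

Lemma word_letters k : (k < (2 * n).-1)%N ->
  nth N W k = if nth false (eshape W) k then E else N.
Proof.
move=> kn; have [a pa] : exists a, pos a = k by apply: (pos_onto m_bound); lia.
have st : size (take (2 * n).-1 (allitems n m)) = (2 * n).-1.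
  by rewrite size_takel // size_allitems //; lia.
by rewrite eshape_word zetaD_wordE // !(nth_map a) ?st.
Qed.

Lemma zetaDE : zetaD n p =
  if north_then_east W n
  then set_nth N W (north_pos W n).+1 (if odd_pos_area n p then Em else Ep) else W.
Proof.
rewrite /zetaD north_then_eastE; set k := (north_pos W n).+1.
case: (ltnP k (size W)) => l; last first.
  by rewrite onth_default // nth_default // size_map.
rewrite (onth_lt N) // (word_letters (k := k)); last by rewrite -size_zetaD_word.
by case: (nth false _ k).
Qed.

Lemma eshape_zetaD : eshape (zetaD n p) = eshape W.
Proof.
rewrite zetaDE; case: ifP => //; rewrite north_then_eastE; set k := (north_pos W n).+1.
move=> e; have l : (k < size W)%N.
  by rewrite ltnNge; apply/negP => l; move: e; rewrite nth_default // size_map.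
apply: (@eq_from_nth _ false); rewrite !size_map size_set_nth; first by lia.
move=> i il; rewrite !(nth_map N) ?size_set_nth; [|lia..].
rewrite nth_set_nth /=; case: eqP => // ->.
by move: e; rewrite (nth_map N) // => ->; case: ifP.
Qed.

Lemma size_zetaD : size (zetaD n p) = (2 * n).-1.
Proof. by have := congr1 size eshape_zetaD; rewrite !size_map size_zetaD_word. Qed.

Lemma zeta_east a d : (pos a < (2 * n).-1)%N -> nth d (eshape (zetaD n p)) (pos a) = a.1.
Proof.
move=> pa; have st : size (take (2 * n).-1 (allitems n m)) = (2 * n).-1.
  by rewrite size_takel // size_allitems //; lia.
rewrite eshape_zetaD eshape_word (nth_map a) ?st // nth_take //.
by rewrite /pos nth_index // mem_allitems.
Qed.

Lemma zeta_easts k : (k <= (2 * n).-1)%N -> num_east (take k (zetaD n p)) = easts n m k.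
Proof.
move=> kn; rewrite num_eastE /eshape map_take -/(eshape _) eshape_zetaD eshape_word.
by rewrite -map_take take_takel // count_map.
Qed.

Lemma zeta_norths k : (k <= (2 * n).-1)%N -> num_north (take k (zetaD n p)) = norths n m k.
Proof.
move=> kn; rewrite num_northE /eshape map_take -/(eshape _) eshape_zetaD eshape_word.
by rewrite -map_take take_takel // count_map.
Qed.

Lemma zeta_north_pos y : (pos (false, y) < (2 * n).-1)%N ->
  north_pos (zetaD n p) (rk y).+1 = pos (false, y).
Proof.
move=> py; apply/eqP; rewrite north_pos_eq ?size_zetaD // zeta_east //=.
by rewrite zeta_norths ?norths_pos // ltnW.
Qed.

Lemma zeta_ballot k : (k <= (2 * n).-1)%N ->
  (num_east (take k (zetaD n p)) <= num_north (take k (zetaD n p)))%N.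
Proof.
by move=> kn; rewrite zeta_easts // zeta_norths //; apply: (easts_le_norths m_bound); lia.
Qed.

Lemma middle_entry y : rk y = n.-1 ->
  (pos (false, y) < (2 * n).-1)%N /\ north_pos (zetaD n p) n = pos (false, y).
Proof.
move=> ry; have py : (pos (false, y) < (2 * n).-1)%N.
  have n4 : ((2 * n).-1 <= 4 * n)%N by lia.
  have e := easts_norths m_bound n4; have l := easts_le_norths m_bound n4.
  by rewrite ltnNge (pos_north m_bound) ry -ltnNge; lia.
split=> //; rewrite -(zeta_north_pos py) ry; congr north_pos; lia.
Qed.

Lemma north_pos_word : north_pos W =1 north_pos (zetaD n p).
Proof. by apply: north_pos_shape; rewrite eshape_zetaD. Qed.

Lemma NTE_word : north_then_east (zetaD n p) n = north_then_east W n.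
Proof. by rewrite !north_then_eastE eshape_zetaD north_pos_word. Qed.

Lemma word_unsigned k : is_signed (nth N W k) = false.
Proof.
case: (ltnP k (2 * n).-1) => l; first by rewrite word_letters //; case: ifP.
by rewrite nth_default ?size_zetaD_word.
Qed.

Lemma zeta_eps : eps (zetaD n p) =
  if north_then_east (zetaD n p) n && odd_pos_area n p then -1 else 1.
Proof.
rewrite NTE_word /eps zetaDE; have nW : (Em \in W) = false.
  by apply/negP => /(nthP N)[k _ e]; have := word_unsigned k; rewrite e.
case e: (north_then_east W n); last by rewrite nW.
set k := (north_pos W n).+1; have l : (k < size W)%N.
  rewrite ltnNge; apply/negP => l; move: e.
  by rewrite north_then_eastE nth_default // size_map.
case: (odd_pos_area n p) => /=.
  rewrite ifT //; apply/(nthP N); exists k; first by rewrite size_set_nth; lia.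
  by rewrite nth_set_nth /= eqxx.
rewrite ifF //; apply/negP => /(nthP N)[i _]; rewrite nth_set_nth /=.
by case: eqP => // _ e'; have := word_unsigned i; rewrite e'.
Qed.

Lemma zetaD_signed_ballot : signed_ballot_path n (zetaD n p).
Proof.
apply/and3P; split.
- by rewrite size_zetaD.
- apply/allP => k; rewrite mem_iota size_zetaD => kn; apply: zeta_ballot; lia.
apply/allP => i; rewrite mem_iota size_zetaD add0n -north_pos_word => /= il.
rewrite zetaDE; set k := (north_pos W n).+1; case e: (north_then_east W n).
  rewrite nth_set_nth /=; case: (eqVneq i k) => _; first by case: ifP.
  by rewrite word_unsigned.
rewrite word_unsigned; case: (eqVneq i k) => //= ei.
by move: e; rewrite north_then_eastE -/k -ei word_letters // => ->.
Qed.

Definition flip0 (i : nat) : bool := odd_pos_area n p && (i == 0%N).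

(* The k-th entry of the reading word is, with all the sign changes of [dD], the
   label of the signed row [place (false, k)]. *)
Definition place (x : pm n) : pm n :=
  let y := nth x (reading n p) x.2 in
  tw p (if x.1 (+) flip0 x.2 then pm_opp y else y).

Lemma place_opp x : place (pm_opp x) = pm_opp (place x).
Proof.
case: x => b i; rewrite /place /= (set_nth_default (b, i)); last first.
  by rewrite size_reading.
by case: b; case: (flip0 i); rewrite /= -tw_opp ?pm_oppK.
Qed.

(** All entries of the reading word have positive keys, so no two of them are opposite. *)
Lemma place_inj : injective place.
Proof.
have key (x y : pm n) b c : x \in reading n p -> y \in reading n p ->
    (if b then pm_opp x else x) = (if c then pm_opp y else y) -> x = y /\ b = c.
  rewrite !mem_reading // => x0 y0; case: b; case: c => e; split=> //.
  - exact: pm_opp_inj e.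
  - by exfalso; move: y0; rewrite -e ckey_opp; lia.
  - by exfalso; move: y0; rewrite -e ckey_opp; lia.
  - by exfalso; move: x0; rewrite e ckey_opp; lia.
  - by exfalso; move: x0; rewrite e ckey_opp; lia.
move=> [b i] [c j] /(can_inj (@twK n p)) /=.
rewrite (set_nth_default (b, i) (c, j)) ?size_reading //.
have rI (k : 'I_n) : nth (b, i) (reading n p) k \in reading n p.
  by rewrite mem_nth ?size_reading.
case/(key _ _ _ _ (rI i) (rI j)) => /eqP.
rewrite nth_uniq ?size_reading ?uniq_reading // => /eqP/val_inj ->.
by move/addIb ->.
Qed.

(** It depends on the path only: for a fixed path the map on labels is the translation [v] to
    [place_perm * v], hence invertible. *)
Definition place_perm : {perm pm n} := perm place_inj.

Lemma place_perm_SB : place_perm \in SB n.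
Proof. by rewrite inE; apply/forallP => x; rewrite !permE place_opp. Qed.

Lemma place_label (v : {perm pm n}) (i : 'I_n) : v \in SB n ->
  pm_val ((place_perm * v)%g (false, i)) =
  let l := lab p v (nth (false, i) (reading n p) i) in if flip0 i then - l else l.
Proof.
move=> vB; rewrite permM permE /place /=; case: (flip0 i) => //=.
by rewrite tw_opp SB_opp // pm_val_opp.
Qed.

End Zeta.

(** * Diagonal labels *)

Lemma mem_valleys b i j : ((i, j) \in valleys b) = is_valley b (i, j).
Proof.
rewrite /valleys mem_filter; case v: (is_valley b (i, j)); rewrite ?andFb ?andTb //.
apply/allpairsPdep; exists i, j; rewrite !mem_iota; split=> //=.
  case/orP: v => [/and3P[]|/and3P[l /eqP -> _]]; first by lia.
  rewrite /num_east -has_count; apply/andP; split; last by rewrite add1n ltnS.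
  case/lastP: b l => // b x; rewrite last_rcons => xe; apply/hasP.
  by exists x; rewrite ?mem_rcons ?mem_head.
by case/orP: v => [/and3P[]|/and3P[_ _ /eqP ->]]; lia.
Qed.

Section DiagonalLabels.
Variables (n : nat) (p : seq letter) (v w : {perm pm n}).
Hypothesis n3 : (2 < n)%N.
Hypothesis pL : signed_lattice_path n p.
Hypothesis vB : v \in SB n.
Hypothesis wB : w \in SB n.
Hypothesis wE : forall i : 'I_n, pm_val (w (false, i)) =
  let l := lab p v (nth (false, i) (reading n p) i) in if flip0 n p i then - l else l.

Local Notation m := (mrow n p).
Local Notation pos := (@pos n m).
Local Notation rk := (@rk n m).
Local Notation b := (zetaD n p).
Local Notation lab := (lab p v).
Local Notation odd_area := (odd_pos_area n p).

Let m_bound i : (i < n)%N -> - (2 * n%:Z) < m i < 2 * n%:Z.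
Proof. exact: mrow_bound. Qed.

Lemma sapp_neg (i : nat) : (0 < i <= n)%N -> sapp w (- i%:Z) = - sapp w i%:Z.
Proof.
move=> ii; have i1 : (i.-1 < n)%N by lia.
have -> : i%:Z = pm_val (false, Ordinal i1) by rewrite pm_valE /= prednK //; lia.
by rewrite -pm_val_opp !sapp_pm SB_opp // pm_val_opp.
Qed.

Lemma sapp_reading i x0 : (i < n)%N -> sapp w (i.+1)%:Z =
  let l := lab (nth x0 (reading n p) i) in if flip0 n p i then - l else l.
Proof.
move=> ii; have -> : (i.+1)%:Z = pm_val (false, Ordinal ii) by rewrite pm_valE.
by rewrite sapp_pm wE /= (set_nth_default x0) // size_reading.
Qed.

Lemma nth_reading x0 x i : (i < n)%N -> rk x = (n + i)%N -> nth x0 (reading n p) i = x.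
Proof. by move=> ii rx; apply: (@rk_inj n m); rewrite rk_reading. Qed.

(** The opposite of an entry of rank r has rank [n + (n-1-r)], so the window shows its label in
    place [n - r]. The inequality at a valley thus reads [- lab x > - lab y]. Rank [n-1] is left out
    because of the sign change of the first entry. *)
Lemma sapp_low x : (rk x < n.-1)%N -> sapp w (n%:Z - (rk x)%:Z) = - lab x.
Proof.
move=> rx; have -> : n%:Z - (rk x)%:Z = ((n - rk x).-1.+1)%:Z by lia.
have ro := rk_opp m x.
rewrite (sapp_reading x) ?(@nth_reading x (pm_opp x)); [|lia..].
by rewrite /flip0 (_ : ((n - rk x).-1 == 0)%N = false) ?andbF /= ?lab_opp //; lia.
Qed.

Lemma sapp_one y : rk y = n.-1 ->
  sapp w 1 = if odd_area then lab y else - lab y.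
Proof.
move=> ry; have ro := rk_opp m y; rewrite (@sapp_reading 0%N y); last by lia.
rewrite (@nth_reading y (pm_opp y)); [|lia..].
by rewrite /flip0 eqxx andbT lab_opp //=; case: ifP; rewrite ?opprK.
Qed.

Lemma lhs_low x : (rk x < n.-1)%N -> sapp w (n%:Z + 1 - ((rk x).+1)%:Z) = - lab x.
Proof. by move=> rx; rewrite -sapp_low //; congr sapp; lia. Qed.

Lemma rhs_outer y : rk y != n.-1 -> rk y != n ->
  valley_rhs b w (rk y).+1 = - lab y.
Proof.
move=> r1 r2; rewrite /valley_rhs; case: (leqP (rk y).+1 n.-1) => l.
  by rewrite -sapp_low //; congr sapp; lia.
have -> : ((rk y).+1 == n) = false by lia.
have -> : ((rk y).+1 == n.+1) = false by lia.
have ro := rk_opp m y.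
have -> : n%:Z - ((rk y).+1)%:Z = - ((rk y).+1 - n)%N%:Z by lia.
rewrite sapp_neg; last by lia.
have -> : ((rk y).+1 - n)%N%:Z = n%:Z - (rk (pm_opp y))%:Z by lia.
by rewrite sapp_low ?lab_opp ?opprK //; lia.
Qed.

(** The sign carried by the East step after the n-th North step undoes the sign change of the first
    window entry. *)
Lemma rhs_north y : rk y = n.-1 -> north_then_east b n ->
  valley_rhs b w n = - lab y.
Proof.
move=> ry e; rewrite /valley_rhs (_ : (n <= n.-1)%N = false) ?eqxx; last by lia.
by rewrite zeta_eps // e (sapp_one ry) /=; case: odd_pos_area; rewrite ?mulN1r ?mul1r.
Qed.

Lemma rhs_north_next y : rk y = n -> north_then_east b n ->
  valley_rhs b w n.+1 = - lab y.
Proof.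
move=> ry e; have ro := rk_opp m y; rewrite /valley_rhs.
have -> : (n.+1 <= n.-1)%N = false by lia.
have -> : (n.+1 == n)%N = false by lia.
rewrite eqxx zeta_eps // e (@sapp_one (pm_opp y)) /=; last by lia.
by case: odd_pos_area; rewrite lab_opp // ?mulN1r ?mul1r ?opprK ?mulN1r ?mul1r.
Qed.

(** Without a signed East step the word does not record whether the first entry changed its sign;
    only absolute values can be compared. *)
Lemma rhs_north_alone y : rk y = n.-1 -> north_then_east b n = false ->
  `|valley_rhs b w n| = `|lab y| /\ `|sapp w 1| = `|lab y|.
Proof.
move=> ry e; rewrite /valley_rhs (_ : (n <= n.-1)%N = false) ?eqxx; last by lia.
rewrite zeta_eps // e mul1r (sapp_one ry); case: odd_pos_area; rewrite ?normrN //.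
Qed.

Lemma valley_at_is_valley k x y : valley_at m k x y ->
  is_valley b ((rk x).+1, (rk y).+1).
Proof.
move=> va; have [kn pk nk ny] := va.
have [ek rr ek' nk' kl] := valley_at_facts n3 m_bound va.
have := @pos_valley b k; rewrite size_zetaD // zeta_easts ?zeta_norths //; try lia.
rewrite ek nk -pk zeta_east //; last by rewrite pk.
apply=> //; first by rewrite pk.
rewrite pk => k1; rewrite -ny; last by lia.
by rewrite zeta_east // ny //; lia.
Qed.

Lemma is_valley_at i j : is_valley b (i, j) ->
  exists k x y, [/\ valley_at m k x y, i = (rk x).+1 & j = (rk y).+1].
Proof.
case/valley_pos => k []; rewrite size_zetaD // => kn ke -> -> kk.
rewrite zeta_easts ?zeta_norths //; try lia.
have [a pa] : exists a, pos a = k by apply: (pos_onto m_bound); lia.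
move: ke; rewrite -pa zeta_east ?pa //; case: a pa => [[] x] //= pa _.
have ex : easts n m k = rk x by rewrite -pa easts_pos.
have kk4 := easts_norths m_bound (_ : (k <= 4 * n)%N).
have [y ry] : exists y, rk y = norths n m k.
  by apply: rk_onto; have := kk4 _; lia.
exists k, x, y; split; rewrite ?ex ?ry //; split=> // k1.
have [c pc] : exists c, pos c = k.+1 by apply: (pos_onto m_bound); lia.
have k2 : (k.+1 < (2 * n).-1)%N by lia.
move: (kk k2); rewrite -pc zeta_east ?pc //; case: c pc => [[] y'] //= pc _.
have : rk y' = rk y.
  by rewrite -(norths_pos m_bound) pc -{1}pa norths_step // pa addn0 ry.
by move/(@rk_inj n m) <-.
Qed.

Lemma valley_at_low k x y : valley_at m k x y -> (rk x < n.-1)%N.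
Proof.
move=> va; have [kn pk nk ny] := va.
have [ek rr ek' nk' kl] := valley_at_facts n3 m_bound va.
have k4 : (k.+1 <= 4 * n)%N by lia.
by have := easts_le_norths m_bound k4; rewrite ek' nk'; lia.
Qed.

(** The two middle North steps are then separated by the East step of the valley at least, so the
    first of them is followed by an East step. *)
Lemma valley_at_next_middle k x y : valley_at m k x y -> rk y = n -> north_then_east b n.
Proof.
move=> va ry; have [kn pk nk ny] := va; have ro := rk_opp m y.
have [|p0 e0] := @middle_entry n p n3 pL (pm_opp y); first by lia.
have q : (pos (false, pm_opp y) < k)%N.
  by rewrite ltnNge (pos_north m_bound) nk; lia.
rewrite north_then_eastE e0.
have [c pc] : exists c, pos c = (pos (false, pm_opp y)).+1.
  by apply: (pos_onto m_bound); lia.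
rewrite -pc zeta_east ?pc; [|by []..|by lia].
case: c pc => [[] y'] //= pc.
have ry' : rk y' = rk y.
  by rewrite -(norths_pos m_bound) pc norths_step // norths_pos //=; lia.
have yy := rk_inj ry'; subst y'.
have : (k <= pos (false, y))%N by rewrite (pos_north m_bound) nk.
move=> l; have e : pos (false, y) = pos (true, x).
  by apply/eqP; rewrite pk eqn_leq l andbT pc.
by have := pos_inj m_bound e.
Qed.

Lemma valley_at_middle k x y : valley_at m k x y -> rk y = n.-1 ->
  pos (false, y) = k.+1.
Proof.
move=> va ry; have [kn pk nk ny] := va.
have [ek rr ek' nk' kl] := valley_at_facts n3 m_bound va.
by apply: ny; have := valley_at_low va; lia.
Qed.

Lemma north_alone k x y : valley_at m k x y -> rk y = n.-1 ->
  north_then_east b n = false <->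
  ((k.+2 < (2 * n).-1)%N -> pos (false, pm_opp y) = k.+2).
Proof.
move=> va ry; have py := valley_at_middle va ry; have [kn pk nk ny] := va.
have [ek rr ek' nk' kl] := valley_at_facts n3 m_bound va.
have [p0 e0] := middle_entry n3 pL ry; have ro := rk_opp m y.
rewrite north_then_eastE e0 py; case: (ltnP k.+2 (2 * n).-1) => k2; last first.
  by split=> // _; rewrite nth_default // size_map size_zetaD.
have [c pc] : exists c, pos c = k.+2 by apply: (pos_onto m_bound); lia.
split=> [|/(_ isT) e]; last by rewrite -e zeta_east // e.
rewrite -pc zeta_east ?pc //; case: c pc => [[] y'] //= pc _ _.
have ry' : rk y' = rk (pm_opp y).
  by rewrite -(norths_pos m_bound) pc -{1}py norths_step // py nk' /=; lia.
by rewrite -(rk_inj ry').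
Qed.

Definition diag_cond : bool :=
  all (fun ij : nat * nat =>
         sapp w (n%:Z + 1 - ij.1%:Z) > valley_rhs b w ij.2) (valleys b)
  && all (fun ij : nat * nat =>
         (ij.2 == n) && ~~ north_then_east b n
         ==> (sapp w (n%:Z + 1 - ij.1%:Z) > `|sapp w 1|)) (valleys b).

Lemma diag_floors : diag_cond -> forall x y, floor m x y -> lab x < lab y.
Proof.
case/andP=> /allP D3 /allP D4 x y f.
(* The pairs [(x, y)] and [(pm_opp y, pm_opp x)] give the same root and rank sums symmetric about
   [2n-1]; the sum [2n-1] itself would mean [y = pm_opp x]. *)
wlog rxy : x y f / (rk x + rk y < (2 * n).-1)%N.
  move=> H; have := rk_opp m x; have := rk_opp m y => ry rx.
  case: (ltngtP (rk x + rk y) (2 * n).-1) => r.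
  - exact: H.
  - rewrite -ltrN2 -!lab_opp //; apply: H; rewrite ?floor_opp //; lia.
  have xy : rk y = rk (pm_opp x) by lia.
  by case/andP: f; rewrite (rk_inj xy) eqxx.
have fv := floor_valley n3 m_bound f rxy; case: fv => [va|[ry va py1 py2]].
  have iv := valley_at_is_valley va; have lx := valley_at_low va.
  have := D3 _ (_ : ((rk x).+1, (rk y).+1) \in valleys b).
  rewrite mem_valleys iv => /(_ isT) /=; rewrite lhs_low //.
  have [ry|ry] := eqVneq (rk y) n.-1.
    have ny : (rk y).+1 = n by lia.
    rewrite ny; case e: (north_then_east b n).
      by rewrite (rhs_north ry e) ltrN2.
    have := D4 _ (_ : ((rk x).+1, (rk y).+1) \in valleys b).
    rewrite mem_valleys iv => /(_ isT) /=; rewrite lhs_low // ny eqxx e /=.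
    by have [_ ->] := rhs_north_alone ry e; lia.
  have [ry'|ry'] := eqVneq (rk y) n.
    have e := valley_at_next_middle va ry'.
    by rewrite ry' (rhs_north_next ry' e) ltrN2.
  by rewrite rhs_outer // ltrN2.
(* The valley belongs to [pm_opp y], of rank [n-1], and the bound by an absolute value covers [y]
   too. *)
have ro := rk_opp m y; have ryo : rk (pm_opp y) = n.-1 by lia.
have iv := valley_at_is_valley va; have lx := valley_at_low va.
have e : north_then_east b n = false.
  by apply/(north_alone va ryo); rewrite pm_oppK.
have := D4 _ (_ : ((rk x).+1, (rk (pm_opp y)).+1) \in valleys b).
rewrite mem_valleys iv => /(_ isT) /=; rewrite lhs_low // (_ : (rk _).+1 = n); last by lia.
rewrite eqxx e /=; have [_ ->] := rhs_north_alone ryo e.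
by rewrite lab_opp //; lia.
Qed.

Lemma floors_diag : (forall x y, floor m x y -> lab x < lab y) -> diag_cond.
Proof.
move=> F; have mst := @mrow_step n p n3 pL; have mf := mrow_first n3 pL.
have ml := mrow_final n3 pL.
have both k x y : valley_at m k x y -> rk y = n.-1 -> north_then_east b n = false ->
    `|lab y| < - lab x.
  move=> va ry e; have /(north_alone va ry) py2 := e.
  have f1 := F _ _ (valley_floor n3 m_bound mst mf ml va).
  have := F _ _ (middle_floor n3 m_bound mst mf ml va ry (valley_at_middle va ry) py2).
  by rewrite lab_opp //; lia.
apply/andP; split; apply/allP => -[i j]; rewrite mem_valleys;
  case/is_valley_at => k [x [y [va -> ->]]] /=; rewrite lhs_low; try exact: valley_at_low va.
  have f := F _ _ (valley_floor n3 m_bound mst mf ml va).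
  have [ry|ry] := eqVneq (rk y) n.-1.
    have ny : (rk y).+1 = n by lia.
    rewrite ny; case e: (north_then_east b n).
      by rewrite (rhs_north ry e) ltrN2.
    have := both _ _ _ va ry e; have [e1 _] := rhs_north_alone ry e; lia.
  have [ry'|ry'] := eqVneq (rk y) n.
    have e := valley_at_next_middle va ry'.
    by rewrite ry' (rhs_north_next ry' e) ltrN2.
  by rewrite rhs_outer // ltrN2.
apply/implyP => /andP[/eqP ny /negbTE e]; have ry : rk y = n.-1 by lia.
by have [_ ->] := rhs_north_alone ry e; apply: both va ry e.
Qed.

End DiagonalLabels.

(** * Injectivity on paths *)

Lemma path_eps_east n p : signed_lattice_path n p -> (2 < n)%N ->
  eps p = if nth N p 0 == Em then -1 else 1.
Proof.
move=> pL n3; rewrite /eps; case: eqP => e.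
  by rewrite ifT //; apply/(nthP N); exists 0%N => //; rewrite (path_size n3 pL); lia.
rewrite ifF //; apply/negP => /(nthP N)[k kp ek]; have := path_signed pL kp.
by rewrite ek; case: eqP => // k0; move: ek; rewrite k0.
Qed.

Lemma path_ext n p q : (2 < n)%N -> signed_lattice_path n p -> signed_lattice_path n q ->
  (forall i, (0 < i <= n)%N -> easts_before p i = easts_before q i) ->
  eps p = eps q -> p = q.
Proof.
move=> n3 pL qL ea ee; have pn := path_norths pL; have qn := path_norths qL.
have np i : (0 < i <= n)%N -> north_pos p i = north_pos q i.
  by move=> ii; rewrite -!easts_beforeE ?pn ?qn // ea.
have sub r r' k : signed_lattice_path n r -> signed_lattice_path n r' ->
    (forall i, (0 < i <= n)%N -> north_pos r i = north_pos r' i) ->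
    (k < (2 * n).-1)%N -> nth true (eshape r) k = false -> nth true (eshape r') k = false.
  move=> rL rL' e kn ek; have kr : (k < size r)%N by rewrite (path_size n3 rL).
  have [h1 h2] := north_pos_uniq kr ek.
  rewrite (path_norths rL) in h2; rewrite -h1 e; last by lia.
  by have [|_ -> _] := @north_pos_spec r' (num_north (take k r)).+1; rewrite ?(path_norths rL').
have se : eshape p = eshape q.
  apply: (@eq_from_nth _ true); rewrite !size_map (path_size n3 pL) ?(path_size n3 qL) // => k kn.
  have h1 := @sub p q k pL qL np kn.
  have h2 := @sub q p k qL pL (fun i ii => esym (np i ii)) kn.
  by case: (nth true (eshape p) k) h1 h2 => h1 h2; [case: (nth _ _ _) h2 => // -> | rewrite h1].
apply: (@eq_from_nth _ N); rewrite (path_size n3 pL) ?(path_size n3 qL) // => k kn.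
have sk : is_east (nth N p k) = is_east (nth N q k).
  have := congr1 (fun s => nth true s k) se; rewrite /eshape !(nth_map N) //.
    by rewrite (path_size n3 qL).
  by rewrite (path_size n3 pL).
have gp : (k < size p)%N by rewrite (path_size n3 pL).
have gq : (k < size q)%N by rewrite (path_size n3 qL).
have := path_signed pL gp; have := path_signed qL gq; rewrite -sk.
have [k0|k0] := eqVneq k 0%N; last first.
  by move: sk; case: (nth N p k); case: (nth N q k).
move: ee; rewrite (path_eps_east pL n3) (path_eps_east qL n3) -k0.
by move: sk; case: (nth N p k); case: (nth N q k).
Qed.

Section Relation.
Variables (n : nat) (p : seq letter).
Hypothesis n3 : (2 < n)%N.
Hypothesis pL : signed_lattice_path n p.
Local Notation m := (mrow n p).
Local Notation pos := (@pos n m).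
Local Notation rk := (@rk n m).
Local Notation b := (zetaD n p).
Implicit Types x y : pm n.

Let m_bound i : (i < n)%N -> - (2 * n%:Z) < m i < 2 * n%:Z.
Proof. exact: mrow_bound. Qed.

(** Among the first [rk x + rk y + 1] letters, either more than [rk x] are East steps or more than
    [rk y] are North steps, never both. So exactly one of the East step of [x] and the North step of
    [y] is among them, and it comes first. *)
Lemma key_word x y : (rk x + rk y < (2 * n).-1)%N ->
  (ckey m x + period n < ckey m y) =
  (rk x < num_east (take (rk x + rk y).+1 b))%N.
Proof.
move=> r; rewrite zeta_easts // -pos_north_east //; set K := (rk x + rk y).+1.
have K4 : (K <= 4 * n)%N by rewrite /K; lia.
have e := easts_norths m_bound K4.
have h1 := pos_east m_bound x K; have h2 := pos_north m_bound y K.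
by apply/idP/idP; rewrite /K in e h1 h2 *; lia.
Qed.

(** No East step lies between the North steps of [y] and [pm_opp y], as far as the word reaches;
    exchanging the middle ranks does not change the relation. *)
Lemma key_middle x y : north_then_east b n = false -> rk y = n.-1 -> (rk x < n.-1)%N ->
  (ckey m x + period n < ckey m y) = (ckey m x + period n < ckey m (pm_opp y)).
Proof.
move=> e ry rx; have ro := rk_opp m y; rewrite -!pos_north_east //.
have [py e0] := middle_entry n3 pL ry.
have yy : (pos (false, y) < pos (false, pm_opp y))%N.
  by rewrite pos_lt // /ikey ltrD2r -rk_lt /=; lia.
apply/idP/idP => l; first exact: ltn_trans l yy.
case: (ltngtP (pos (true, x)) (pos (false, y))) => // [l2|/(pos_inj m_bound)//].
have [c pc] : exists c, pos c = (pos (false, y)).+1.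
  by apply: (pos_onto m_bound); lia.
have xl : (pos (true, x) < (2 * n).-1)%N.
  have x4 : (pos (true, x) <= 4 * n)%N by apply: ltnW; apply: pos_max.
  have := easts_norths m_bound x4; rewrite (easts_pos m_bound).
  have : (norths n m (pos (true, x)) <= rk (pm_opp y))%N.
    by rewrite -(pos_north m_bound); exact: ltnW.
  lia.
move: e; rewrite north_then_eastE e0 -pc zeta_east ?pc //; last by lia.
case: c pc => [[] u] //= pc _.
have ru : rk u = rk (pm_opp y).
  by rewrite -(norths_pos m_bound) pc norths_step // norths_pos //=; lia.
by move: l; rewrite -(rk_inj ru) pc ltnS leqNgt l2.
Qed.

End Relation.

Section Injective.
Variables (n : nat) (p q : seq letter).
Hypothesis n3 : (2 < n)%N.
Hypothesis pL : signed_lattice_path n p.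
Hypothesis qL : signed_lattice_path n q.
Hypothesis pq : zetaD n p = zetaD n q.
Local Notation m := (mrow n p).
Local Notation m' := (mrow n q).
Local Notation h := (cox n).
Implicit Types x y : pm n.

Definition swap : bool := odd_pos_area n p != odd_pos_area n q.
(** Entries of the two paths are matched by rank. If the parities of the positive area entries
    differ, the middle ranks are exchanged as well; equal words then carry no sign after the n-th
    North step, and by [key_middle] the levels are still preserved. This choice lets [first_sign]
    exclude opposite first entries. *)
Definition sig (k : nat) : nat :=
  if swap && ((k == n.-1) || (k == n)) then ((2 * n).-1 - k)%N else k.
Definition transfer x : pm n := nth x (sorted_rows n q) (sig (rk m x)).

Lemma sig_bound k : (k < 2 * n)%N -> (sig k < 2 * n)%N.
Proof. by rewrite /sig; case: ifP; lia. Qed.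

Lemma rk_transfer x : rk m' (transfer x) = sig (rk m x).
Proof.
rewrite -(index_sorted_rows n3 qL) index_uniq //.
  rewrite size_cat size_rev size_map size_reading //.
  by have := sig_bound (rk_max m x); lia.
exact: key_uniq (pairwise_sorted_rows n3 qL).
Qed.

Lemma transfer_opp x : transfer (pm_opp x) = pm_opp (transfer x).
Proof.
apply: (@rk_inj n m'); rewrite rk_transfer.
have := rk_opp m' (transfer x); rewrite rk_transfer; have := rk_opp m x.
by rewrite /sig; case: swap => /=; [case: ifP; case: ifP; lia | lia].
Qed.

Lemma transfer_inj : injective transfer.
Proof.
move=> x y /(congr1 (rk m')); rewrite !rk_transfer => e; apply: (@rk_inj n m).
by have := rk_max m x; have := rk_max m y; move: e; rewrite /sig; case: swap => /=;
  [case: ifP; case: ifP; lia | lia].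
Qed.

Lemma swap_no_east : swap -> north_then_east (zetaD n p) n = false.
Proof.
move=> sw; have := congr1 eps pq; rewrite !zeta_eps // -pq.
case: (north_then_east _ _) => //=; move: sw; rewrite /swap.
by case: (odd_pos_area n p); case: (odd_pos_area n q).
Qed.

Lemma transfer_row x y : x.2 != y.2 -> (transfer x).2 != (transfer y).2.
Proof. exact: row_neq transfer_inj transfer_opp _ _. Qed.

Lemma transfer_lev0 x y : x.2 != y.2 ->
  (0 < zz m y - zz m x) = (0 < zz m' (transfer y) - zz m' (transfer x)).
Proof.
move=> xy; have xy' := transfer_row xy.
rewrite !subr_gt0 -!key_zz0 // -!rk_lt !rk_transfer.
have ne : rk m x != rk m y by apply: contraNneq xy => /(@rk_inj n m) ->.
have ne' : rk m x != rk m (pm_opp y).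
  by apply: contraNneq xy => /(@rk_inj n m) ->.
have := rk_opp m y; rewrite /sig; case: swap => //=.
by move=> ro; case: ifP; case: ifP; lia.
Qed.

Lemma transfer_lev1 x y : x.2 != y.2 ->
  (h < zz m y - zz m x) = (h < zz m' (transfer y) - zz m' (transfer x)).
Proof.
move=> xy; wlog r : x y xy / (rk m x + rk m y < (2 * n).-1)%N.
  move=> H; have rx := rk_opp m x; have ry := rk_opp m y.
  case: (ltngtP (rk m x + rk m y) (2 * n).-1) => r.
  - exact: H.
  - have := H (pm_opp y) (pm_opp x); rewrite eq_sym !transfer_opp !zz_opp.
    rewrite !opprK ![- zz _ _ + _]addrC; apply=> //; lia.
  have e : rk m y = rk m (pm_opp x) by lia.
  by move: xy; rewrite (rk_inj e) eqxx.
have xy' := transfer_row xy; rewrite -!key_zz1 //.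
have low (s : nat -> int) (u u' : pm n) : (rk s u' < rk s u)%N ->
    (ckey s u + period n < ckey s u') = false.
  by rewrite rk_lt => l; apply/negbTE; rewrite -leNgt /period; lia.
have ne : rk m x != rk m y by apply: contraNneq xy => /(@rk_inj n m) ->.
have ro := rk_opp m y; have ro' := rk_opp m' (transfer y).
have rx := rk_transfer x; have ry := rk_transfer y.
case sw: swap; last first.
  have sE k : sig k = k by rewrite /sig sw.
  rewrite !sE in rx ry; rewrite !key_word ?rx ?ry // pq //.
have sE k : k != n.-1 -> k != n -> sig k = k.
  by rewrite /sig sw => /negbTE -> /negbTE ->.
case: (ltnP (rk m x) n.-1) => xl; last first.
  rewrite !low //; last by lia.
  rewrite rx ry (sE (rk m y)); [|lia..].
  by rewrite /sig sw; case: ifP; lia.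
have e := swap_no_east sw.
rewrite (sE (rk m x)) in rx; [|lia..].
case: (boolP ((rk m y == n.-1) || (rk m y == n))) => [o|]; last first.
  rewrite negb_or => /andP[o1 o2]; rewrite (sE _ o1 o2) in ry.
  by rewrite !key_word ?rx ?ry // pq.
have ry2 : rk m' (transfer y) = ((2 * n).-1 - rk m y)%N by rewrite ry /sig sw o.
have e' : north_then_east (zetaD n q) n = false by rewrite -pq.
(* By [key_middle], [transfer y] may be replaced by its opposite, whose rank is that of [y]
   again. *)
have -> : (ckey m' (transfer x) + period n < ckey m' (transfer y)) =
    (ckey m' (transfer x) + period n < ckey m' (pm_opp (transfer y))).
  case: (eqVneq (rk m y) n) => o2.
    by rewrite (key_middle n3 qL) //; rewrite ?ry2 ?rx; lia.
  rewrite -{1}(pm_oppK (transfer y)) -(key_middle n3 qL) //; [lia|].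
  by rewrite rx.
rewrite !key_word ?rx //; try lia.
by have -> : rk m' (pm_opp (transfer y)) = rk m y by [lia]; rewrite pq.
Qed.

Lemma transfer_zz x : zz m' (transfer x) = zz m x.
Proof.
by apply: zz_determined; [exact: n3 | exact: mrow_step | exact: mrow_first
  | exact: mrow_final | exact: mrow_step | exact: mrow_first | exact: mrow_final
  | exact: transfer_inj | exact: transfer_opp | exact: transfer_lev0
  | exact: transfer_lev1].
Qed.

(** z is congruent to [rho] modulo h, and differences of [rho] between distinct rows are not
    multiples of h. *)
Lemma transfer_same_row x : (transfer x).2 = x.2.
Proof.
apply/eqP/negPn/negP; rewrite eq_sym => ne.
have := @aht_neq0 n n3 x (transfer x) (ext m x - ext m' (transfer x)) ne.
have := transfer_zz x; rewrite /zz /aht => e; apply/negP; rewrite negbK.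
by rewrite mulrBr; apply/eqP; lia.
Qed.

(** A change of sign in row [i] needs [2 * i] divisible by h = 2(n-1), which leaves the first and
    the last row. *)
Lemma transfer_cases (i : 'I_n) :
  (transfer (false, i) = (false, i) /\ m' i = m i) \/
  [/\ transfer (false, i) = (true, i)
    & ((i : nat) = 0%N /\ m' i = - m i) \/ ((i : nat) = n.-1 /\ m' i = 1 - m i)].
Proof.
have := transfer_zz (false, i); have ii := ltn_ord i.
case: (pm_same_row (esym (transfer_same_row (false, i)))) => ->.
  rewrite /zz /rho /ext /= => e; left; split=> //.
  have h0 : h != 0 by rewrite /cox; lia.
  by apply: (mulfI h0); lia.
rewrite /zz /rho /ext /= => e; right; split=> //.
have e2 : 2 * (i : nat)%:Z = h * (m' i + m i) by rewrite mulrDr; lia.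
have h0 : 0 < h by rewrite /cox; lia.
have hi : 2 * (i : nat)%:Z <= h by rewrite /cox; lia.
have [s0|s0] := eqVneq (m' i + m i) 0; first by left; move: e2; rewrite s0; lia.
right; have s1 : m' i + m i = 1.
  by move: e2 h0 hi s0; move: h (m' i + m i) => H S; nia.
by move: e2; rewrite s1 /cox; lia.
Qed.

Lemma mid_eq i : (0 < i < n.-1)%N -> m' i = m i.
Proof.
move=> ii; have il : (i < n)%N by lia.
case: (transfer_cases (Ordinal il)) => [[_ //]|[_ [] [/= e _]]]; lia.
Qed.

Lemma first_eq : m' 0 = m 0 \/ m' 0 = - m 0.
Proof.
have il : (0 < n)%N by lia.
case: (transfer_cases (Ordinal il)) => [[_ e]|[_ [] [/= e e']]]; [left|right|]; [done|done|lia].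
Qed.

Lemma easts_eq_low i : (0 < i < n)%N -> easts_before p i = easts_before q i.
Proof.
move=> ii; have [i1|i1] := eqVneq i 1%N.
  have := first_eq; rewrite i1 !mrow0.
  by case: (lead_sign_cases n p) => ->; case: (lead_sign_cases n q) => -> [] e; lia.
have := @mid_eq i.-1; rewrite !(mrow_mid n3) //; [|lia..].
have -> : i.-1.+1 = i by [lia]; lia.
Qed.

Lemma flag_eq : last_flag n p = last_flag n q.
Proof.
rewrite /last_flag; congr (~~ odd _ == _); apply: eq_big_nat => i ii.
by apply: easts_eq_low; lia.
Qed.

(** Otherwise the two last entries would add up to 1; but both come from the same formula with the
    same [a n.-1], and their sum is even. *)
Lemma last_eq : m' n.-1 = m n.-1.
Proof.
have il : (n.-1 < n)%N by lia.
case: (transfer_cases (Ordinal il)) => [[_ //]|[_ [] [/= e e']]]; first by lia.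
have ea : easts_before p n.-1 = easts_before q n.-1 by apply: easts_eq_low; lia.
move: e'; rewrite !(mrow_last n3) // flag_eq ea; case: (last_flag n q); lia.
Qed.

Lemma easts_eq i : (0 < i <= n)%N -> easts_before p i = easts_before q i.
Proof.
move=> ii; have [->|i1] := eqVneq i n; last by apply: easts_eq_low; lia.
have ea : easts_before p n.-1 = easts_before q n.-1 by apply: easts_eq_low; lia.
move: last_eq; rewrite !(mrow_last n3) // flag_eq ea; case: (last_flag n q); lia.
Qed.

(** If the first entries were opposite and not 0, the numbers of positive entries would have
    different parities, and [transfer] would exchange the middle ranks, taking some negative key to
    a positive one. But [transfer] keeps the sign of every key: in row 0 this sign is that of [ext],
    and the other rows are fixed. *)
Lemma first_sign : m' 0 = m 0.
Proof.
have il : (0 < n)%N by lia.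
have [//|fe] := first_eq; have [->//|m0] := eqVneq (m' 0) (m 0).
have {}m0 : m 0 != 0 by lia.
have area_tail (r : seq letter) : area n r = mrow n r 0 :: [seq mrow n r i | i <- iota 1 n.-1].
  have -> : area n r = [seq mrow n r i | i <- iota 0 n].
    by rewrite /area -[1%N]/(1 + 0)%N iotaDl -map_comp.
  by rewrite -[X in iota 0 X](prednK il).
have tails : [seq m' i | i <- iota 1 n.-1] = [seq m i | i <- iota 1 n.-1].
  apply/eq_in_map => i; rewrite mem_iota => ii.
  have [e|e] := eqVneq i n.-1; first by rewrite e last_eq.
  by apply: mid_eq; lia.
have sw : swap.
  rewrite /swap /odd_pos_area !area_tail tails /= fe !oddD.
  have -> : (0 < - m 0) = ~~ (0 < m 0) by lia.
  by move: (count _ _) => C; case: (0 < m 0); case: (odd C).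
have [x rx] : exists x, rk m x = n.-1 by apply: rk_onto; lia.
have rx' : rk m' (transfer x) = n by rewrite rk_transfer rx /sig sw eqxx /=; lia.
have kx : ckey m x < 0.
  have := rk_lt m x (pm_opp x); rewrite ckey_opp; have := rk_opp m x; lia.
have kx' : 0 < ckey m' (transfer x).
  have := rk_lt m' (pm_opp (transfer x)) (transfer x); rewrite ckey_opp.
  have := rk_opp m' (transfer x); lia.
have fix_row (i : 'I_n) : (i : nat) <> 0%N -> transfer (false, i) = (false, i) /\ m' i = m i.
  case: (transfer_cases i) => [//|[_ [] [e e']]] i0; first by lia.
  by exfalso; move: e'; rewrite e last_eq; have := last_eq; lia.
have il0 (i : 'I_n) : (i : nat) = 0%N -> transfer (false, i) = (true, i).
  move=> i0; case: (transfer_cases i) => [[_]|[//]].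
  by rewrite i0; lia.
have tT (i : 'I_n) : transfer (true, i) = pm_opp (transfer (false, i)).
  by rewrite -transfer_opp.
case: x kx kx' {rx rx'} => c i; have [i0|i0] := eqVneq (i : nat) 0%N.
  case: c; rewrite ?tT il0 // /ckey /ext !pm_valE /= i0 fe /period; nia.
have [f1 f2] := fix_row i (elimN eqP i0).
by case: c; rewrite ?tT f1 /ckey /ext !pm_valE /= f2; lia.
Qed.

Lemma zetaD_inj : p = q.
Proof.
apply: (path_ext n3 pL qL easts_eq); have e1 := @easts_eq 1 _.
have := first_sign; rewrite !mrow0 -e1; last by lia.
have [a0|a0] := eqVneq (easts_before p 1) 0%N.
  move=> _; rewrite (path_eps_east pL n3) (path_eps_east qL n3).
  have z (r : seq letter) : signed_lattice_path n r -> easts_before r 1 = 0%N -> nth N r 0 = N.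
    move=> rL r0; have [|h1 h2 _] := @north_pos_spec r 1; first by rewrite (path_norths rL); lia.
    have := @easts_beforeE r 1; rewrite (path_norths rL) r0 => h3.
    move: h1 h2; have <- : 0%N = north_pos r 1 by lia.
    by move=> h1; rewrite (nth_map N) // /is_east => /negbFE/eqP.
  by rewrite !z // -e1 //; lia.
by rewrite /lead_sign; case: (cond03 n); case: (path_eps p) => ->; case: (path_eps q) => ->; lia.
Qed.

End Injective.

(** * Counting paths *)

Section Counts.
Local Open Scope nat_scope.

Fixpoint words (l : nat) : seq (seq bool) :=
  if l is l'.+1 then
    [seq rcons u false | u <- words l'] ++ [seq rcons u true | u <- words l']
  else [:: [::]].

Lemma mem_words l u : (u \in words l) = (size u == l).
Proof.
elim: l u => [|l IH] u /=; first by rewrite inE; case: u.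
case/lastP: u => [|u e].
  rewrite mem_cat; apply/norP; split; apply/mapP => -[u _] /(congr1 size);
    by rewrite size_rcons.
rewrite size_rcons eqSS -IH mem_cat; apply/orP/idP.
  by case=> /mapP[u' u'l] /rcons_inj[-> _].
by move=> ul; case: e; [right|left]; apply/mapP; exists u.
Qed.

Lemma uniq_words l : uniq (words l).
Proof.
elim: l => //= l IH; rewrite cat_uniq !map_inj_uniq ?IH ?andbT //=.
- by apply/hasPn => u /mapP[u1 _ ->]; apply/mapP => -[u2 _] /rcons_inj[].
- by move=> u v /rcons_inj[].
- by move=> u v /rcons_inj[].
Qed.

Lemma count_wordsS (P : pred (seq bool)) l :
  count P (words l.+1) = count (fun u => P (rcons u false)) (words l) +
                         count (fun u => P (rcons u true)) (words l).
Proof. by rewrite /= count_cat !count_map. Qed.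

Lemma count_words_norths l k :
  count (fun u => count negb u == k) (words l) = 'C(l, k).
Proof.
elim: l k => [|l IH] k; first by rewrite /= addn0 bin0n eq_sym.
rewrite count_wordsS; case: k => [|k].
  have -> : count (fun u => count negb (rcons u false) == 0) (words l) = 0.
    by apply/eqP; rewrite -leqn0 leqNgt -has_count; apply/hasPn => u _;
      rewrite -cats1 count_cat /=; lia.
  rewrite bin0 -[RHS](bin0 l) -IH; apply: eq_count => u.
  by rewrite -cats1 count_cat /=; lia.
rewrite binS addnC -!IH; congr addn; apply: eq_count => u;
  by rewrite -cats1 count_cat /=; lia.
Qed.

Definition ballot (u : seq bool) : bool :=
  all (fun k => count id (take k u) <= count negb (take k u)) (iota 0 (size u).+1).

Lemma ballotP u :
  reflect (forall k, count id (take k u) <= count negb (take k u)) (ballot u).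
Proof.
apply: (iffP allP) => [h k|h k _]; last exact: h.
case: (leqP k (size u)) => ku; first by apply: h; rewrite mem_iota.
rewrite take_oversize; last exact: ltnW.
by have := h (size u); rewrite take_size mem_iota; apply; rewrite add0n ltnSn.
Qed.

Lemma ballot_rcons u e :
  ballot (rcons u e) = ballot u && (count id u + e <= count negb u + ~~ e).
Proof.
have ce : count id (rcons u e) = count id u + e by rewrite -cats1 count_cat /= addn0.
have cn : count negb (rcons u e) = count negb u + ~~ e.
  by rewrite -cats1 count_cat /= addn0.
apply/ballotP/andP => [h|[/ballotP hu he] k].
  split; last by have := h (size u).+1; rewrite -(size_rcons u e) take_size ce cn.
  apply/ballotP => k; case: (leqP k (size u)) => ku.
    by have := h k; rewrite -cats1 takel_cat.
  rewrite take_oversize; last exact: ltnW.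
  by have := h (size u); rewrite -cats1 take_size_cat.
case: (leqP k (size u)) => ku; first by rewrite -cats1 takel_cat.
by rewrite take_oversize ?size_rcons // ce cn.
Qed.

Lemma count_letters (u : seq bool) : count id u + count negb u = size u.
Proof. exact: count_predC id u. Qed.

(** Pascal's rule, by the last letter. A final East step respects the ballot condition
    automatically, because at least half of the letters are North steps. *)
Lemma count_ballot l k : l <= 2 * k ->
  count (fun u => ballot u && (k <= count negb u)) (words l) = 'C(l, k).
Proof.
elim: l k => [|l IH] k lk; first by rewrite /= bin0n addn0; case: k lk.
rewrite count_wordsS; case: k lk => [|k] lk; first by lia.
rewrite binS addnC; congr addn.
  rewrite -IH; last by lia.
  apply: eq_in_count => u; rewrite mem_words => /eqP su.
  rewrite ballot_rcons -cats1 count_cat /= !addn0 addn1 -andbA; congr andb.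
  move: (count_letters u); rewrite su; move: (count id u) (count negb u) => A B AB.
  by apply/andb_idl; lia.
have shift P : {in words l, forall u, ballot u -> (k <= count negb u) = P u} ->
    count (fun u => ballot (rcons u false) && (k.+1 <= count negb (rcons u false))) (words l)
    = count (fun u => ballot u && P u) (words l).
  move=> h; apply: eq_in_count => u ul.
  rewrite ballot_rcons -cats1 count_cat /=; case b: (ballot u) => //=.
  rewrite -(h u ul b); move/ballotP: b => /(_ (size u)); rewrite take_size.
  by move: (count id u) (count negb u) => A B AB; lia.
case: (leqP l (2 * k)) => l2; first by rewrite -IH //; apply: shift.
(* Here [l = 2k + 1]: the induction hypothesis holds at [k + 1] only, but a ballot word of odd
   length [2k + 1] has at least [k + 1] North steps. *)
rewrite (_ : 'C(l, k) = 'C(l, k.+1)); last first.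
  have -> : k.+1 = l - k by lia.
  by rewrite bin_sub; lia.
rewrite -IH; last by lia.
apply: shift => u; rewrite mem_words => /eqP su /ballotP/(_ (size u)).
rewrite take_size; move: (count_letters u); rewrite su.
by move: (count id u) (count negb u) => A B; lia.
Qed.

Definition letter_of (e : bool) : letter := if e then E else N.

Lemma eshape_letters u : eshape (map letter_of u) = u.
Proof. by rewrite /eshape -map_comp -[RHS]map_id; apply: eq_map => -[]. Qed.

Lemma letters_eshape p : (forall k, is_signed (nth N p k) = false) ->
  map letter_of (eshape p) = p.
Proof.
move=> h; rewrite /eshape -map_comp -[RHS]map_id; apply/eq_in_map => x.
by case/(nthP N) => k _ <-; have := h k; case: (nth N p k).
Qed.

Lemma letters_unsigned u k : is_signed (nth N (map letter_of u) k) = false.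
Proof.
case: (ltnP k (size u)) => l; last by rewrite nth_default ?size_map.
by rewrite (nth_map false) //; case: nth.
Qed.

(** * Lists of lattice paths and of ballot paths *)

Section Counting.
Variable n : nat.
Hypothesis n3 : 2 < n.

Definition lattice_list : seq (seq letter) :=
  [seq N :: map letter_of u | u <- words (2 * n).-2 & count negb u == n.-1]
  ++ [seq Ep :: map letter_of u | u <- words (2 * n).-2 & count negb u == n]
  ++ [seq Em :: map letter_of u | u <- words (2 * n).-2 & count negb u == n].

Lemma letters_inj x : injective (fun u => x :: map letter_of u).
Proof.
by move=> u v [] /(congr1 eshape); rewrite !eshape_letters.
Qed.

Lemma uniq_lattice_list : uniq lattice_list.
Proof.
rewrite /lattice_list !cat_uniq !(map_inj_uniq (@letters_inj _)) !filter_uniq ?uniq_words //.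
rewrite /= !andbT; apply/andP; split; apply/hasPn => p.
  by rewrite mem_cat => /orP[] /mapP[u _ ->]; apply/mapP => -[].
by move=> /mapP[u _ ->]; apply/mapP => -[].
Qed.

Lemma size_lattice_list : size lattice_list = 'C((2 * n).-1, n) + 'C((2 * n).-2, n).
Proof.
rewrite !size_cat !size_map !size_filter !count_words_norths addnA; congr addn.
have -> : (2 * n).-1 = (2 * n).-2.+1 by lia.
by case: n n3 => // k _; rewrite binS addnC.
Qed.

Lemma lattice_list_path p : p \in lattice_list -> signed_lattice_path n p.
Proof.
have key x u : size u = (2 * n).-2 -> count negb u + (x == N) = n ->
    is_signed x = is_east x -> signed_lattice_path n (x :: map letter_of u).
  move=> su cu sx; have cl := count_letters u.
  have ne : num_east (x :: map letter_of u) = count id u + is_east x.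
    by rewrite num_eastE /= -/(eshape _) eshape_letters addnC.
  have nn : num_north (x :: map letter_of u) = count negb u + ~~ is_east x.
    by rewrite num_northE /= -/(eshape _) eshape_letters addnC.
  apply/and3P; split; rewrite ?ne ?nn.
  - by move: cu; rewrite /is_east; case: (x == N) => /=; lia.
  - by move: cu; rewrite /is_east; case: (x == N) => /=; lia.
  apply/allP => -[|i] _ /=; first by rewrite sx.
  by rewrite letters_unsigned.
rewrite !mem_cat => /or3P[] /mapP[u]; rewrite mem_filter mem_words;
  by move=> /andP[/eqP cu /eqP su] ->; apply: key => //=; lia.
Qed.

Definition plus_word (u : seq bool) : seq letter :=
  let p := map letter_of u in
  let k := (north_pos p n).+1 in
  if nth false u k then set_nth N p k Ep else p.

(** A path with [Em] is coded by erasing this step, whose place is known from the n-th North step;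
    what remains is a ballot word of length [2n - 2] with at least n North steps. *)
Definition minus_word (u : seq bool) : seq letter :=
  let p := map letter_of u in
  let k := (north_pos p n).+1 in take k p ++ Em :: drop k p.

Definition ballot_list : seq (seq letter) :=
  [seq plus_word u | u <- words (2 * n).-1 & ballot u && (n <= count negb u)]
  ++ [seq minus_word u | u <- words (2 * n).-2 & ballot u && (n <= count negb u)].

Lemma size_ballot_list : size ballot_list = 'C((2 * n).-1, n) + 'C((2 * n).-2, n).
Proof. by rewrite size_cat !size_map !size_filter !count_ballot //; lia. Qed.

Lemma mem_ballot_list b : signed_ballot_path n b -> b \in ballot_list.
Proof.
case/and3P=> /eqP sb /allP bb /allP sg.
have bal k : num_east (take k b) <= num_north (take k b).
  case: (leqP k (size b)) => kb; first by apply: bb; rewrite mem_iota.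
  rewrite take_oversize; last exact: ltnW.
  by have := bb (size b); rewrite take_size; apply; rewrite mem_iota add0n leqnn.
set k := (north_pos b n).+1 in sg.
have sgn i : i < size b -> is_signed (nth N b i) = (i == k) && is_east (nth N b i).
  by move=> ib; apply/eqP; rewrite sg // mem_iota.
have bn : n <= num_north b.
  by have := num_letters b; have := bal (size b); rewrite take_size; lia.
have [|kb kN kc] := @north_pos_spec b n; first by lia.
rewrite mem_cat; have [em|em] := boolP ((k < size b) && (nth N b k == Em)); last first.
  apply/orP; left; apply/mapP; exists (eshape b).
    rewrite mem_filter mem_words size_map sb eqxx andbT -num_northE bn andbT.
    by apply/ballotP => i; rewrite -map_take -num_eastE -num_northE.
  rewrite /plus_word (north_pos_shape (eshape_letters (eshape b))) -/k.
  have sz : size (map letter_of (eshape b)) = size b by rewrite !size_map.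
  apply: (@eq_from_nth _ N) => [|i ib].
    case: ifP => // e; rewrite size_set_nth sz; case: (ltnP k (size b)) => l; first by lia.
    by move: e; rewrite nth_default // size_map.
  have := sgn i ib; have [ik|ik] := eqVneq i k; last first.
    have -> : nth N (if nth false (eshape b) k then set_nth N (map letter_of (eshape b)) k Ep
        else map letter_of (eshape b)) i = nth N (map letter_of (eshape b)) i.
      by case: ifP => // _; rewrite nth_set_nth /= (negbTE ik).
    by rewrite (nth_map false) ?size_map // (nth_map N) //; case: (nth N b i).
  subst i; rewrite (nth_map N) //; move: em; rewrite ib /=.
  case e: (nth N b k) => //= _ _; first by rewrite (nth_map false) ?size_map // (nth_map N) // e.
  by rewrite nth_set_nth /= eqxx.
case/andP: em => kl /eqP em; apply/orP; right.
have bE : b = take k b ++ Em :: drop k.+1 b.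
  by rewrite -em -drop_nth // cat_take_drop.
set p := take k b ++ drop k.+1 b.
have stk : size (take k b) = k by rewrite size_takel // ltnW.
have unp i : is_signed (nth N p i) = false.
  rewrite /p nth_cat stk; case: (ltnP i k) => ik.
    rewrite nth_take // sgn; last by lia.
    by rewrite (_ : (i == k) = false) //; lia.
  rewrite nth_drop; case: (ltnP (k.+1 + (i - k)) (size b)) => l.
    by rewrite sgn // (_ : (_ == k) = false) //; lia.
  by rewrite nth_default.
have sp : size p = (2 * n).-2 by rewrite size_cat stk size_drop; lia.
have tp j : j <= k -> take j p = take j b.
  by move=> jk; rewrite /p takel_cat ?stk // take_takel.
apply/mapP; exists (eshape p).
  rewrite mem_filter mem_words size_map sp eqxx andbT -num_northE; apply/andP; split; last first.
    by move: bn; rewrite bE /num_north /p !count_cat /=; lia.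
  apply/ballotP => j; rewrite -map_take -num_eastE -num_northE.
  case: (leqP j k) => jk; first by rewrite tp.
  have := bal j.+1; rewrite {1 2}bE /p !take_cat stk.
  have -> : (j.+1 < k) = false by lia.
  have -> : (j < k) = false by lia.
  have -> : j.+1 - k = (j - k).+1 by lia.
  by rewrite /= /num_east /num_north !count_cat /=; lia.
rewrite /minus_word letters_eshape //.
have kp : north_pos b n < size p by rewrite sp; move: kl; rewrite sb /k; lia.
have -> : north_pos p n = north_pos b n.
  apply/eqP; rewrite north_pos_eq //; last by lia.
  rewrite tp ?kc ?eqxx ?andbT; last by rewrite /k.
  rewrite (nth_map E) // /p nth_cat stk ltnS leqnn nth_take ?ltnSn //.
  by move: kN; rewrite (nth_map E) // => ->.
by rewrite -/k /p -{1}stk take_size_cat // -{1}stk drop_size_cat // stk -bE.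
Qed.

Lemma zetaD_onto b : signed_ballot_path n b ->
  exists p, signed_lattice_path n p /\ zetaD n p = b.
Proof.
move=> bB; have zu : uniq (map (zetaD n) lattice_list).
  rewrite map_inj_in_uniq ?uniq_lattice_list // => p q pl ql.
  by apply: zetaD_inj => //; apply: lattice_list_path.
have sub : {subset map (zetaD n) lattice_list <= ballot_list}.
  move=> c /mapP[p pl ->]; apply: mem_ballot_list.
  by apply: zetaD_signed_ballot => //; apply: lattice_list_path.
have [|_ e] := uniq_min_size zu sub.
  by rewrite size_map size_lattice_list size_ballot_list.
have := mem_ballot_list bB; rewrite -e => /mapP[p pl ->].
by exists p; split=> //; apply: lattice_list_path.
Qed.

End Counting.

End Counts.

(** * The bijection *)

Lemma exprN1z_even (c : int) : (-1) ^ (2 * c) = 1 :> int.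
Proof. by rewrite -exprz_exp -[(-1) ^ 2]/((-1) ^+ 2) sqrrN expr1n exp1rz. Qed.

Lemma exprN1z_odd (c : int) : (-1) ^ (2 * c + 1) = -1 :> int.
Proof. by rewrite exprzDr ?unitrN1 // exprN1z_even expr1z mul1r. Qed.

Lemma prod_sg (s : seq int) : all (fun x => x != 0) s ->
  \prod_(x <- s) Num.sg x = (-1) ^+ odd (count (fun x : int => x < 0) s).
Proof.
elim: s => [|x s IH] /=; first by rewrite big_nil.
case/andP=> x0 /IH e; rewrite big_cons e oddD signr_addb oddb; congr (_ * _).
by case: (ltrgtP x 0) x0 => // x0 _; [rewrite ltr0_sg | rewrite gtr0_sg].
Qed.

Section Assembly.
Variables (n : nat) (p : seq letter).
Hypothesis n3 : (2 < n)%N.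
Hypothesis pL : signed_lattice_path n p.
Local Notation m := (mrow n p).
Local Notation a := (easts_before p).

Lemma lead_signE :
  eps p * (-1) ^ (1 + nu n n.-1 + nu n n) = lead_sign n p.
Proof.
rewrite /nu /lead_sign ltnn (_ : (n.-1 < n)%N); last by lia.
case: (cond03 n).
  rewrite (_ : 1 + _ + _ = 2 * (n%:Z - 1)); last by lia.
  by rewrite exprN1z_even mulr1.
rewrite (_ : 1 + _ + _ = 2 * (n%:Z - 1) + 1); last by lia.
by rewrite exprN1z_odd mulrN1.
Qed.

Lemma last_signE :
  (-1) ^ (1 + mu n p n.-1 + mu n p n) = if last_flag n p then 1 else -1 :> int.
Proof.
have e := mrow_pair n3 pL; rewrite /mrow in e.
have e1 : n.-2.+1 = n.-1 by lia.
have e2 : n.-1.+1 = n by lia.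
rewrite e1 e2 in e; rewrite -addrA e; case: (last_flag n p).
  by rewrite (_ : 1 + _ = 2 * ((a n)%:Z - n%:Z + 2)) ?exprN1z_even //; lia.
rewrite (_ : 1 + _ = 2 * (1 - ((a n)%:Z - (a n.-1)%:Z)) + 1) ?exprN1z_odd //; lia.
Qed.

(** The exponent has the parity of the sum that defines [lam], so the sign required of vertical
    labels is the product of all the row signs. *)
Lemma vert_signE : eps p * (-1) ^ (lam n p n.-1 + lam n p n) =
  lead_sign n p * (if last_flag n p then 1 else -1).
Proof.
rewrite /lam; have -> : (n.-1 == 1)%N = false by lia.
have -> : (n == 1)%N = false by lia.
have -> : (n.-1 < n)%N by lia.
rewrite ltnn /lead_sign /last_flag; case: (odd _) => /=.
  rewrite (_ : (a n.-1)%:Z + _ = 2 * (n%:Z - 1 - (a n)%:Z + (a n.-1)%:Z) + 1); last by lia.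
  by rewrite exprN1z_odd; case: (cond03 n); rewrite /= ?mulr1 ?mulrN1.
rewrite (_ : (a n.-1)%:Z + _ = 2 * (a n)%:Z); last by lia.
by rewrite exprN1z_even; case: (cond03 n); rewrite /= ?mulr1 ?mulrN1 ?opprK.
Qed.

Lemma row_signE (i : 'I_n) : row_sign n p i.+1 = (-1) ^+ row_neg n p i.
Proof.
rewrite /row_sign last_signE lead_signE /row_neg eqSS.
have ii := ltn_ord i; have -> : (i.+1 == n) = (i == n.-1 :> nat) by lia.
case: (eqVneq (i : nat) n.-1) => e.
  have -> : (i == 0 :> nat)%N = false by lia.
  by rewrite mulr1; case: (last_flag n p).
by rewrite mul1r; case: (i == 0 :> nat)%N => //; case: (lead_sign_cases n p) => ->.
Qed.

Variable v : {perm pm n}.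
Hypothesis vB : v \in SB n.
Local Notation w := (place_perm n3 pL * v)%g.

Lemma lab_sign x : lab p v x = row_sign n p (x.2 : nat).+1 * pm_val (v x).
Proof.
rewrite row_signE /lab /tw; case: x => b i /=.
case: (row_neg n p i); last by rewrite addbF mul1r.
by rewrite addbT -[(~~ b, i)]/(pm_opp (b, i)) SB_opp // pm_val_opp mulN1r.
Qed.

Lemma place_SB : w \in SB n.
Proof.
rewrite inE; apply/forallP => x; apply/eqP.
by rewrite !permM (SB_opp _ (place_perm_SB n3 pL)) SB_opp.
Qed.

Lemma window_enum (u : {perm pm n}) :
  window u = [seq pm_val (u (false, i)) | i <- enum 'I_n].
Proof.
rewrite /window iota_enum -map_comp; apply: eq_map => i /=.
by rewrite -sapp_pm pm_valE.
Qed.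

Lemma window_place : window w = dD p v.
Proof.
have sE : [seq row_sign n p jx.1 * jx.2 | jx <- rows_word p v] =
    map (lab p v) (reading n p).
  by rewrite rows_wordE // -map_comp; apply: eq_map => x; rewrite /= lab_sign.
rewrite window_enum /dD sE.
have sr := size_reading n3 pL.
apply: (@eq_from_nth _ 0) => [|i].
  rewrite size_map size_enum_ord -[LHS]sr.
  case: (odd_pos_area n p); last by rewrite size_map.
  by case: (reading n p) => //= x l; rewrite size_map.
rewrite size_map size_enum_ord => ii; rewrite (nth_map (Ordinal ii)) ?size_enum_ord //.
have -> : nth (Ordinal ii) (enum 'I_n) i = Ordinal ii.
  by apply: val_inj; rewrite /= nth_enum_ord.
rewrite place_label //= /flip0; case: (odd_pos_area n p) => /=; last first.
  by rewrite (nth_map (false, Ordinal ii)) ?sr.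
case: (reading n p) sr => [|x l] /= sr; first by lia.
by case: i ii => [|i] ii //=; rewrite (nth_map (false, Ordinal ii)) //; lia.
Qed.

Lemma rows_perm : perm_eq (map snd (reading n p)) (enum 'I_n).
Proof.
have sr := size_reading n3 pL.
have u : uniq (map snd (reading n p)).
  rewrite map_inj_in_uniq ?(uniq_reading n3 pL) // => x y.
  rewrite !mem_reading // => x0 y0 /pm_same_row[//|e].
  by move: y0; rewrite e ckey_opp; lia.
apply: uniq_perm => //; first exact: enum_uniq.
have sub : {subset map snd (reading n p) <= enum 'I_n} by move=> i _; rewrite mem_enum.
have le : (size (enum 'I_n) <= size (map snd (reading n p)))%N.
  by rewrite [X in (_ <= X)%N]size_map sr size_enum_ord.
by have [_] := uniq_min_size u sub le.
Qed.

Lemma sg_pm (x : pm n) : pm_val x != 0.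
Proof. by have [] := pm_val_bound x. Qed.

Lemma prod_window (u : {perm pm n}) : \prod_(x <- window u) Num.sg x =
  (-1) ^+ odd (count (fun x : int => x < 0) (window u)).
Proof.
by apply: prod_sg; rewrite window_enum; apply/allP => x /mapP[i _ ->]; apply: sg_pm.
Qed.

Lemma prod_rows : \prod_(i <- enum 'I_n) (-1) ^+ row_neg n p i =
  lead_sign n p * (if last_flag n p then 1 else -1).
Proof.
have i0 : (0 < n)%N by lia.
have il : (n.-1 < n)%N by lia.
rewrite big_enum /= (bigD1 (Ordinal i0)) //= (bigD1 (Ordinal il)) /=; last first.
  by apply/eqP => /(congr1 val) /=; lia.
rewrite big1 ?mulr1 => [|i /andP[i1 i2]].
  congr (_ * _); first by rewrite row_neg0 //; case: (lead_sign_cases n p) => ->.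
  by rewrite row_neg_last; case: (last_flag n p).
rewrite row_neg_mid // lt0n; apply/andP; split.
  by apply: contraNneq i1 => e; apply/eqP/val_inj.
have := ltn_ord i; have : (i : nat) != n.-1; last by lia.
by apply: contraNneq i2 => e; apply/eqP/val_inj.
Qed.

Lemma prod_flip : \prod_(i < n) (-1) ^+ flip0 n p i = (-1) ^+ odd_pos_area n p :> int.
Proof.
have i0 : (0 < n)%N by lia.
rewrite (bigD1 (Ordinal i0)) //= /flip0 eqxx andbT big1 ?mulr1 // => i i1.
rewrite (_ : (i == 0 :> nat)%N = false) ?andbF //; apply: contraNF i1 => /eqP e.
by apply/eqP/val_inj.
Qed.

(** The minus signs of the reading word and the sign change of the first entry cancel in the
    product, by [odd_areaE]; what remains are the row signs, each row being read once. *)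
Lemma prod_window_place : \prod_(x <- window w) Num.sg x =
  lead_sign n p * (if last_flag n p then 1 else -1) * \prod_(x <- window v) Num.sg x.
Proof.
have i0 : (0 < n)%N by lia.
pose x0 : pm n := (true, Ordinal i0).
have sr := size_reading n3 pL.
have E1 : \prod_(x <- reading n p) (-1) ^+ x.1 = (-1) ^+ odd_pos_area n p :> int.
  rewrite odd_areaE // signr_odd; elim: (reading n p) => [|x l IH]; first by rewrite big_nil.
  by rewrite big_cons IH /= exprD.
rewrite !window_enum 2!big_map.
transitivity (\prod_(i < n) ((-1) ^+ flip0 n p i * Num.sg (lab p v (nth x0 (reading n p) i)))).
  rewrite big_enum /=; apply: eq_bigr => i _; rewrite place_label //=.
  rewrite (set_nth_default x0) ?sr //.
  by case: (flip0 n p i); rewrite ?sgrN ?mulN1r ?mul1r.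
rewrite big_split /= prod_flip.
have -> : \prod_(i < n) Num.sg (lab p v (nth x0 (reading n p) i)) =
    \prod_(x <- reading n p) Num.sg (lab p v x).
  by rewrite (big_nth x0) big_mkord sr.
have -> : \prod_(x <- reading n p) Num.sg (lab p v x) =
    \prod_(x <- reading n p) ((-1) ^+ x.1 * ((-1) ^+ row_neg n p x.2 *
      Num.sg (pm_val (v (false, x.2))))).
  apply: eq_bigr => -[b i] _; rewrite lab_val // /val_row /=.
  have -> : (i.+1)%:Z = pm_val (false, i) by rewrite pm_valE.
  rewrite sapp_pm; case: b; case: (row_neg n p i) => /=;
    by rewrite ?sgrN ?mulN1r ?mul1r ?opprK.
rewrite big_split /= E1 mulrA -expr2 -exprM mulnC exprM sqrrN expr1n mul1r.
rewrite -(big_map snd xpredT (fun i : 'I_n => (-1) ^+ row_neg n p i * Num.sg (pm_val (v (false, i))))).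
by rewrite (perm_big _ rows_perm) /= big_split /= prod_rows.
Qed.

Lemma place_SD : (w \in SD n) =
  (\prod_(1 <= i < n.+1) Num.sg (sapp v i%:Z) ==
     eps p * (-1) ^ (lam n p n.-1 + lam n p n)).
Proof.
have -> : \prod_(1 <= i < n.+1) Num.sg (sapp v i%:Z) = \prod_(x <- window v) Num.sg x.
  by rewrite /window big_map /index_iota subn1.
rewrite vert_signE inE place_SB /=.
have := prod_window_place; rewrite (prod_window w) (prod_window v).
case: (odd _); case: (odd _); case: (lead_sign_cases n p) => ->; case: (last_flag n p) => //=.
Qed.

Lemma rise_condE :
  reflect (rise_cond p v)
    (all (fun i : nat => sapp v i%:Z < sapp v i.+1%:Z) (rises p) &&
     ((take 2 p == [:: N; N]) ==> (`|sapp v 1| < sapp v 2))).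
Proof.
apply: (iffP andP) => [[/allP h1 /implyP h2]|[h1 h2]].
  split=> [i ii ai|a1 a2].
    have := h1 i; rewrite mem_rises (path_norths pL) ii ai eqxx => /(_ isT).
    by rewrite /val_row prednK //; lia.
  by apply: h2; rewrite (take2_NN n3 pL) a1 a2.
split.
  apply/allP => i; rewrite mem_rises (path_norths pL) => /andP[ii /eqP ai].
  by have := h1 i ii ai; rewrite /val_row prednK //; lia.
by apply/implyP; rewrite (take2_NN n3 pL) => /andP[/eqP a1 /eqP a2]; apply: h2.
Qed.

(** Being an equality, it serves both ways: it makes the map well defined, and it shows that the
    preimage of a diagonal labelling is a vertical one. *)
Lemma vert_diag : is_vert (p, v) = is_diag (zetaD n p, w).
Proof.
rewrite /is_vert /is_diag pL vB (zetaD_signed_ballot n3 pL) place_SD /=.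
rewrite [RHS]andbC -/(diag_cond p w) !andbA; congr andb.
have wE := place_label n3 pL _ vB.
apply/rise_condE/idP => h.
  by apply: (floors_diag (v := v)) => //; [exact: place_SB | exact: rises_floors].
by apply: floors_rises => //; apply: (diag_floors (w := w)) => //; exact: place_SB.
Qed.

End Assembly.

Lemma place_perm_eq n p (n3 : (2 < n)%N) (h h' : signed_lattice_path n p) :
  place_perm n3 h = place_perm n3 h'.
Proof. by apply/permP => x; rewrite !permE. Qed.

Lemma vert_path n x : @is_vert n x -> signed_lattice_path n x.1.
Proof. by case: x => p v /and3P[]. Qed.

Lemma vert_SB n x : @is_vert n x -> x.2 \in SB n.
Proof. by case: x => p v /and3P[]. Qed.

Theorem theorem5p22 (n : nat) (hn : (3 <= n)%N) :
  exists f : Vert n -> Diag n,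
    (forall x : Vert n,
       (sval (f x)).1 = zetaD n (sval x).1
       /\ window (sval (f x)).2 = dD (sval x).1 (sval x).2)
    /\ bijective f.
Proof.
pose F (x : Vert n) : seq letter * {perm pm n} :=
  (zetaD n (sval x).1, (place_perm hn (vert_path (svalP x)) * (sval x).2)%g).
have FP x : is_diag (F x).
  case: x => -[p v] xv.
  have e (h : signed_lattice_path n p) : is_diag (zetaD n p, (place_perm hn h * v)%g).
    by rewrite -vert_diag //; exact: vert_SB xv.
  exact: e.
pose f x : Diag n := exist _ (F x) (FP x).
exists f; split=> [[[p v] xv]|].
  by split=> //=; apply: window_place; exact: vert_SB xv.
have f_inj : injective f.
  move=> [[p v] xv] [[q u] xu] /(congr1 sval); rewrite /f /F /= => -[e1].
  have pL := vert_path xv; have qL := vert_path xu.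
  have epq : p = q by exact: (zetaD_inj hn pL qL e1).
  subst q.
  move: (vert_path (svalP _)) (vert_path (svalP _)) => /= h h'.
  rewrite (place_perm_eq hn h h') => /mulgI e2; subst u.
  by apply: val_inj.
have f_onto y : exists x, f x == y.
  case: y => -[b w] yd; have [bB wD _] := and3P yd.
  have [p [pL pb]] := zetaD_onto hn bB; subst b.
  have rB := place_perm_SB hn pL.
  have wB : w \in SB n by move: wD; rewrite inE => /andP[].
  (* On labels the map is a left translation, which is undone here. *)
  pose v := ((place_perm hn pL)^-1 * w)%g.
  have vB : v \in SB n.
    rewrite inE; apply/forallP => x; apply/eqP; rewrite !permM -SB_opp //; congr (w _).
    by apply: (@perm_inj _ (place_perm hn pL)); rewrite permKV SB_opp // permKV.
  have xv : is_vert (p, v) by rewrite (vert_diag hn pL vB) mulKVg.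
  exists (exist _ (p, v) xv); apply/eqP; apply: val_inj; rewrite /f /F /=.
  by rewrite (place_perm_eq hn _ pL) mulKVg.
exists (fun y => xchoose (f_onto y)) => [x|y]; last exact/eqP/(xchooseP (f_onto y)).
by apply: f_inj; apply/eqP/(xchooseP (f_onto (f x))).
Qed.
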